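(* The symmetric matrix-valued Gegenbauer polynomials satisfy $$\frac{d\hat P^{(\nu)}_n}{dx}(x)\,C-C^t\,\frac{d\hat P^{(\nu)}_n}{dx}(x)=-2[V,\hat P^{(\nu)}_n(x)].$$ In turn, the matrices $F^{(\nu)}_{k,n}$ satisfy $$F^{(\nu)}_{k,n}C-C^tF^{(\nu)}_{k,n}=\frac{1}{\nu+2\ell+n-k-1}[F^{(\nu)}_{k+1,n},V]-\frac{1}{\nu+2\ell+n-k+1}[F^{(\nu)}_{k-1,n},V].$$
   Context: $\mathbb N=\{0,1,2,\dots\}$; $\ell\in\frac12\mathbb N$ and real $\nu>0$ are fixed, $n\in\mathbb N$, and $k\in\{0,1,\dots,2\ell\}$. $(a)_k=\Gamma(a+k)/\Gamma(a)$ is the Pochhammer symbol. The scalar Gegenbauer polynomials are $C_n^{(\nu)}(x)=\sum_{k=0}^{\lfloor n/2\rfloor}(-1)^k\frac{\Gamma(\nu+n-k)}{k!\,(n-2k)!\,\Gamma(\nu)}(2x)^{n-2k}$. All matrices have size $(2\ell+1)\times(2\ell+1)$, with rows and columns indexed by $0,1,\dots,2\ell$; $\mathbf 1$ is the identity matrix, $E_{i,j}$ the matrix unit with $1$ in position $(i,j)$, ${}^t$ the transpose, ${}^*$ the conjugate transpose, and $[X,Y]=XY-YX$. Matrix weight: for $x\in(-1,1)$, $W^{(\nu)}(x)$ is the (symmetric, positive definite) matrix with entries $$(W^{(\nu)}(x))_{i,j}=(1-x^2)^{\nu-\frac12}\sum_{k=\max(0,i+j-2\ell)}^{\min(i,j)}\alpha_k(i,j)\,C^{(\nu)}_{i+j-2k}(x),$$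 $$\alpha_k(i,j)=(-1)^k\frac{i!\,j!\,(i+j-2k)!}{k!\,(2\nu)_{i+j-2k}(\nu)_{i+j-k}}\,\frac{(\nu)_{i-k}(\nu)_{j-k}}{(i-k)!\,(j-k)!}\,\frac{i+j-2k+\nu}{i+j-k+\nu}\,\frac{(2\ell-i)!\,(2\ell-j)!}{(2\ell+k-i-j)!}\,(-2\ell-\nu)_k\,\frac{2\ell+\nu}{(2\ell)!},$$ where $(-2\ell-\nu)_k$ means $\prod_{s=0}^{k-1}(-2\ell-\nu+s)$. The monic matrix-valued Gegenbauer polynomials $P_n^{(\nu)}(x)=x^n\mathbf 1+(\text{lower order terms with matrix coefficients})$, $n\in\mathbb N$, are the unique monic matrix polynomials with $\int_{-1}^1P_n^{(\nu)}(x)W^{(\nu)}(x)P_m^{(\nu)}(x)^{*}\,dx=0$ for $n\neq m$. The symmetric matrix-valued Gegenbauer polynomials are $\hat P_n^{(\nu)}(x)=D_n^{(\nu)}P_n^{(\nu)}(x)$, where $D_n^{(\nu)}$ is the diagonal matrix with $(D_n^{(\nu)})_{i,i}=\binom{2\ell}{i}\frac{(\nu+n)_i}{(\nu+n+2\ell-i)_i}$. The constant matrices are $$C=\sum_{i=0}^{2\ell-1}(2\ell-i)E_{i,i+1}+\sum_{i=1}^{2\ell}i\,E_{i,i-1},\qquad V=-\sum_{i=0}^{2\ell}i(2\ell-i)E_{i,i}.$$ For every $k\in\{0,1,\dots,2\ell\}$ and every $n\in\mathbb N$ (including $k>n$) the matrix $F^{(\nu)}_{k,n}$ has entries $(F^{(\nu)}_{k,n})_{i,j}=\frac{n!\,\Gamma(\nu+2\ell)}{2^n}\gamma(\nu+n;i,j,k)$,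 where $$\gamma(\nu;i,j,k)=(-1)^k(\nu+2\ell)(\nu+2\ell-k)\binom{2\ell}{k}\binom{k}{\frac12(k+i-j)}\binom{2\ell-k}{\frac12(i+j-k)}\frac{\Gamma(\nu-\frac12(k-i-j))\,\Gamma(\nu+2\ell-\frac12(k+i+j))}{\Gamma(\nu)\,\Gamma(\nu+2\ell+1-\frac12(k-i+j))\,\Gamma(\nu+2\ell+1-\frac12(k+i-j))}$$ if $i+j\equiv k\pmod2$ and $\gamma(\nu;i,j,k)=0$ otherwise. Binomial coefficients $\binom ab$ are zero unless $0\le b\le a$, and $\gamma$ is zero whenever a binomial factor vanishes. For the boundary indices, $F^{(\nu)}_{-1,n}=F^{(\nu)}_{2\ell+1,n}=0$, and the corresponding commutator terms are omitted. These matrices give the expansion $\hat P_n^{(\nu)}(x)=\sum_{k=0}^{\min(n,2\ell)}F^{(\nu)}_{k,n}C^{(\nu+2\ell)}_{n-k}(x)$. *)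

(* Defs.v *)
From HB Require Import structures.
From mathcomp Require Import all_boot all_order all_algebra.
From mathcomp Require Import all_classical all_reals all_analysis.
From mathcomp Require Import complex.

Set Implicit Arguments.
Unset Strict Implicit.
Unset Printing Implicit Defensive.

Import Order.TTheory GRing.Theory Num.Theory.
Import numFieldNormedType.Exports.

Local Open Scope classical_set_scope.
Local Open Scope ring_scope.
Local Open Scope complex_scope.

(* The half-integer ell enters only through the natural number L = 2 ell;
   matrices have size L + 1, with rows and columns indexed by 0, ..., L. *)

(* Meaningful for x > 0, where the integral converges.  All the values of Gamma
   below that contribute to a nonzero term are taken at positive arguments. *)
Definition Gamma (R : realType) (x : R) : R :=
  \int[@lebesgue_measure R]_(t in `]0, +oo[) (t `^ (x - 1) * expR (- t)).

Definition pochhammer (R : realType) (a : R) (k : nat) : R :=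
  Gamma (a + k%:R) / Gamma a.

(* Binomial coefficient that vanishes unless 0 <= b <= a. *)
Definition binz (a : nat) (b : int) : nat :=
  match b with Posz m => 'C(a, m) | Negz _ => 0 end.

Definition gegenbauer (R : realType) (nu : R) (n : nat) : {poly R} :=
  \sum_(0 <= k < (n./2).+1)
    ((-1) ^+ k * Gamma (nu + (n - k)%:R)
       / ((k`!)%:R * ((n - 2 * k)`!)%:R * Gamma nu)) *: (2%:R *: 'X) ^+ (n - 2 * k).

(* Used only for max(0, i + j - L) <= k <= min(i, j), where none of the
   subtractions of natural numbers is truncated.  The first argument of
   (-2 ell - nu)_k is negative, so that symbol is the explicit product. *)
Definition alpha (R : realType) (L : nat) (nu : R) (k i j : nat) : R :=
  (-1) ^+ k
  * (((i`!) * (j`!) * ((i + j - 2 * k)`!))%:R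
      / ((k`!)%:R * pochhammer (2 * nu) (i + j - 2 * k)
           * pochhammer nu (i + j - k)))
  * (pochhammer nu (i - k) * pochhammer nu (j - k)
      / ((i - k)`! * (j - k)`!)%:R)
  * (((i + j - 2 * k)%:R + nu) / ((i + j - k)%:R + nu))
  * (((L - i)`! * (L - j)`!)%:R / ((L + k - (i + j))`!)%:R)
  * (\prod_(0 <= s < k) (- L%:R - nu + s%:R))
  * ((L%:R + nu) / (L`!)%:R).

(* The lower bound i + j - L is a truncated subtraction: max(0, i + j - L). *)
Definition weight (R : realType) (L : nat) (nu : R) (x : R) : 'M[R]_L.+1 :=
  \matrix_(i, j)
    ((1 - x ^+ 2) `^ (nu - 2^-1)
     * \sum_(i + j - L <= k < (minn i j).+1)
         alpha L nu k i j * (gegenbauer nu (i + j - 2 * k)).[x]).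

Definition cmxintegral (R : realType) (m : nat) (D : set R)
    (f : R -> 'M[R[i]]_m) : 'M[R[i]]_m :=
  \matrix_(i, j)
    ((\int[@lebesgue_measure R]_(x in D) complex.Re (f x i j))
     +i* (\int[@lebesgue_measure R]_(x in D) complex.Im (f x i j))).

Definition conjtrmx (R : rcfType) (m : nat) (A : 'M[R[i]]_m) : 'M[R[i]]_m :=
  map_mx (fun z : R[i] => z^*) A^T.

(* Value at a real point of a polynomial with complex matrix coefficients. *)
Definition mxpoly_at (R : rcfType) (m : nat) (p : {poly 'M[R[i]]_m.+1}) (x : R) :
    'M[R[i]]_m.+1 :=
  p.[(x%:C)%:M].

Definition monic_mvgegenbauer (R : realType) (L : nat) (nu : R)
    (P : nat -> {poly 'M[R[i]]_L.+1}) : Prop :=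
  (forall n, size (P n) = n.+1 /\ P n \is monic) /\
  (forall n m, n <> m ->
     cmxintegral `]-1, 1[ (fun x : R =>
       mxpoly_at (P n) x *m map_mx (real_complex R) (weight L nu x)
         *m conjtrmx (mxpoly_at (P m) x)) = 0).

Definition Dmx (R : realType) (L : nat) (nu : R) (n : nat) : 'M[R]_L.+1 :=
  \matrix_(i, j)
    (('C(L, i)%:R * pochhammer (nu + n%:R) i
       / pochhammer (nu + n%:R + L%:R - i%:R) i) *+ (i == j)).

Definition sym_mvgegenbauer (R : realType) (L : nat) (nu : R)
    (P : nat -> {poly 'M[R[i]]_L.+1}) (n : nat) : {poly 'M[R[i]]_L.+1} :=
  (map_mx (real_complex R) (Dmx L nu n))%:P * P n.

Definition Cmx (K : nzRingType) (L : nat) : 'M[K]_L.+1 :=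
  \matrix_(i, j) ((L - i)%:R *+ (j == i.+1 :> nat) + i%:R *+ (i == j.+1 :> nat)).

Definition Vmx (K : nzRingType) (L : nat) : 'M[K]_L.+1 :=
  \matrix_(i, j) (- (i * (L - i))%:R *+ (i == j)).

Definition mxbracket (K : nzRingType) (m : nat) (X Y : 'M[K]_m) : 'M[K]_m :=
  X *m Y - Y *m X.

(* gamma(nu; i, j, k); the integer divisions by 2 are exact by the parity test. *)
Definition gamma_coef (R : realType) (L : nat) (nu : R) (i j k : nat) : R :=
  if i + j == k %[mod 2] then
    (-1) ^+ k * (nu + L%:R) * (nu + L%:R - k%:R)
    * 'C(L, k)%:R
    * (binz k ((k%:Z + i%:Z - j%:Z) %/ 2)%Z)%:R
    * (binz (L - k) ((i%:Z + j%:Z - k%:Z) %/ 2)%Z)%:R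
    * (Gamma (nu - (k%:R - i%:R - j%:R) / 2)
       * Gamma (nu + L%:R - (k%:R + i%:R + j%:R) / 2)
       / (Gamma nu
          * Gamma (nu + L%:R + 1 - (k%:R - i%:R + j%:R) / 2)
          * Gamma (nu + L%:R + 1 - (k%:R + i%:R - j%:R) / 2)))
  else 0.

Definition Fmx (R : realType) (L : nat) (nu : R) (k n : nat) : 'M[R]_L.+1 :=
  \matrix_(i, j)
    ((n`!)%:R * Gamma (nu + L%:R) / 2 ^+ n * gamma_coef L (nu + n%:R) i j k).

(* Main.v *)
(* The first identity is proved without the expansion in Gegenbauer polynomials.
   Up to a scalar, the weight is (1 - x^2)^(nu - 1/2) W_nu with W_nu polynomial, and
   - X_nu W_nu = W_nu X_nu^t for a matrix X_nu = const + 4 x V, where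
     X_(nu+1) = X_nu + 2 C;
   - a matrix Pearson equation holds: W_nu Phi = (1 - x^2) W_(nu+1), and W_nu Psi is
     the corresponding derivative of (1 - x^2) W_(nu+1), with deg Phi <= 2 and
     deg Psi <= 1, so that H' is orthogonal for nu + 1 when H is orthogonal for nu.
   For H with H W_nu orthogonal to all degrees < n put
     S(H) = H' C - C^t H' + 2 [V, H]  and  T_nu(H) = H X_nu - X_nu^t H.
   Then S(H)' = S(H') and T_nu(H)' = T_(nu+1)(H') - 2 S(H), so by induction on n
   S(H) is a constant K and T_nu(H) = K0 - 2 x K.  But T_nu(H) is again orthogonal
   to all degrees < n, which forces K = 0 for n >= 2; for n = 1 this is a computation
   with the first moments.  The normalization D_n makes the induction start.

   For the second identity, gamma(nu; i, j, k) factors as a product of one-variable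
   functions f(a) f(k - a) g(b) g(2 l - k - b) with a = (k + i - j) / 2 and
   b = (i + j - k) / 2; the contiguity relations of f and g turn the identity into a
   polynomial one. *)
Require Import Defs.
From HB Require Import structures.
From mathcomp Require Import all_boot all_order all_algebra.
From mathcomp Require Import all_classical all_reals all_analysis.
From mathcomp Require Import complex.
From mathcomp Require Import measurable_realfun zify ring lra.

Set Implicit Arguments.
Unset Strict Implicit.
Unset Printing Implicit Defensive.

Import Order.TTheory GRing.Theory Num.Theory.
Import numFieldNormedType.Exports.

Local Open Scope ring_scope.

(** * Improper integrals over an open interval *)

(** The analysis is confined to the functional equation of Gamma and a few properties of the moments
    of (1 - x^2)^(nu - 1/2): linearity, positivity on 1, passage to nu + 1 through the factor 1 -
    x^2, and vanishing on total derivatives. The rest is algebra. The induction lowers n and raises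
    nu, so nu + n stays fixed. The condition imposed on the leading coefficients d_i of H is a
    homogeneous first-order recurrence in i whose coefficients depend on nu + n alone; it survives
    differentiation, and the diagonal of D_n solves it. T_nu(H) stays orthogonal because only the
    term 4 x V of X_nu raises degrees: it contributes 4 (V_jj - V_ii) times the n-th moment of H
    W_nu at (i, j), and that moment matrix is diagonal. Diagonality is proved by differentiating
    down to n = 0, which needs the top coefficients of Phi and Psi to be diagonal and negative. The
    obstacle in the weight is the summation range, which varies with i and j: the coefficients are
    extended to all integers, so that identities can be compared term by term. The P_n may have
    complex coefficients; since the weight is real, real and imaginary parts satisfy the same real
    orthogonality and are treated separately. *)

Section improper_FTC.
Local Open Scope classical_set_scope.
Local Open Scope ring_scope.
Variables (R : realType) (D : set R) (u v : nat -> R) (f F : R -> R).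
Local Notation mu := (@lebesgue_measure R).
Hypothesis uv : forall n, u n < v n.
Hypothesis DE : D = \bigcup_n `[u n, v n]%classic.
Hypothesis nd : nondecreasing_seq (fun n => `[u n, v n]%classic : set R).
Hypothesis Ff : forall x, D x -> is_derive x 1 F (f x).
Hypothesis cf : forall x, D x -> {for x, continuous f}.

Let sD n : `[u n, v n]%classic `<=` D.
Proof. by rewrite DE => x xn; exists n. Qed.

Let mD : measurable D.
Proof. by rewrite DE; apply: bigcupT_measurable => n; exact: measurable_itv. Qed.

Let mI n : measurable `[u n, v n]%classic.
Proof. exact: measurable_itv. Qed.

Let cfn n : {within `[u n, v n], continuous f}.
Proof.
by apply: continuous_in_subspaceT => x; rewrite inE => /sD; exact: cf.
Qed.

Let segment_FTC n :
  (\int[mu]_(x in `[u n, v n]) (f x)%:E = (F (v n) - F (u n))%:E)%E.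
Proof.
rewrite EFinB; apply: continuous_FTC2 => //.
- have cF : {within `[u n, v n], continuous F}.
    apply: derivable_within_continuous => x xn.
    by have [] := Ff (sD xn).
  have /(continuous_within_itvP _ (uv n))[? ? ?] := cF.
  split => // x xn.
  have xn' : `[u n, v n]%classic x by exact: subset_itv_oo_cc xn.
  by have [] := Ff (sD xn').
- move=> x xn; have xn' : `[u n, v n]%classic x by exact: subset_itv_oo_cc xn.
  by have H := Ff (sD xn'); rewrite derive1E derive_val.
Qed.

Let mf : measurable_fun D f.
Proof.
rewrite DE; apply/(measurable_fun_bigcup _ mI) => n.
exact: subspace_continuous_measurable_fun.
Qed.

(** Monotone convergence along the segments, each of which contributes F (v n) - F (u n). *)
Lemma ge0_improper_integrable (M : R) : (forall x, D x -> 0 <= f x) ->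
  (forall n, F (v n) - F (u n) <= M) -> mu.-integrable D (EFin \o f).
Proof.
move=> f0 FM; apply/integrableP; split; first exact: measurableT_comp.
under eq_integral.
  move=> x; rewrite inE => Dx; rewrite /= ger0_norm ?f0//; over.
apply: (@le_lt_trans _ _ M%:E); last by rewrite ltry.
have H : (\int[mu]_(x in `[u n, v n]) (f x)%:E)%E @[n --> \oo] -->
   (\int[mu]_(x in D) (f x)%:E)%E.
  rewrite DE; apply: ge0_nondecreasing_set_cvg_integral => //.
  - move=> i; have mfE : measurable_fun D (EFin \o f) by exact/measurable_EFinP.
    exact: measurable_funS mD (@sD i) mfE.
  - by move=> i x xi; rewrite lee_fin f0//; apply: sD xi.
rewrite -(cvg_lim _ H)//; apply: lime_le; first by apply/cvg_ex; eexists; exact: H.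
by apply: nearW => n; rewrite segment_FTC lee_fin.
Qed.

(** Dominated convergence, with |f| as majorant, for the restrictions of f to the segments. *)
Lemma improper_FTC (l : R) : mu.-integrable D (EFin \o f) ->
  F (v n) - F (u n) @[n --> \oo] --> l -> \int[mu]_(x in D) f x = l.
Proof.
move=> fi Fl.
have H : (\int[mu]_(x in D) ((f \_ `[u n, v n]%classic) x)%:E)%E @[n --> \oo] -->
   (\int[mu]_(x in D) (f x)%:E)%E.
  apply: (@dominated_cvg _ _ _ mu D mD _ _ (fun x => `|(f x)%:E|%E)).
  - move=> n; apply/measurable_EFinP.
    apply/(measurable_restrict _ (mI n) mD).
    by apply: measurable_funS mf => // x [].
  (* The segments increase to D, so at each point the restriction eventually equals f. *)
  - move=> x Dx; apply: cvg_near_cst.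
    move: (Dx); rewrite DE => -[N _ xN].
    near=> n; rewrite patchE ifT// inE.
    have /nd : (N <= n)%N by near: n; exact: nbhs_infty_ge.
    by rewrite subsetEset; apply.
  - by move=> x Dx.
  - exact: integrable_abse.
  - move=> n x Dx; rewrite patchE; case: ifPn => //= _.
    by rewrite normr0 lee_fin.
have H2 : (\int[mu]_(x in D) ((f \_ `[u n, v n]%classic) x)%:E)%E @[n --> \oo] --> l%:E.
  have -> : (fun n => (\int[mu]_(x in D) ((f \_ `[u n, v n]%classic) x)%:E)%E) =
            EFin \o (fun n => F (v n) - F (u n)).
    apply/funext => n /=; rewrite -segment_FTC.
    rewrite [RHS]integral_mkcond [LHS]integral_mkcond; apply: eq_integral => x _.
    rewrite !patchE; case: ifPn => xD; case: ifPn => xn //.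
    by exfalso; move: xD; rewrite notin_setE; apply; apply: (@sD n); rewrite inE in xn.
  by apply: cvg_EFin => //; exact: nearW.
by rewrite /Rintegral (cvg_unique _ H H2).
Unshelve. all: by end_near. Qed.

End improper_FTC.

Lemma is_derive1_1DpowR (R : realType) (a t : R) : 0 < 1 + t ->
  is_derive t 1 (fun s : R => (1 + s) `^ a) (a * (1 + t) `^ (a - 1)).
Proof.
move=> t10.
have H1 : is_derive t (1 : R) (fun s : R => 1 + s) 1.
  have := is_deriveD (is_derive_cst (1 : R) t (1 : R)) (is_derive_id t (1 : R)).
  by rewrite add0r.
have H2 := is_derive1_powR a t10.
by apply: (is_derive_eq (is_derive1_comp H2 H1)); rewrite mulr1.
Qed.

(** * The Gamma function *)

Section Gamma_function.
Local Open Scope classical_set_scope.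
Local Open Scope ring_scope.
Variable R : realType.
Local Notation mu := (@lebesgue_measure R).
Implicit Types x t : R.

Let u (n : nat) : R := n.+2%:R^-1.
Let v (n : nat) : R := n.+2%:R.

Let uv n : u n < v n.
Proof.
by rewrite /u /v (@lt_trans _ _ 1)// ?invf_lt1 ?ltr1n ?ltr0n.
Qed.

Let DE : `]0, +oo[%classic = \bigcup_n `[u n, v n]%classic.
Proof.
apply/seteqP; split => [x|x [n _]] /=; rewrite !in_itv/= ?andbT; last first.
  by move=> /andP[+ _]; apply: lt_le_trans; rewrite invr_gt0 ltr0n.
move=> x0; exists (Num.truncn (x + x^-1)) => //=.
have H : x + x^-1 <= v (Num.truncn (x + x^-1)).
  apply: le_trans (ltW (truncnS_gt _)) _.
  by rewrite ler_nat.
have xi : 0 < x^-1 by rewrite invr_gt0.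
rewrite in_itv /=; apply/andP; split; last by apply: le_trans H; rewrite lerDl ltW.
rewrite /u -(invrK x) lef_pV2 ?posrE ?invr_gt0 ?ltr0n//.
by rewrite invrK; apply: le_trans H; rewrite lerDr ltW.
Qed.

Let nd : nondecreasing_seq (fun n => `[u n, v n]%classic : set R).
Proof.
move=> m n mn; rewrite subsetEset; apply: subset_itv; rewrite bnd_simp.
  by rewrite lef_pV2 ?posrE ?ltr0n// ler_nat.
by rewrite ler_nat.
Qed.

Let is_derive_expN t : is_derive t 1 (fun s : R => expR (- s)) (- expR (- t)).
Proof.
apply: is_derive_eq; rewrite /GRing.scale/=. ring.
Qed.

(** With N > a, e^t = (e^(t/N))^N >= (1 + t/N)^N >= ((1 + t)/N)^N, which gives the constant K =
    N^N. *)
Let expR_dominates (a : R) : exists2 K : R, 0 < K &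
  forall t, 0 < t -> (1 + t) `^ a * expR (- t) <= K.
Proof.
set N := (Num.truncn a).+1.
have N0 : 0 < N%:R :> R by rewrite ltr0n.
exists (N%:R ^+ N); first by rewrite exprn_gt0.
move=> t t0; have t1 : 1 <= 1 + t by rewrite lerDl ltW.
have t10 : 0 <= 1 + t by apply: le_trans t1.
rewrite expRN ler_pdivrMr ?expR_gt0//.
apply: (@le_trans _ _ ((1 + t) `^ N%:R)).
  by rewrite ler_powR// ltW// truncnS_gt.
rewrite powR_mulrn//.
apply: (@le_trans _ _ ((N%:R * (1 + t / N%:R)) ^+ N)).
  rewrite lerXn2r ?nnegrE//.
    by rewrite mulr_ge0 ?addr_ge0 ?divr_ge0 ?ltW.
  by rewrite mulrDr mulr1 mulrCA divff ?gt_eqF// mulr1 lerD2r ler1n.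
rewrite exprMn ler_pM2l ?exprn_gt0//.
have -> : expR t = expR (t / N%:R) ^+ N.
  by rewrite -expRM_natl mulrC divfK ?gt_eqF.
by rewrite lerXn2r ?nnegrE ?expR_ge0 ?expR_ge1Dx// addr_ge0 ?divr_ge0 ?ltW.
Qed.

Lemma Gamma_integrable x : 0 < x ->
  mu.-integrable `]0, +oo[ (EFin \o (fun t => t `^ (x - 1) * expR (- t))).
Proof.
move=> x0.
(* [f0] is the derivative of (t / (1 + t))^x, which takes values in [0, 1]. It behaves like t^(x -
   1) at 0, and [expR_dominates] shows that a multiple of it dominates the integrand everywhere. *)
pose f0 t := x * (t `^ (x - 1) * (1 + t) `^ (- x - 1)).
pose F0 t := t `^ x * (1 + t) `^ (- x).
have dF t : `]0, +oo[%classic t -> is_derive t 1 F0 (f0 t).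
  rewrite /= in_itv/= andbT => t0.
  have t10 : 0 < 1 + t by rewrite addr_gt0.
  have H1 := is_derive1_powR x t0; have H2 := is_derive1_1DpowR (- x) t10.
  apply: is_derive_eq; rewrite /GRing.scale/= /f0.
  have -> : (1 + t) `^ (- x) = (1 + t) * (1 + t) `^ (- x - 1).
    by rewrite powRB ?(gt_eqF t10) ?implybT// powRr1 ?ltW// mulrC divfK ?gt_eqF.
  have -> : t `^ x = t * t `^ (x - 1).
    by rewrite powRB ?(gt_eqF t0) ?implybT// powRr1 ?ltW// mulrC divfK ?gt_eqF.
  ring.
have cf t : `]0, +oo[%classic t -> {for t, continuous f0}.
  rewrite /= in_itv/= andbT => t0.
  apply: differentiable_continuous; apply/derivable1_diffP.
  have t10 : 0 < 1 + t by rewrite addr_gt0.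
  have H1 := is_derive1_powR (x - 1) t0; have H2 := is_derive1_1DpowR (- x - 1) t10.
  by apply: derivableM => //; apply: derivableM.
have f0i : mu.-integrable `]0, +oo[ (EFin \o f0).
  apply: (@ge0_improper_integrable _ _ u v _ F0 uv DE nd dF cf 1).
  - by move=> t _; rewrite /f0 !mulr_ge0 ?powR_ge0// ltW.
  - move=> n; rewrite lerBlDr (@le_trans _ _ 1)//; last first.
      by rewrite lerDl mulr_ge0 ?powR_ge0.
    rewrite /F0 powRN ler_pdivrMr ?powR_gt0 ?addr_gt0 ?ltr0n// mul1r.
    by rewrite ge0_ler_powR ?nnegrE ?addr_ge0 ?ler0n ?ltW// ltrDr.
have [K K0 HK] := expR_dominates (x + 1).
have : mu.-integrable `]0, +oo[ (EFin \o (fun t => (K / x) * f0 t)).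
  have -> : EFin \o (fun t => (K / x) * f0 t) =
     (fun t => ((K / x)%:E * (EFin \o f0) t)%E) by apply/funext => t /=; rewrite EFinM.
  by apply: integrableZl.
apply: le_integrable => //.
  apply/measurable_EFinP; apply: measurable_funM.
    by apply: measurable_funTS; exact: measurable_powR.
  by apply: measurable_funTS; apply: measurableT_comp.
move=> t /=; rewrite in_itv/= andbT => t0; rewrite lee_fin !ger0_norm.
- rewrite /f0 mulrA divfK ?gt_eqF// mulrCA ler_pM2l ?powR_gt0//.
  have t10 : 0 < 1 + t by rewrite addr_gt0.
  rewrite -opprD powRN ler_pdivlMr ?powR_gt0// mulrC; exact: HK.
- by rewrite /f0 !mulr_ge0 ?powR_ge0 ?invr_ge0 ?ltW.
- by rewrite mulr_ge0 ?powR_ge0 ?expR_ge0.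
Qed.

Lemma Gamma_gt0 x : 0 < x -> 0 < Gamma x.
Proof.
move=> x0; have Gi := Gamma_integrable x0; have [mG _] := integrableP _ _ _ Gi.
(* On [1, 2], t^(x - 1) >= 1/t >= 1/2 and e^(-t) >= e^(-2), whatever the sign of x - 1. *)
have : ((2^-1 * expR (- 2%:R))%:E <= (Gamma x)%:E)%E.
  rewrite /Gamma /Rintegral fineK; last exact: integrable_fin_num.
  apply: (@le_trans _ _ (\int[mu]_(t in `[1%R, 2%R]) (2^-1 * expR (- 2%:R))%:E)%E).
    rewrite integral_cst//= lebesgue_measure_itv/= lte_fin ltr1n/=.
    by rewrite -EFinD -EFinM lee_fin; lra.
  apply: (@le_trans _ _ (\int[mu]_(t in `[1%R, 2%R]) (t `^ (x - 1) * expR (- t))%:E)%E).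
    apply: ge0_le_integral => //.
      by apply: measurable_funS mG => // t /=; rewrite !in_itv/= andbT => /andP[+ _]; apply: lt_le_trans.
    move=> t /=; rewrite in_itv/= => /andP[t1 t2]; rewrite lee_fin.
    have t0 : 0 < t by apply: lt_le_trans t1.
    apply: ler_pM; rewrite ?expR_ge0 ?ler_expR ?lerN2//.
    rewrite powRB ?(gt_eqF t0) ?implybT// powRr1 ?(ltW t0)//.
    apply: (@le_trans _ _ t^-1); first by rewrite lef_pV2 ?posrE.
    rewrite -[leLHS]mul1r ler_pM2r ?invr_gt0//.
    have <- : 1 `^ x = 1 :> R by rewrite powR1.
    apply: ge0_ler_powR => //; rewrite ?nnegrE//; exact: ltW.
  apply: ge0_subset_integral => //.
  - by move=> t _; rewrite lee_fin mulr_ge0 ?powR_ge0 ?expR_ge0.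
  - by move=> t /=; rewrite !in_itv/= andbT => /andP[+ _]; apply: lt_le_trans.
by rewrite lee_fin; apply: lt_le_trans; rewrite mulr_gt0 ?expR_gt0.
Qed.

(** Integration by parts: the primitive - t^x e^(-t) tends to 0 at both ends. *)
Lemma Gamma_rec x : 0 < x -> Gamma (x + 1) = x * Gamma x.
Proof.
move=> x0; have x10 : 0 < x + 1 by rewrite addr_gt0.
have Gi := Gamma_integrable x0; have Gi1 := Gamma_integrable x10.
rewrite addrK in Gi1.
pose F t := - (t `^ x * expR (- t)).
pose f t := t `^ x * expR (- t) - x * (t `^ (x - 1) * expR (- t)).
apply/eqP; rewrite -subr_eq0 /Gamma addrK -RintegralZl//; last first.
have xGi : mu.-integrable `]0, +oo[
    (EFin \o (fun t => x * (t `^ (x - 1) * expR (- t)))).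
  have -> : EFin \o (fun t => x * (t `^ (x - 1) * expR (- t))) =
     (fun t => (x%:E * (EFin \o (fun t => t `^ (x - 1) * expR (- t))%R) t)%E).
    by apply/funext => t /=; rewrite EFinM.
  by apply: integrableZl => //; exact: Gamma_integrable.
rewrite -RintegralB//; apply/eqP.
apply: (@improper_FTC _ _ u v f F uv DE nd).
- move=> t; rewrite /= in_itv/= andbT => t0.
  have H1 := is_derive1_powR x t0; have H2 := is_derive_expN t.
  by apply: is_derive_eq; rewrite /GRing.scale/= /f; ring.
- move=> t; rewrite /= in_itv/= andbT => t0.
  apply: differentiable_continuous; apply/derivable1_diffP.
  have H1 := is_derive1_powR x t0; have H2 := is_derive_expN t.
  have H3 := is_derive1_powR (x - 1) t0.
  apply: derivableB; first by apply: derivableM.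
  by apply: derivableM => //; apply: derivableM.
- have -> : EFin \o f = (fun t => (EFin \o (fun t => t `^ x * expR (- t))%R) t -
      (EFin \o (fun t => x * (t `^ (x - 1) * expR (- t)))%R) t)%E by [].
  exact: integrableB.
(* The exponent x + 1 leaves a spare factor: v^x e^(-v) <= K / v. *)
have [K K0 HK] := expR_dominates (x + 1).
have vlim : (v n)^-1 @[n --> \oo] --> (0 : R).
  by have := @cvg_harmonic R; rewrite -cvg_shiftS.
rewrite -[X in _ --> X](subrr 0); apply: cvgB.
  rewrite -[X in _ --> X]oppr0; apply: cvgN.
  apply: (@squeeze_cvgr _ _ _ _ (fun=> 0) (fun n => K * (v n)^-1)).
  - apply: nearW => n; rewrite mulr_ge0 ?powR_ge0 ?expR_ge0//=.
    have v0 : 0 < v n by rewrite ltr0n.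
    rewrite ler_pdivlMr//; apply: le_trans (HK _ v0).
    rewrite mulrAC ler_pM2r ?expR_gt0//.
    have v1 : 0 < 1 + v n by rewrite addr_gt0.
    rewrite powRD ?(gt_eqF v1) ?implybT// powRr1 ?(ltW v1)//.
    apply: ler_pM; rewrite ?powR_ge0 ?ltW// ?ltrDr//.
    by rewrite gt0_ltr_powR ?nnegrE ?ltW// ltrDr.
  - exact: cvg_cst.
  - by rewrite -[X in _ --> X](mulr0 K); apply: cvgM => //; exact: cvg_cst.
rewrite -[X in _ --> X]oppr0; apply: cvgN.
rewrite -[X in _ --> X](mul0r (expR (- 0))); apply: cvgM.
  have /cvg_at_rightP H := powR_cvg0 x0.
  by apply: H; split => // n; rewrite invr_gt0 ltr0n.
apply: continuous_cvg; first exact: continuous_expR.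
by apply: cvgN.
Qed.

End Gamma_function.

(** * Moments of the ultraspherical weight *)

Definition ultra_moment (R : realType) (nu : R) (p : {poly R}) : R :=
  \int[@lebesgue_measure R]_(x in `]-1, 1[) ((1 - x ^+ 2) `^ (nu - 2^-1) * p.[x]).

(** This is (1 - x^2)^(1/2 - nu) times the derivative of (1 - x^2)^(nu + 1/2) p: integration by
    parts between the parameters nu + 1 and nu in polynomial form. *)
Definition ultra_deriv (K : nzRingType) (nu : K) (p : {poly K}) : {poly K} :=
  (1 - 'X ^+ 2) * p^`() - (2 * nu + 1) *: ('X * p).

Section ultraspherical_moments.
Local Open Scope classical_set_scope.
Local Open Scope ring_scope.
Variable R : realType.
Local Notation mu := (@lebesgue_measure R).
Implicit Types x t nu : R.

Let v (n : nat) : R := 1 - n.+2%:R^-1.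
Let u (n : nat) : R := - v n.

Let v0 n : 0 < v n.
Proof. by rewrite /v subr_gt0 invf_lt1 ?ltr1n ?ltr0n. Qed.

Let v1 n : v n < 1.
Proof. by rewrite /v gtrBl invr_gt0 ltr0n. Qed.

Let uv n : u n < v n.
Proof. by rewrite /u (@lt_trans _ _ 0)// oppr_lt0. Qed.

Let ndv : {homo v : m n / (m <= n)%N >-> m <= n}.
Proof.
by move=> m n mn; rewrite lerB// lef_pV2 ?posrE ?ltr0n// ler_nat.
Qed.

Let DE : `]-1, 1[%classic = \bigcup_n `[u n, v n]%classic.
Proof.
apply/seteqP; split => [x|x [n _]] /=; rewrite !in_itv/= -ltr_norml; last first.
  by rewrite -ler_norml => H; apply: le_lt_trans H _.
move=> x1; exists (Num.truncn (1 - `|x|)^-1) => //=.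
rewrite in_itv/= -ler_norml /v lerBrDl -lerBrDr.
have H0 : 0 < 1 - `|x| by rewrite subr_gt0.
rewrite -[leRHS]invrK lef_pV2 ?posrE ?invr_gt0 ?ltr0n//.
by apply: le_trans (ltW (truncnS_gt _)) _; rewrite ler_nat.
Qed.

Let nd : nondecreasing_seq (fun n => `[u n, v n]%classic : set R).
Proof.
move=> m n mn; rewrite subsetEset; apply: subset_itv; rewrite bnd_simp.
  by rewrite lerN2 ndv.
exact: ndv.
Qed.

Let w nu x : R := (1 - x ^+ 2) `^ (nu - 2^-1).

Let is_derive_1Bpow (a t : R) : 0 < 1 - t ->
  is_derive t 1 (fun s : R => (1 - s) `^ a) (- (a * (1 - t) `^ (a - 1))).
Proof.
move=> t10.
have H1 : is_derive t (1 : R) (fun s : R => 1 - s) (-1).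
  have := is_deriveB (is_derive_cst (1 : R) t (1 : R)) (is_derive_id t (1 : R)).
  by rewrite sub0r.
have H2 := is_derive1_powR a t10.
have := is_derive1_comp (f := @powR R ^~ a) (g := fun s : R => 1 - s) H2 H1.
by rewrite mulrN1.
Qed.

Let is_derive_w (a t : R) : 0 < 1 - t ^+ 2 ->
  is_derive t 1 (fun s : R => (1 - s ^+ 2) `^ a)
    (- (2 * a * t * (1 - t ^+ 2) `^ (a - 1))).
Proof.
move=> t10.
have H1 : is_derive t (1 : R) (fun s : R => 1 - s ^+ 2) (- (2 * t)).
  have H0 : is_derive t (1 : R) (fun s : R => s ^+ 2) (2 * t).
    by apply: is_derive_eq; rewrite /GRing.scale/=; ring.
  have := is_deriveB (is_derive_cst (1 : R) t (1 : R)) H0.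
  by rewrite sub0r.
have H2 := is_derive1_powR a t10.
have := is_derive1_comp (f := @powR R ^~ a) (g := fun s : R => 1 - s ^+ 2) H2 H1.
by move=> H; apply: (is_derive_eq H); ring.
Qed.

Let w_measurable nu : measurable_fun (`](-1 : R), 1[%classic) (w nu).
Proof.
apply: measurable_funTS; apply: (measurableT_comp (@measurable_powR R _)).
apply: measurable_funB => //; exact: measurable_funX.
Qed.

Let itvP1 x : `]-1, 1[%classic x -> [/\ 0 < 1 + x, 0 < 1 - x & 0 < 1 - x ^+ 2].
Proof.
rewrite /= in_itv/= => /andP[x1 x2].
have h1 : 0 < 1 + x by lra.
have h2 : 0 < 1 - x by lra.
split => //; have -> : 1 - x ^+ 2 = (1 + x) * (1 - x) by ring.
by rewrite mulr_gt0.
Qed.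

(** For nu < 1/2 the weight blows up at both ends. With a = nu + 1/2 it equals (1 + t)^(a - 1) (1 -
    t)^(a - 1); on each half of the interval one factor has its base in [1, 2], hence is at most
    2^a, and the other has an elementary bounded primitive. *)
Let w_integrable nu : 0 < nu -> mu.-integrable `]-1, 1[ (EFin \o w nu).
Proof.
move=> nu0; set a := nu + 2^-1.
have a0 : 0 < a by rewrite addr_gt0.
pose F0 x := (1 + x) `^ a - (1 - x) `^ a.
pose f0 x := a * (1 + x) `^ (a - 1) + a * (1 - x) `^ (a - 1).
have dF t : `]-1, 1[%classic t -> is_derive t 1 F0 (f0 t).
  move=> /itvP1[t1 t2 _].
  have H1 := is_derive1_1DpowR a t1; have H2 := is_derive_1Bpow a t2.
  by apply: is_derive_eq; rewrite opprK.
have cf t : `]-1, 1[%classic t -> {for t, continuous f0}.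
  move=> /itvP1[t1 t2 _].
  apply: differentiable_continuous; apply/derivable1_diffP.
  have H1 := is_derive1_1DpowR (a - 1) t1; have H2 := is_derive_1Bpow (a - 1) t2.
  by apply: derivableD; apply: derivableM.
have f0i : mu.-integrable `]-1, 1[ (EFin \o f0).
  apply: (@ge0_improper_integrable _ _ u v _ F0 uv DE nd dF cf (2 `^ a + 2 `^ a)).
  - by move=> t _; rewrite /f0 addr_ge0// mulr_ge0 ?powR_ge0// ltW.
  - move=> n; rewrite /F0 /u opprK.
    have v2 : 1 + v n <= 2 by rewrite lerD2l ltW.
    have v3 : 0 <= 1 + v n by rewrite addr_ge0// ltW.
    have v4 : (1 + v n) `^ a <= 2 `^ a by rewrite ge0_ler_powR ?nnegrE// ltW.
    have := powR_ge0 (1 - v n) a; lra.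
have : mu.-integrable `]-1, 1[ (EFin \o (fun t => (2 `^ a / a) * f0 t)).
  have -> : EFin \o (fun t => (2 `^ a / a) * f0 t) =
     (fun t => ((2 `^ a / a)%:E * (EFin \o f0) t)%E) by apply/funext => t /=; rewrite EFinM.
  by apply: integrableZl.
apply: le_integrable => //; first by apply/measurable_EFinP; exact: w_measurable.
move=> t tD; have [t1 t2 t3] := itvP1 tD; rewrite lee_fin !ger0_norm ?powR_ge0//; last first.
  by rewrite /f0 mulr_ge0 ?divr_ge0 ?addr_ge0 ?mulr_ge0 ?powR_ge0// ltW.
have -> : w nu t = (1 + t) `^ (a - 1) * (1 - t) `^ (a - 1).
  rewrite -powRM ?(ltW t1) ?(ltW t2)//; congr (_ `^ _); first by ring.
  by rewrite /a; field.
have bound (y : R) : 1 <= y -> y <= 2 -> y `^ (a - 1) <= 2 `^ a.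
  move=> y1 y2; have y0 : 0 <= y by apply: le_trans y1.
  apply: (@le_trans _ _ (y `^ a)); first by rewrite ler_powR// gerBl.
  by rewrite ge0_ler_powR ?nnegrE// ltW.
have -> : 2 `^ a / a * f0 t =
    2 `^ a * (1 + t) `^ (a - 1) + 2 `^ a * (1 - t) `^ (a - 1).
  by rewrite /f0; field; rewrite gt_eqF.
have p1 := powR_ge0 (1 + t) (a - 1); have p2 := powR_ge0 (1 - t) (a - 1).
have p3 := powR_ge0 2 a.
have [t0|t0] := leP 0 t.
  apply: (@le_trans _ _ (2 `^ a * (1 - t) `^ (a - 1))).
    by rewrite ler_wpM2r// bound//; lra.
  by rewrite lerDr mulr_ge0.
apply: (@le_trans _ _ (2 `^ a * (1 + t) `^ (a - 1))).
  by rewrite mulrC ler_wpM2r// bound//; lra.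
by rewrite lerDl mulr_ge0.
Qed.

(** Induction on p: multiplication by x does not increase absolute values on (-1, 1). *)
Lemma ultra_integrable nu (p : {poly R}) : 0 < nu -> mu.-integrable `]-1, 1[
  (EFin \o (fun x => (1 - x ^+ 2) `^ (nu - 2^-1) * p.[x])).
Proof.
move=> nu0; elim/poly_ind: p => [|p c IH].
  apply: (eq_integrable _ (fun=> 0%E)) => //; last exact: integrable0.
  by move=> x _ /=; rewrite horner0 mulr0.
have -> : EFin \o (fun x => w nu x * (p * 'X + c%:P).[x]) =
  (fun x => (EFin \o (fun x => w nu x * p.[x] * x)%R) x + c%:E * (EFin \o w nu) x)%E.
  apply/funext => x /=; rewrite -EFinM -EFinD; congr EFin.
  by rewrite hornerD hornerMX hornerC; ring.
apply: integrableD => //; last by apply: integrableZl => //; exact: w_integrable.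
apply: le_integrable IH => //.
  apply/measurable_EFinP; apply: measurable_funM => //.
  apply: measurable_funM; first exact: w_measurable.
  by apply: measurable_funTS; apply: continuous_measurable_fun; exact: continuous_horner.
move=> x /=; rewrite in_itv/= => /andP[x1 x2]; rewrite lee_fin normrM ler_piMr//.
by rewrite ler_norml !ltW.
Qed.

Lemma ultra_moment_linear nu (c : R) (p q : {poly R}) : 0 < nu ->
  ultra_moment nu (c *: p + q) = c * ultra_moment nu p + ultra_moment nu q.
Proof.
move=> nu0; rewrite /ultra_moment.
rewrite -RintegralZl//; last exact: ultra_integrable.
rewrite -RintegralD//; last 2 first.
- rewrite (_ : EFin \o _ = EFin \o (fun x => w nu x * (c *: p).[x])%R).
    exact: ultra_integrable.
  by apply/funext => x /=; rewrite hornerZ mulrCA.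
- exact: ultra_integrable.
by apply: eq_Rintegral => x _; rewrite hornerD hornerZ; ring.
Qed.

Lemma ultra_moment1_gt0 nu : 0 < nu -> 0 < ultra_moment nu 1.
Proof.
move=> nu0; have Gi := ultra_integrable 1 nu0; have [mG _] := integrableP _ _ _ Gi.
(* Lower bound on [-1/2, 1/2], of length 1: as 3/4 <= 1 - t^2 <= 1, (1 - t^2)^(nu - 1/2) >= (1 -
   t^2)^nu >= (3/4)^nu. *)
set c : R := (3%:R / 4%:R) `^ nu.
have c0 : 0 < c by rewrite powR_gt0// divr_gt0.
have : (c%:E <= (ultra_moment nu 1)%:E)%E.
  rewrite /ultra_moment /Rintegral fineK; last exact: integrable_fin_num.
  apply: (@le_trans _ _ (\int[mu]_(t in `[(- 2^-1)%R, (2^-1)%R]) c%:E)%E).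
    rewrite integral_cst//= lebesgue_measure_itv/= lte_fin.
    have -> : - 2^-1 < 2^-1 :> R by lra.
    by rewrite -EFinD -EFinM lee_fin; lra.
  have sub : `[(- 2^-1)%R, (2^-1)%R]%classic `<=` (`]-1, 1[%classic : set R).
    by move=> t /=; rewrite !in_itv/= => /andP[? ?]; apply/andP; split; lra.
  apply: (@le_trans _ _ (\int[mu]_(t in `[(- 2^-1)%R, (2^-1)%R])
      ((1 - t ^+ 2) `^ (nu - 2^-1) * (1 : {poly R}).[t])%:E)%E).
    apply: ge0_le_integral => //.
    - by move=> t _; rewrite lee_fin ltW.
    - by apply: measurable_funS mG.
    move=> t /=; rewrite in_itv/= => /andP[t1 t2]; rewrite lee_fin hornerC mulr1.
    have b1 : 3%:R / 4%:R <= 1 - t ^+ 2 by nra.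
    have b0 : 0 < 1 - t ^+ 2 by lra.
    have b2 : 1 - t ^+ 2 <= 1 by rewrite gerBl sqr_ge0.
    apply: (@le_trans _ _ ((1 - t ^+ 2) `^ nu)).
      by apply: ge0_ler_powR; rewrite ?nnegrE//; lra.
    by apply: ger_powR; [rewrite b0|lra].
  apply: ge0_subset_integral => //.
  by move=> t _; rewrite lee_fin hornerC mulr1 powR_ge0.
by rewrite lee_fin; apply: lt_le_trans.
Qed.

Lemma ultra_momentS nu (p : {poly R}) : 0 < nu ->
  ultra_moment (nu + 1) p = ultra_moment nu ((1 - 'X ^+ 2) * p).
Proof.
move=> nu0; apply: eq_Rintegral => x; rewrite inE => /itvP1[_ _ x0].
rewrite hornerM hornerD hornerN hornerXn hornerC mulrA; congr (_ * _).
have -> : nu + 1 - 2^-1 = nu - 2^-1 + 1 by ring.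
by rewrite powRD ?(gt_eqF x0) ?implybT// powRr1// ltW.
Qed.

(** The primitive (1 - x^2)^(nu + 1/2) p has a positive exponent, so it vanishes at both ends even
    when the weight is unbounded. *)
Lemma ultra_moment_deriv nu (p : {poly R}) : 0 < nu ->
  ultra_moment nu (ultra_deriv nu p) = 0.
Proof.
move=> nu0; set a := nu + 2^-1.
have a0 : 0 < a by rewrite addr_gt0.
pose F x := (1 - x ^+ 2) `^ a * p.[x].
apply: (@improper_FTC _ _ u v _ F uv DE nd) => //.
- move=> t /itvP1[_ _ t0].
  have H1 := is_derive_w a t0.
  have H2 := is_derive_poly p t.
  apply: is_derive_eq; rewrite /GRing.scale/=.
  have -> : (1 - t ^+ 2) `^ a = (1 - t ^+ 2) `^ (nu - 2^-1) * (1 - t ^+ 2).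
    have -> : a = nu - 2^-1 + 1 by rewrite /a; field.
    by rewrite powRD ?(gt_eqF t0) ?implybT// powRr1// ltW.
  have -> : a - 1 = nu - 2^-1 by rewrite /a; field.
  by rewrite /ultra_deriv !hornerE /a /=; field.
- move=> t /itvP1[_ _ t0].
  apply: differentiable_continuous; apply/derivable1_diffP.
  have H1 := is_derive_w (nu - 2^-1) t0.
  have H2 := is_derive_poly (ultra_deriv nu p) t.
  by apply: derivableM.
- exact: ultra_integrable.
have vlim : v n @[n --> \oo] --> (1 : R).
  rewrite -[X in _ --> X]subr0; apply: cvgB; first exact: cvg_cst.
  by have := @cvg_harmonic R; rewrite -cvg_shiftS.
have wlim : (1 - v n ^+ 2) `^ a @[n --> \oo] --> (0 : R).
  have /cvg_at_rightP H := powR_cvg0 a0.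
  apply: H; split.
    move=> n; have := v0 n; have := v1 n; nra.
  have -> : 0 = 1 - 1 ^+ 2 :> R by rewrite expr1n subrr.
  apply: cvgB; first exact: cvg_cst.
  by apply: cvgM.
rewrite -[X in _ --> X](subrr 0) /F; apply: cvgB.
  rewrite -[X in _ --> X](mul0r p.[1]); apply: cvgM => //.
  by apply: continuous_cvg => //; exact: continuous_horner.
rewrite -[X in _ --> X](mul0r p.[-1]); apply: cvgM.
  by rewrite /u; under eq_fun do rewrite sqrrN.
apply: continuous_cvg; first exact: continuous_horner.
exact: cvgN.
Qed.

End ultraspherical_moments.

(** * The matrices F *)

Section gamma_coefficients.
Variables (R : realType) (L : nat) (nu : R).
Hypothesis nu0 : 0 < nu.

(** Integer arguments, with value 0 at the negative ones, encode the vanishing of the binomial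
    coefficients. *)
Let f (a : int) : R :=
  if a is Posz n then (-1) ^+ n / (n`!%:R * Gamma (nu + L%:R + 1 - n%:R)) else 0.
Let g (b : int) : R := if b is Posz n then Gamma (nu + n%:R) / n`!%:R else 0.

Let kappa : R := (nu + L%:R) * L`!%:R / Gamma nu.

Let gamma_coefE (a b : int) (i j k : nat) : (k <= L)%N ->
  i%:Z = a + b -> j%:Z = k%:Z - a + b ->
  gamma_coef L nu i j k =
  kappa * (nu + L%:R - k%:R) * (f a * f (k%:Z - a) * g b * g (L%:Z - k%:Z - b)).
Proof.
move=> kL Hi Hj; rewrite /gamma_coef ifT; last by apply/eqP; lia.
have -> : ((k%:Z + i%:Z - j%:Z) %/ 2)%Z = a by lia.
have -> : ((i%:Z + j%:Z - k%:Z) %/ 2)%Z = b by lia.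
case: a Hi Hj => [a|a] Hi Hj; last by rewrite /= !(mulr0, mul0r).
case: b Hi Hj => [b|b] Hi Hj; last by rewrite /= !(mulr0, mul0r).
rewrite /binz.
have [ka|ka] := ltnP k a.
  rewrite (bin_small ka) (_ : k%:Z - a%:Z = Negz (a - k).-1); last by lia.
  by rewrite /= !(mulr0, mul0r).
have [kb|kb] := ltnP (L - k) b.
  rewrite (bin_small kb) (_ : L%:Z - k%:Z - b%:Z = Negz (b - (L - k)).-1); last by lia.
  by rewrite /= !(mulr0, mul0r).
have -> : k%:Z - a%:Z = (k - a)%N by lia.
have -> : L%:Z - k%:Z - b%:Z = (L - k - b)%N by lia.
rewrite /f /g /kappa.
have Ei : i%:R = a%:R + b%:R :> R by rewrite -natrD; congr _%:R; lia.
have Ej : j%:R = k%:R - a%:R + b%:R :> R by rewrite -natrB// -natrD; congr _%:R; lia.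
rewrite Ei Ej (natrB _ ka) (natrB _ kb) (natrB _ kL).
have -> : nu - (k%:R - (a%:R + b%:R) - (k%:R - a%:R + b%:R)) / 2 = nu + b%:R by field.
have -> : nu + L%:R - (k%:R + (a%:R + b%:R) + (k%:R - a%:R + b%:R)) / 2
   = nu + (L%:R - k%:R - b%:R) by field.
have -> : nu + L%:R + 1 - (k%:R - (a%:R + b%:R) + (k%:R - a%:R + b%:R)) / 2
   = nu + L%:R + 1 - (k%:R - a%:R) by field.
have -> : nu + L%:R + 1 - (k%:R + (a%:R + b%:R) - (k%:R - a%:R + b%:R)) / 2
   = nu + L%:R + 1 - a%:R by field.
have -> : (-1) ^+ k = (-1) ^+ a * (-1) ^+ (k - a) :> R by rewrite -exprD; congr (_ ^+ _); lia.
(* The three binomials form a multinomial coefficient, whose four factorials go to the two values of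
   [f] and the two of [g]. *)
have B1 : 'C(L, k)%:R * 'C(k, a)%:R * 'C(L - k, b)%:R
   = L`!%:R / (a`!%:R * (k - a)`!%:R * b`!%:R * (L - k - b)`!%:R) :> R.
  have natE (m n : nat) : m = n -> m%:R = n%:R :> R by move=> ->.
  rewrite -(natE _ _ (bin_fact kL)) !natrM -(natE _ _ (bin_fact ka)) -(natE _ _ (bin_fact kb)) !natrM.
  by field; rewrite !pnatr_eq0 -!lt0n !fact_gt0.
have gap (m : nat) : (m <= L)%N -> 0 < nu + L%:R + 1 - m%:R.
  by rewrite -(ler_nat R) => H; have h := nu0; lra.
have G1 : Gamma (nu + L%:R + 1 - a%:R) != 0.
  by apply: lt0r_neq0; apply: Gamma_gt0; apply: gap; lia.
have G2 : Gamma (nu + L%:R + 1 - (k%:R - a%:R)) != 0.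
  by rewrite -(natrB _ ka); apply: lt0r_neq0; apply: Gamma_gt0; apply: gap; lia.
have G3 : Gamma nu != 0 by apply: lt0r_neq0; exact: Gamma_gt0.
transitivity ((-1) ^+ a * (-1) ^+ (k - a) * (nu + L%:R) * (nu + L%:R - k%:R) *
  ('C(L, k)%:R * 'C(k, a)%:R * 'C(L - k, b)%:R) *
 (Gamma (nu + b%:R) * Gamma (nu + (L%:R - k%:R - b%:R)) /
  (Gamma nu * Gamma (nu + L%:R + 1 - (k%:R - a%:R)) *
   Gamma (nu + L%:R + 1 - a%:R)))); first by ring.
rewrite B1.
have F0 n : n`!%:R != 0 :> R by rewrite pnatr_eq0 -lt0n fact_gt0.
move: (Gamma (nu + b%:R)) (Gamma (nu + (_ - _))) => c1 c2.
move: (Gamma (nu + L%:R + 1 - a%:R)) (Gamma (nu + L%:R + 1 - (k%:R - a%:R))) (Gamma nu)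
  G1 G2 G3 => c3 c4 c5 G1 G2 G3.
move: (a`!%:R) ((k - a)`!%:R) (b`!%:R) ((L - k - b)`!%:R) (L`!%:R)
  (F0 a) (F0 (k - a)%N) (F0 b) (F0 (L - k - b)%N) => d1 d2 d3 d4 d5 F1 F2 F3 F4.
by field; rewrite G1 G2 G3 F1 F2 F3 F4.
Qed.

(** Contiguity relation - a f(a) = (nu + L + 1 - a) f(a - 1), stated with a common factor t so that
    substitution leaves a polynomial identity. The bound on a keeps the arguments of [Gamma]
    positive. *)
Let fP (a : int) : a <= L%:Z + 1 -> exists t,
  f a = (nu + L%:R + 1 - a%:~R) * t /\ f (a - 1) = - a%:~R * t.
Proof.
case: a => [[|n]|n] aL.
- exists ((Gamma (nu + L%:R + 1))^-1 / (nu + L%:R + 1)).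
  have h := nu0; have hL := ler0n R L.
  have h1 : nu + L%:R + 1 != 0 by rewrite gt_eqF//; lra.
  have h2 : Gamma (nu + L%:R + 1) != 0 by rewrite gt_eqF// Gamma_gt0//; lra.
  by rewrite /f/= expr0 fact0 !subr0; split; [field; rewrite h1 h2|rewrite oppr0 mul0r].
- have -> : n.+1%:Z - 1 = n by lia.
  have hL : n%:R <= L%:R :> R by rewrite ler_nat; lia.
  have h := nu0; have n0 := ler0n R n.
  exists (- f n / n.+1%:R).
  have G0 : 0 < nu + L%:R - n%:R by lra.
  have E : Gamma (nu + L%:R + 1 - n%:R) = (nu + L%:R - n%:R) * Gamma (nu + L%:R - n%:R).
    by rewrite -(Gamma_rec G0); congr Gamma; ring.
  have -> : f n.+1 = - (nu + L%:R - n%:R) / n.+1%:R * f n.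
    rewrite /f E exprS factS natrM.
    have -> : nu + L%:R + 1 - n.+1%:R = nu + L%:R - n%:R by rewrite -natr1; ring.
    have := Gamma_gt0 G0 => G1.
    by field; rewrite !gt_eqF// ?ltr0n ?fact_gt0//; lra.
  have -> : n.+1%:~R = n%:R + 1 :> R by rewrite natr1.
  by split; rewrite -[n.+1%:R]natr1; field; rewrite gt_eqF//; lra.
- by exists 0; rewrite !mulr0.
Qed.

(** At b = -1, where g(b) = 0 and g(b + 1) = Gamma(nu), the factor t would be Gamma(nu) / (nu - 1),
    impossible for nu = 1; that case is computed directly where it occurs. *)
Let gP (b : int) : b != -1 -> exists t,
  g (b + 1) = (nu + b%:~R) * t /\ g b = (b%:~R + 1) * t.
Proof.
case: b => [n|[|n]]// _; last by exists 0; rewrite !mulr0.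
have h := nu0; have n0 := ler0n R n.
exists (g n / (n%:R + 1)); rewrite (_ : Posz n + 1 = n.+1); last by lia.
have n1 : n%:R + 1 != 0 :> R by rewrite gt_eqF//; lra.
split; last by rewrite -[n%:~R]/(n%:R); field.
rewrite /g factS natrM -[n%:~R]/(n%:R) -natr1 addrA Gamma_rec; last by lra.
by field; rewrite n1 pnatr_eq0 -lt0n fact_gt0.
Qed.

(** The commutator identity without its prefactors. Each term is a multiple of the common factors
    from [fP] and [gP], so what remains is polynomial. *)
Let six_term (a a' b b' : int) (l : R) : a + a' + b + b' = L%:Z ->
  0 <= b + b' + 1 -> l = nu + b%:~R + b'%:~R + 1 ->
  l * ((a%:~R + b'%:~R + 1) * (f a * f (a' - 1) * g b * g (b' + 1))
    + (a'%:~R + b%:~R + 1) * (f (a - 1) * f a' * g (b + 1) * g b')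
    - (a'%:~R + b'%:~R + 1) * (f (a - 1) * f a' * g b * g (b' + 1))
    - (a%:~R + b%:~R + 1) * (f a * f (a' - 1) * g (b + 1) * g b'))
  = (a%:~R - a'%:~R) * (b'%:~R - b%:~R) *
    (f a * f a' * g b * g b' - f (a - 1) * f (a' - 1) * g (b + 1) * g (b' + 1)).
Proof.
move=> sumL bb ->.
have LE : L%:R = a%:~R + a'%:~R + b%:~R + b'%:~R :> R.
  by rewrite -!intrD sumL.
have fneg (x : int) : x < 0 -> f x = 0 by case: x.
(* As b + b' >= -1, a + a' <= L + 1: if one of a, a' exceeds L + 1 the other is negative and every
   term is 0. *)
have [aL|aL] := leP a (L%:Z + 1); last first.
  by rewrite (fneg a') ?(fneg (a' - 1)); [ring|lia|lia].
have [a'L|a'L] := leP a' (L%:Z + 1); last first.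
  by rewrite (fneg a) ?(fneg (a - 1)); [ring|lia|lia].
have [t [-> ->]] := fP aL; have [t' [-> ->]] := fP a'L.
rewrite LE.
have [-> /=|/gP[u [-> ->]]] := eqVneq b (-1).
  have [-> /=|/gP[u' [-> ->]]] := eqVneq b' (-1); first by rewrite /g/=; ring.
  by rewrite /g/=; ring.
have [-> /=|/gP[u' [-> ->]]] := eqVneq b' (-1); last by ring.
by rewrite /g/=; ring.
Qed.

Let fneg (x : int) : x < 0 -> f x = 0. Proof. by case: x. Qed.
Let gneg (x : int) : x < 0 -> g x = 0. Proof. by case: x. Qed.

(** Of two integers with negative sum one is negative. By this and its two variants, the terms
    omitted at the borders for i, j and k are those where the product formula already gives 0. *)
Let ffneg (x y : int) : x + y < 0 -> f x * f y = 0.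
Proof.
move=> xy; have [x0|x0] := ltP x 0; first by rewrite fneg ?mul0r.
by rewrite (fneg (x := y)) ?mulr0//; lia.
Qed.

Let ggneg (x y : int) : x + y < 0 -> g x * g y = 0.
Proof.
move=> xy; have [x0|x0] := ltP x 0; first by rewrite gneg ?mul0r.
by rewrite (gneg (x := y)) ?mulr0//; lia.
Qed.

Let fgneg (x y : int) : x + y < 0 -> f x * g y = 0.
Proof.
move=> xy; have [x0|x0] := ltP x 0; first by rewrite fneg ?mul0r.
by rewrite (gneg (x := y)) ?mulr0//; lia.
Qed.

Lemma gamma_coef_commutator (i j k : nat) : (i <= L)%N -> (j <= L)%N -> (k <= L)%N ->
  (if (0 < j)%N then gamma_coef L nu i j.-1 k * (L - j.-1)%:R else 0)
  + (if (j < L)%N then gamma_coef L nu i j.+1 k * j.+1%:R else 0)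
  - ((if (0 < i)%N then gamma_coef L nu i.-1 j k * (L - i.-1)%:R else 0)
  + (if (i < L)%N then gamma_coef L nu i.+1 j k * i.+1%:R else 0))
  = ((i * (L - i))%:R - (j * (L - j))%:R) *
    ((if (k < L)%N then (nu + L%:R - k%:R - 1)^-1 * gamma_coef L nu i j k.+1 else 0)
    - (if (0 < k)%N then (nu + L%:R - k%:R + 1)^-1 * gamma_coef L nu i j k.-1 else 0)).
Proof.
move=> iL jL kL.
(* If i + j and k have the same parity, each of the six terms has the wrong parity. *)
have [par|par] := eqVneq ((i + j) %% 2)%N (k %% 2)%N.
  have Z i' j' k' : ((i' + j') %% 2 != k' %% 2)%N -> gamma_coef L nu i' j' k' = 0.
    by move=> /negbTE H; rewrite /gamma_coef H.
  have z1 : (if (0 < j)%N then gamma_coef L nu i j.-1 k * (L - j.-1)%:R else 0) = 0.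
    by case: ifP => // ?; rewrite Z ?mul0r//; lia.
  have z2 : (if (j < L)%N then gamma_coef L nu i j.+1 k * j.+1%:R else 0) = 0.
    by case: ifP => // ?; rewrite Z ?mul0r//; lia.
  have z3 : (if (0 < i)%N then gamma_coef L nu i.-1 j k * (L - i.-1)%:R else 0) = 0.
    by case: ifP => // ?; rewrite Z ?mul0r//; lia.
  have z4 : (if (i < L)%N then gamma_coef L nu i.+1 j k * i.+1%:R else 0) = 0.
    by case: ifP => // ?; rewrite Z ?mul0r//; lia.
  have z5 (z : R) : (if (k < L)%N then z * gamma_coef L nu i j k.+1 else 0) = 0.
    by case: ifP => // ?; rewrite Z ?mulr0//; lia.
  have z6 (z : R) : (if (0 < k)%N then z * gamma_coef L nu i j k.-1 else 0) = 0.
    by case: ifP => // ?; rewrite Z ?mulr0//; lia.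
  transitivity (0 + 0 - (0 + 0) : R).
    by congr (_ + _ - (_ + _)); [exact: z1|exact: z2|exact: z3|exact: z4].
  by rewrite [X in _ = _ * (X - _)]z5 [X in _ = _ * (_ - X)]z6 !(addr0, subr0, mulr0).
(* Chosen so that i = a + b, j = a' + b, k + 1 = a + a' and L = a + a' + b + b'; the six terms then
   differ by unit shifts of these four numbers. *)
pose a : int := ((k%:Z + i%:Z - j%:Z + 1) %/ 2)%Z.
pose b : int := ((i%:Z + j%:Z - k%:Z - 1) %/ 2)%Z.
pose a' : int := k%:Z + 1 - a.
pose b' : int := L%:Z - k%:Z - 1 - b.
have Hi : i%:Z = a + b by rewrite /a /b; lia.
have Hj : j%:Z = a' + b by rewrite /a' /a /b; lia.
have Hk : k%:Z = a + a' - 1 by rewrite /a' /a /b; lia.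
have HL : L%:Z = a + a' + b + b' by rewrite /a' /b' /a /b; lia.
move: a b a' b' Hi Hj Hk HL => a b a' b' Hi Hj Hk HL {par}.
have h := nu0.
have iR : i%:R = a%:~R + b%:~R :> R by rewrite -intrD -Hi.
have jR : j%:R = a'%:~R + b%:~R :> R by rewrite -intrD -Hj.
have kR : k%:R = a%:~R + a'%:~R - 1 :> R by rewrite -intrD -[1]/(1%:~R) -intrB -Hk.
have LR : L%:R = a%:~R + a'%:~R + b%:~R + b'%:~R :> R by rewrite -!intrD -HL.
pose l := nu + L%:R - k%:R.
have kLR : k%:R <= L%:R :> R by rewrite ler_nat.
have -> : (if (0 < j)%N then gamma_coef L nu i j.-1 k * (L - j.-1)%:R else 0)
  = kappa * l * ((a%:~R + b'%:~R + 1) * (f a * f (a' - 1) * g b * g (b' + 1))).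
  case: ifP => j0.
    rewrite (@gamma_coefE a b); [|by lia|by lia|by lia].
    have -> : k%:Z - a = a' - 1 by lia.
    have -> : L%:Z - k%:Z - b = b' + 1 by lia.
    have -> : (L - j.-1)%:R = a%:~R + b'%:~R + 1 :> R.
      by rewrite natrB; [rewrite -subn1 natrB// LR jR; ring|lia].
    by rewrite /l; ring.
  have E : f (a' - 1) * g b = 0 by apply: fgneg; lia.
  by rewrite -(mulrA (f a)) E; ring.
have -> : (if (j < L)%N then gamma_coef L nu i j.+1 k * j.+1%:R else 0)
  = kappa * l * ((a'%:~R + b%:~R + 1) * (f (a - 1) * f a' * g (b + 1) * g b')).
  case: ifP => j0.
    rewrite (@gamma_coefE (a - 1) (b + 1)); [|by lia|by lia|by lia].
    have -> : k%:Z - (a - 1) = a' by lia.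
    have -> : L%:Z - k%:Z - (b + 1) = b' by lia.
    by rewrite -natr1 jR /l; ring.
  have E : f (a - 1) * g b' = 0 by apply: fgneg; lia.
  rewrite (_ : _ * g b' = f a' * g (b + 1) * (f (a - 1) * g b')); last by ring.
  by rewrite E; ring.
have -> : (if (0 < i)%N then gamma_coef L nu i.-1 j k * (L - i.-1)%:R else 0)
  = kappa * l * ((a'%:~R + b'%:~R + 1) * (f (a - 1) * f a' * g b * g (b' + 1))).
  case: ifP => i0.
    rewrite (@gamma_coefE (a - 1) b); [|by lia|by lia|by lia].
    have -> : k%:Z - (a - 1) = a' by lia.
    have -> : L%:Z - k%:Z - b = b' + 1 by lia.
    have -> : (L - i.-1)%:R = a'%:~R + b'%:~R + 1 :> R.
      by rewrite natrB; [rewrite -subn1 natrB// LR iR; ring|lia].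
    by rewrite /l; ring.
  have E : f (a - 1) * g b = 0 by apply: fgneg; lia.
  rewrite (_ : _ * g (b' + 1) = f a' * g (b' + 1) * (f (a - 1) * g b)); last by ring.
  by rewrite E; ring.
have -> : (if (i < L)%N then gamma_coef L nu i.+1 j k * i.+1%:R else 0)
  = kappa * l * ((a%:~R + b%:~R + 1) * (f a * f (a' - 1) * g (b + 1) * g b')).
  case: ifP => i0.
    rewrite (@gamma_coefE a (b + 1)); [|by lia|by lia|by lia].
    have -> : k%:Z - a = a' - 1 by lia.
    have -> : L%:Z - k%:Z - (b + 1) = b' by lia.
    by rewrite -natr1 iR /l; ring.
  have E : f (a' - 1) * g b' = 0 by apply: fgneg; lia.
  rewrite (_ : _ * g b' = f a * g (b + 1) * (f (a' - 1) * g b')); last by ring.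
  by rewrite E; ring.
(* The factor nu + L - (k + 1) of gamma(nu; i, j, k + 1) cancels the denominator; the next rewrite
   does the same for k - 1. *)
rewrite [X in _ = _ * (X - _)](_ : _ = kappa * (f a * f a' * g b * g b')); last first.
  case: ifP => k0.
    rewrite (@gamma_coefE a b); [|by lia|by lia|by lia].
    have -> : k.+1%:Z - a = a' by lia.
    have -> : L%:Z - k.+1%:Z - b = b' by lia.
    have : k.+1%:R <= L%:R :> R by rewrite ler_nat.
    by rewrite -natr1 => H; field; rewrite gt_eqF//; lra.
  have E : g b * g b' = 0 by apply: ggneg; lia.
  by rewrite -(mulrA (f a * f a')) E; ring.
rewrite [X in _ = _ * (_ - X)](_ : _ =
    kappa * (f (a - 1) * f (a' - 1) * g (b + 1) * g (b' + 1))); last first.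
  case: ifP => k0.
    rewrite (@gamma_coefE (a - 1) (b + 1)); [|by lia|by lia|by lia].
    have -> : k.-1%:Z - (a - 1) = a' - 1 by lia.
    have -> : L%:Z - k.-1%:Z - (b + 1) = b' + 1 by lia.
    by rewrite -subn1 natrB//; field; rewrite gt_eqF//; lra.
  have E : f (a - 1) * f (a' - 1) = 0 by apply: ffneg; lia.
  by rewrite E; ring.
(* Both sides are (i - j)(L - i - j). *)
have -> : (i * (L - i))%:R - (j * (L - j))%:R =
   (a%:~R - a'%:~R) * (b'%:~R - b%:~R) :> R.
  by rewrite !natrM !natrB// LR iR jR; ring.
have := @six_term a a' b b' l; rewrite HL => /(_ erefl) H.
rewrite -[RHS](_ : kappa * ((a%:~R - a'%:~R) * (b'%:~R - b%:~R) * (f a * f a' * g b * g b' -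
     f (a - 1) * f (a' - 1) * g (b + 1) * g (b' + 1))) = _); last by ring.
rewrite -H; [ring|lia|].
by rewrite /l LR kR; ring.
Qed.

End gamma_coefficients.

(** * Products with C and V, and the second identity *)

Section matrix_entries.
Variables (K : comNzRingType) (L : nat).

Lemma mulmx_Cmx (A : 'M[K]_L.+1) (i j : 'I_L.+1) :
  (A *m Cmx K L) i j =
  (if (0 < j)%N then A i (inord j.-1) * (L - j.-1)%:R else 0)
  + (if (j < L)%N then A i (inord j.+1) * j.+1%:R else 0).
Proof.
have jL := ltn_ord j.
rewrite mxE; under eq_bigr do rewrite mxE mulrDr; rewrite big_split/=; congr (_ + _).
  case: ifP => j0.
    rewrite (bigD1 (inord j.-1))//= inordK; last by lia.
    rewrite prednK// eqxx mulr1n big1 ?addr0// => l lj.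
    rewrite (_ : (j == l.+1 :> nat) = false) ?mulr0//.
    apply: contraNF lj => /eqP jl; apply/eqP/val_inj; rewrite /= inordK; lia.
  by rewrite big1// => l _; rewrite (_ : (j == l.+1 :> nat) = false) ?mulr0//; lia.
case: ifP => jL'.
  rewrite (bigD1 (inord j.+1))//= inordK; last by lia.
  rewrite eqxx mulr1n big1 ?addr0// => l lj.
  rewrite (_ : (l == j.+1 :> nat) = false) ?mulr0//.
  apply: contraNF lj => /eqP jl; apply/eqP/val_inj; rewrite /= inordK; lia.
rewrite big1// => l _; rewrite (_ : (l == j.+1 :> nat) = false) ?mulr0//.
by have := ltn_ord l; lia.
Qed.

Lemma trCmx_mulmx (A : 'M[K]_L.+1) (i j : 'I_L.+1) :
  ((Cmx K L)^T *m A) i j =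
  (if (0 < i)%N then A (inord i.-1) j * (L - i.-1)%:R else 0)
  + (if (i < L)%N then A (inord i.+1) j * i.+1%:R else 0).
Proof.
rewrite -[A in LHS]trmxK -trmx_mul mxE mulmx_Cmx.
by rewrite !mxE.
Qed.

Lemma mulmx_Vmx (A : 'M[K]_L.+1) (i j : 'I_L.+1) :
  (A *m Vmx K L) i j = - (j * (L - j))%:R * A i j.
Proof.
rewrite mxE (bigD1 j)//= mxE eqxx mulr1n big1 ?addr0 1?mulrC// => l lj.
by rewrite mxE (negbTE lj) mulr0.
Qed.

Lemma Vmx_mulmx (A : 'M[K]_L.+1) (i j : 'I_L.+1) :
  (Vmx K L *m A) i j = - (i * (L - i))%:R * A i j.
Proof.
rewrite mxE (bigD1 i)//= mxE eqxx mulr1n big1 ?addr0// => l lj.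
by rewrite mxE eq_sym (negbTE lj) mul0r.
Qed.

End matrix_entries.

(** The scalar in front of gamma(nu + n; i, j, k) is independent of i, j and k, so this is
    [gamma_coef_commutator] at nu + n, read entrywise. *)
Lemma Fmx_commutator (R : realType) (L : nat) (nu : R) (n k : nat) :
  0 < nu -> (k <= L)%N ->
  Fmx L nu k n *m Cmx R L - (Cmx R L)^T *m Fmx L nu k n
  = (if (k < L)%N
     then (nu + L%:R + n%:R - k%:R - 1)^-1
            *: mxbracket (Fmx L nu k.+1 n) (Vmx R L)
     else 0)
    - (if (0 < k)%N
       then (nu + L%:R + n%:R - k%:R + 1)^-1
              *: mxbracket (Fmx L nu k.-1 n) (Vmx R L)
       else 0).
Proof.
move=> nu0 kL; have nu'0 : 0 < nu + n%:R by rewrite ltr_wpDr.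
set c := n`!%:R * Gamma (nu + L%:R) / 2 ^+ n.
apply/matrixP => i j; have iL := ltn_ord i; have jL := ltn_ord j.
have := gamma_coef_commutator nu'0 (leq_ord i) (leq_ord j) kL.
move=> /(congr1 (fun x => c * x)).
have FE k' (i' j' : 'I_L.+1) :
  Fmx L nu k' n i' j' = c * gamma_coef L (nu + n%:R) i' j' k' by rewrite mxE.
pose B k' := ((i * (L - i))%:R - (j * (L - j))%:R) * (c * gamma_coef L (nu + n%:R) i j k').
have bracketE k' : mxbracket (Fmx L nu k' n) (Vmx R L) i j = B k'.
  by rewrite /mxbracket mxE [(- (_ *m _)) i j]mxE mulmx_Vmx Vmx_mulmx FE /B; ring.
have -> : nu + n%:R + L%:R - k%:R = nu + L%:R + n%:R - k%:R by ring.
move=> H; rewrite [RHS]mxE [X in _ = _ + X]mxE.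
transitivity ((if (k < L)%N then (nu + L%:R + n%:R - k%:R - 1)^-1 * B k.+1 else 0) -
    (if (0 < k)%N then (nu + L%:R + n%:R - k%:R + 1)^-1 * B k.-1 else 0)); last first.
  congr (_ - _).
    by case: (k < L)%N; [rewrite [RHS]mxE; congr (_ * _); rewrite bracketE|rewrite [RHS]mxE].
  by case: (0 < k)%N; [rewrite [RHS]mxE; congr (_ * _); rewrite bracketE|rewrite [RHS]mxE].
rewrite [LHS]mxE [X in _ + X = _]mxE mulmx_Cmx trCmx_mulmx !FE.
transitivity (c * ((if (0 < j)%N then gamma_coef L (nu + n%:R) i j.-1 k * (L - j.-1)%:R else 0) +
      (if (j < L)%N then gamma_coef L (nu + n%:R) i j.+1 k * j.+1%:R else 0) -
      ((if (0 < i)%N then gamma_coef L (nu + n%:R) i.-1 j k * (L - i.-1)%:R else 0) +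
       (if (i < L)%N then gamma_coef L (nu + n%:R) i.+1 j k * i.+1%:R else 0)))).
  rewrite mulrBr !mulrDr; congr (_ + _ - (_ + _)); case: ifP => ?; rewrite ?mulr0//;
    rewrite inordK ?mulrA//; lia.
rewrite H mulrBr mulrBr; congr (_ - _); case: ifP => ?; rewrite ?mulr0// /B; ring.
Qed.

(** * Ultraspherical polynomials *)

Section ultraspherical.
Variable R : realFieldType.
Implicit Types (nu : R) (n : nat).

(** The second component carries the next polynomial, which makes the three-term recurrence
    structural. [ultra nu n] is C_n^(nu) / C_n^(nu)(1): the factor (i + j - 2k)! / (2 nu)_(i + j -
    2k) of [alpha] is this normalization, and the recurrence is free of [Gamma]. *)
Fixpoint ultra2 nu n : {poly R} * {poly R} :=
  if n is m.+1 then
    let: (p, q) := ultra2 nu m in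
    (q, (2 * (m.+1%:R + nu) / (m.+1%:R + 2 * nu)) *: ('X * q)
        - (m.+1%:R / (m.+1%:R + 2 * nu)) *: p)
  else (1, 'X).

Definition ultra nu n : {poly R} := (ultra2 nu n).1.

Lemma ultra0 nu : ultra nu 0 = 1. Proof. by []. Qed.

Lemma ultra1 nu : ultra nu 1 = 'X. Proof. by []. Qed.

Lemma ultraSS nu n : ultra nu n.+2 =
  (2 * (n.+1%:R + nu) / (n.+1%:R + 2 * nu)) *: ('X * ultra nu n.+1)
  - (n.+1%:R / (n.+1%:R + 2 * nu)) *: ultra nu n.
Proof. by rewrite /ultra/=; case: (ultra2 nu n). Qed.

Lemma mulX_ultra nu n : 0 < nu -> 'X * ultra nu n =
  ((n%:R + 2 * nu) / (2 * (n%:R + nu))) *: ultra nu n.+1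
  + (n%:R / (2 * (n%:R + nu))) *: ultra nu n.-1.
Proof.
move=> nu0; case: n => [|n].
  rewrite !add0r !mul0r scale0r addr0 divff ?mulf_neq0 ?pnatr_eq0 ?gt_eqF//.
  by rewrite ultra0 ultra1 mulr1 scale1r.
have n0 := ler0n R n.
rewrite ultraSS scalerBr !scalerA /= -addrA -scaleNr -scalerDl.
rewrite [X in _ + X *: _](_ : _ = 0) ?scale0r ?addr0; last first.
  by field; rewrite !gt_eqF//; lra.
rewrite [X in X *: _](_ : _ = 1) ?scale1r//.
by field; rewrite !gt_eqF//; lra.
Qed.

(** Both sides obey the recurrence of parameter nu + 1, once x times [ultra nu] is expanded by
    [mulX_ultra]; hence an induction on two consecutive values of n. *)
Lemma ultraS_1subX2 nu n : 0 < nu -> (1 - 'X ^+ 2) * ultra (nu + 1) n =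
  ((2 * nu + 1) / (2 * (n%:R + 1 + nu))) *: (ultra nu n - ultra nu n.+2).
Proof.
move=> nu0.
suff : forall n,
    ((1 - 'X ^+ 2) * ultra (nu + 1) n =
     ((2 * nu + 1) / (2 * (n%:R + 1 + nu))) *: (ultra nu n - ultra nu n.+2)) /\
    ((1 - 'X ^+ 2) * ultra (nu + 1) n.+1 =
     ((2 * nu + 1) / (2 * (n.+1%:R + 1 + nu))) *: (ultra nu n.+1 - ultra nu n.+3)).
  by move=> /(_ n)[].
elim=> [|{}n [IH1 IH2]]; first split.
- rewrite ultraSS ultra0 ultra1 expr2; apply/polyP => k.
  rewrite mulr1 !(coefD, coefN, coefZ, coefXM, coefX, coef1).
  by case: k => [|[|[|k]]]/=; field; rewrite !gt_eqF//; lra.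
- rewrite !ultraSS ultra0 ultra1 expr2 mulrBl -!mulrA mul1r; apply/polyP => k.
  rewrite !(coefD, coefN, coefZ, coefXM, coefX, coef1).
  by case: k => [|[|[|[|k]]]]/=; field; rewrite !gt_eqF//; lra.
- split=> //; have n0 := ler0n R n.
  rewrite [in LHS]ultraSS mulrBr -!scalerAr mulrCA IH1 IH2.
  rewrite -scalerAr mulrBr (mulX_ultra n.+1 nu0) (mulX_ultra n.+3 nu0) /=.
  rewrite !scalerBr !scalerDr !scalerA.
  apply/polyP => k; rewrite !(coefD, coefN, coefZ).
  by field; rewrite !gt_eqF//; lra.
Qed.

Lemma ultra_derivX nu (p : {poly R}) : ultra_deriv nu ('X * p) =
  'X * ultra_deriv nu p + (1 - 'X ^+ 2) * p.
Proof.
by rewrite /ultra_deriv derivM derivX mul1r -!mul_polyC; ring.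
Qed.

Lemma ultra_derivD nu (p q : {poly R}) :
  ultra_deriv nu (p + q) = ultra_deriv nu p + ultra_deriv nu q.
Proof. by rewrite /ultra_deriv derivD -!mul_polyC; ring. Qed.

Lemma ultra_derivZ nu c (p : {poly R}) :
  ultra_deriv nu (c *: p) = c *: ultra_deriv nu p.
Proof. by rewrite /ultra_deriv derivZ -!mul_polyC; ring. Qed.

Lemma ultra_derivM nu (p q : {poly R}) :
  ultra_deriv nu (p * q) = p^`() * ((1 - 'X ^+ 2) * q) + p * ultra_deriv nu q.
Proof. by rewrite /ultra_deriv derivM -!mul_polyC; ring. Qed.

(** The operator is minus the adjoint of d/dx, so it sends the orthogonal family for nu + 1 to that
    for nu, one degree higher. Again a two-step induction, where [ultraS_1subX2] handles the extra
    term of [ultra_derivX]. *)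
Lemma ultra_deriv_ultraS nu n : 0 < nu ->
  ultra_deriv nu (ultra (nu + 1) n) = - (2 * nu + 1) *: ultra nu n.+1.
Proof.
move=> nu0.
suff : forall n,
    (ultra_deriv nu (ultra (nu + 1) n) = - (2 * nu + 1) *: ultra nu n.+1) /\
    (ultra_deriv nu (ultra (nu + 1) n.+1) = - (2 * nu + 1) *: ultra nu n.+2).
  by move=> /(_ n)[].
elim=> [|{}n [IH1 IH2]]; first split.
- by rewrite ultra0 ultra1 /ultra_deriv derivC mulr0 sub0r mulr1 scaleNr.
- rewrite ultraSS ultra0 ultra1 /ultra_deriv derivX mulr1 expr2; apply/polyP => k.
  rewrite !(coefD, coefN, coefZ, coefXM, coefX, coef1).
  by case: k => [|[|[|k]]]/=; field; rewrite !gt_eqF//; lra.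
- split=> //; have n0 := ler0n R n.
  rewrite [in LHS]ultraSS ultra_derivD -scaleNr !ultra_derivZ ultra_derivX.
  rewrite IH1 IH2 -scalerAr (mulX_ultra n.+2 nu0) (ultraS_1subX2 n.+1 nu0) /=.
  apply/polyP => k; rewrite !(coefD, coefN, coefZ).
  by field; rewrite !gt_eqF//; lra.
Qed.

End ultraspherical.

(** * Pochhammer symbols and the classical Gegenbauer polynomials *)

Section pochhammer_gegenbauer.
Variable R : realType.
Implicit Types (nu a : R) (n k m : nat).

Lemma pochhammer0 a : 0 < a -> pochhammer a 0 = 1.
Proof. by move=> a0; rewrite /pochhammer addr0 divff// gt_eqF// Gamma_gt0. Qed.

Lemma pochhammerS a k : 0 < a -> pochhammer a k.+1 = (a + k%:R) * pochhammer a k.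
Proof.
move=> a0; have k0 := ler0n R k; rewrite /pochhammer -natr1 addrA Gamma_rec ?mulrA//.
by lra.
Qed.

Lemma pochhammer_gt0 a k : 0 < a -> 0 < pochhammer a k.
Proof. by move=> a0; rewrite divr_gt0 ?Gamma_gt0// ltr_wpDr. Qed.

Lemma gegenbauer_rec nu n : 0 < nu -> n.+2%:R *: gegenbauer nu n.+2 =
  (2 * (n.+1%:R + nu)) *: ('X * gegenbauer nu n.+1)
  - (n%:R + 2 * nu) *: gegenbauer nu n.
Proof.
move=> nu0.
(* Coefficient of x^m in C_(m + 2k). In these indices the recurrence links h k m, h k (m - 1) and h
   (k - 1) m, which the two contiguity relations make comparable. *)
pose h k m : R := (-1) ^+ k * pochhammer nu (k + m) / (k`!%:R * m`!%:R) * 2 ^+ m.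
have coefE n' m : (gegenbauer nu n')`_m =
    if (m <= n')%N && ~~ odd (n' - m) then h (n' - m)./2 m else 0.
  rewrite /gegenbauer coef_sum.
  have cE k : (((-1) ^+ k * Gamma (nu + (n' - k)%:R) /
      (k`!%:R * (n' - 2 * k)`!%:R * Gamma nu)) *: (2 *: 'X) ^+ (n' - 2 * k))`_m =
      if m == (n' - 2 * k)%N then (-1) ^+ k * pochhammer nu (n' - k) /
      (k`!%:R * (n' - 2 * k)`!%:R) * 2 ^+ m else 0 :> R.
    rewrite coefZ exprZn coefZ coefXn; case: eqP => [->|_]; last by rewrite !mulr0.
    rewrite /pochhammer mulr1; congr (_ * _); field.
    by rewrite !pnatr_eq0 -!lt0n !fact_gt0 gt_eqF// Gamma_gt0.
  under eq_bigr do rewrite cE.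
  case: ifP => H; last first.
    rewrite big_nat big1// => k kn; case: ifP => // /eqP mE.
    by exfalso; move/negP: H; apply; apply/andP; split; lia.
  rewrite big_mkord.
  have Hk : ((n' - m)./2 < n'./2.+1)%N by lia.
  rewrite (bigD1 (Ordinal Hk))//= big1 ?addr0; last first.
    move=> k kn; case: ifP => // /eqP mE.
    by exfalso; move/eqP: kn; apply; apply/val_inj => /=; have := ltn_ord k; lia.
  rewrite ifT; last by lia.
  rewrite /h (_ : n' - 2 * (n' - m)./2 = m)%N; last by lia.
  by rewrite (_ : n' - (n' - m)./2 = (n' - m)./2 + m)%N; last by lia.
apply/polyP => m; rewrite !(coefD, coefN, coefZ, coefXM) !coefE.
have [|H] := boolP ((m <= n.+2) && ~~ odd (n.+2 - m))%N; last first.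
  rewrite (_ : (m <= n) && ~~ odd (n - m) = false)%N; last by lia.
  case: m H => [|m] H /=; first by ring.
  by rewrite (_ : (m <= n.+1) && ~~ odd (n.+1 - m) = false)%N; [ring|lia].
move=> /andP[mn par]; set k := (n.+2 - m)./2.
have nE : n.+2 = (m + k.*2)%N by rewrite /k; lia.
have hSm k' m' : h k' m'.+1 * m'.+1%:R = 2 * (nu + k'%:R + m'%:R) * h k' m'.
  have m0 := ler0n R m'.
  rewrite /h !addnS pochhammerS// factS natrM exprS natrD; field.
  by rewrite !gt_eqF// ?ltr0n ?fact_gt0//; lra.
have hSk k' m' : h k'.+1 m' * k'.+1%:R = - (nu + k'%:R + m'%:R) * h k' m'.
  have k0 := ler0n R k'.
  rewrite /h !addSn pochhammerS// factS natrM exprS natrD; field.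
  by rewrite !gt_eqF// ?ltr0n ?fact_gt0//; lra.
have nR2 : n.+2%:R = m%:R + 2 * k%:R :> R by rewrite nE -mul2n natrD natrM.
have nR : n%:R = m%:R + 2 * k%:R - 2 :> R by rewrite -nR2 -addn2 natrD addrK.
have nR1 : n.+1%:R = m%:R + 2 * k%:R - 1 :> R by rewrite -natr1 nR; ring.
rewrite nR nR1 nR2.
clearbody k; case: k nE {nR nR1 nR2} => [|k] nE.
  have -> : ((m <= n) && ~~ odd (n - m) = false)%N by lia.
  case: m mn par nE => [|m] mn par nE /=; first by lia.
  rewrite ifT; last by lia.
  rewrite (_ : (n.+1 - m)./2 = 0)%N; last by lia.
  by rewrite !mulr0 subr0 !addr0 mulrC hSm -natr1; ring.
have -> : ((m <= n) && ~~ odd (n - m))%N by lia.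
have -> : ((n - m)./2 = k)%N by lia.
have k1 : k.+1%:R != 0 :> R by rewrite pnatr_eq0.
have hk : h k.+1 m = - (nu + k%:R + m%:R) * h k m / k.+1%:R by rewrite -hSk mulfK.
case: m mn par nE hk => [|m] mn par nE hk /=.
  by have k0 := ler0n R k; rewrite hk -natr1; field; rewrite !gt_eqF//; lra.
rewrite ifT; last by lia.
rewrite (_ : (n.+1 - m)./2 = k.+1)%N; last by lia.
have m1 : m.+1%:R != 0 :> R by rewrite pnatr_eq0.
have hm : h k m = h k m.+1 * m.+1%:R / (2 * (nu + k%:R + m%:R)).
  have k0 := ler0n R k; have m0 := ler0n R m.
  by rewrite hSm; field; rewrite !gt_eqF//; lra.
have hkm : h k.+1 m = - (nu + k%:R + m%:R) * h k m / k.+1%:R by rewrite -hSk mulfK.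
have k0 := ler0n R k; have m0 := ler0n R m.
by rewrite hk hkm hm -!natr1; field; rewrite !gt_eqF//; lra.
Qed.

Lemma gegenbauer_ultra nu n : 0 < nu ->
  gegenbauer nu n = (pochhammer (2 * nu) n / n`!%:R) *: ultra nu n.
Proof.
move=> nu0; have nu20 : 0 < 2 * nu by lra.
suff : forall n,
    gegenbauer nu n = (pochhammer (2 * nu) n / n`!%:R) *: ultra nu n /\
    gegenbauer nu n.+1 = (pochhammer (2 * nu) n.+1 / n.+1`!%:R) *: ultra nu n.+1.
  by move=> /(_ n)[].
have G0 : Gamma nu != 0 by rewrite gt_eqF// Gamma_gt0.
elim=> [|{}n [IH1 IH2]]; first split.
- rewrite /gegenbauer big_nat1 pochhammer0// fact0 ultra0 !mul1r invr1 scale1r.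
  by rewrite muln0 !subn0 expr0 addr0 divff// scale1r.
- rewrite /gegenbauer big_nat1 pochhammerS// pochhammer0// fact0 ultra1 !mul1r.
  rewrite muln0 !subn0 expr1 scalerA; congr (_ *: _).
  rewrite Gamma_rec// (_ : 1`!%:R = 1)//. by field.
split=> //; have := gegenbauer_rec n nu0; rewrite IH1 IH2 => H.
have n2 : n.+2%:R != 0 :> R by rewrite pnatr_eq0.
apply: (scalerI n2); rewrite H ultraSS -!scalerAr.
have p0 := pochhammer_gt0 n nu20; have n0 := ler0n R n.
rewrite !pochhammerS// !factS !natrM.
apply/polyP => k; rewrite !(coefD, coefN, coefZ).
have f0 : n`!%:R != 0 :> R by rewrite pnatr_eq0 -lt0n fact_gt0.
by rewrite -!natr1; field; rewrite f0 !gt_eqF//; lra.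
Qed.

End pochhammer_gegenbauer.

(** * Coefficients of the matrix weight *)

Section weight_coefficients.
Variables (R : realFieldType) (L : nat).
Implicit Types (nu : R) (k p q s : int).

(* wf, wg and we extend (nu + L - k + 1)_k / k!, (nu)_p / p! and
   1 / ((nu)_(s + 1) (L - s)!) to all integers in such a way that their contiguity
   relations hold without boundary cases. *)
Definition wf nu k : R :=
  if k is Posz n then (\prod_(s < n) (nu + L%:R - s%:R)) / n`!%:R else 0.

Definition wg nu p : R :=
  if p is Posz n then (\prod_(s < n) (nu + s%:R)) / n`!%:R else 0.

Definition we nu s : R :=
  match s with
  | Posz n => if (n <= L)%N then ((\prod_(u < n.+1) (nu + u%:R)) * (L - n)`!%:R)^-1 else 0
  | Negz t => (\prod_(u < t) (nu - 1 - u%:R)) / (L + t.+1)`!%:R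
  end.

(** With p = i - k and q = j - k, this is the coefficient of [ultra nu (p + q)] in the weight, up to
    factors depending on i and j only. The denominator nu + i + j - k of [alpha] is the last factor
    of (nu)_(s + 1) in [we], s = i + j - k. *)
Definition wcoef nu k p q : R :=
  wf nu k * wg nu p * wg nu q * we nu (k + p + q) * ((p + q)%:~R + nu).

Lemma wf_neg nu k : k < 0 -> wf nu k = 0. Proof. by case: k. Qed.
Lemma wg_neg nu p : p < 0 -> wg nu p = 0. Proof. by case: p. Qed.
Lemma we_gt nu s : L%:Z < s -> we nu s = 0.
Proof. by case: s => // n; rewrite /we => nL; rewrite ifF//; lia. Qed.

(** With [wf_recB1]: the values at k and k - 1 are linear multiples of one quantity of parameter nu
    + 1. [we_rec] and [we_recS] do the same for [we], so that identities mixing nu and nu + 1 reduce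
    to polynomial ones. *)
Lemma wf_rec nu k : 0 < nu ->
  wf nu k = (nu + L%:R + 1 - k%:~R) * (wf (nu + 1) k / (nu + L%:R + 1)).
Proof.
move=> nu0; case: k => [n|n]; last by rewrite /wf mul0r mulr0.
have L0 := ler0n R L.
have H : (\prod_(s < n) (nu + L%:R - s%:R)) * (nu + L%:R + 1) =
  (nu + L%:R + 1 - n%:R) * \prod_(s < n) (nu + 1 + L%:R - s%:R).
  elim: n => [|n IH]; first by rewrite !big_ord0 subr0 mulrC.
  by rewrite !big_ord_recr/= mulrAC IH -natr1; ring.
rewrite /wf mulrA [X in _ = X / _]mulrA -[n%:~R]/(n%:R) -H.
have n0 : n`!%:R != 0 :> R by rewrite pnatr_eq0 -lt0n fact_gt0.
by field; rewrite n0 gt_eqF//; lra.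
Qed.

Lemma wf_recB1 nu k : 0 < nu ->
  wf nu (k - 1) = k%:~R * (wf (nu + 1) k / (nu + L%:R + 1)).
Proof.
move=> nu0; case: k => [[|n]|n]; try by rewrite /wf !(mul0r, mulr0).
have L0 := ler0n R L.
rewrite (_ : n.+1%:Z - 1 = n); last by lia.
rewrite /wf big_ord_recl factS natrM subr0.
have -> : \prod_(i < n) (nu + 1 + L%:R - (lift ord0 i)%:R) =
   \prod_(s < n) (nu + L%:R - s%:R).
  by apply: eq_bigr => i _; rewrite lift0 -natr1; ring.
have n0 : n`!%:R != 0 :> R by rewrite pnatr_eq0 -lt0n fact_gt0.
have n1 := ler0n R n; rewrite -[n.+1%:~R]/(n.+1%:R) -natr1.
by field; rewrite n0 !gt_eqF//; lra.
Qed.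

Lemma wgS nu p : p != -1 -> wg nu (p + 1) = (nu + p%:~R) * (wg nu p / (p%:~R + 1)).
Proof.
case: p => [n|[|n]]// _; last by rewrite /wg mul0r mulr0.
rewrite (_ : Posz n + 1 = n.+1); last by lia.
rewrite /wg big_ord_recr/= factS natrM -[n%:~R]/(n%:R) -natr1.
have n0 : n`!%:R != 0 :> R by rewrite pnatr_eq0 -lt0n fact_gt0.
by have n1 := ler0n R n; field; rewrite n0 !gt_eqF//; lra.
Qed.

Lemma wg_nu1 nu p : 0 < nu -> wg (nu + 1) p = (nu + p%:~R) / nu * wg nu p.
Proof.
move=> nu0; case: p => [n|n]; last by rewrite /wg mulr0.
have H : \prod_(s < n) (nu + 1 + s%:R) * nu = (nu + n%:R) * \prod_(s < n) (nu + s%:R).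
  elim: n => [|n IH]; first by rewrite !big_ord0 addr0 mulrC.
  by rewrite !big_ord_recr/= mulrAC IH -natr1; ring.
have n0 : n`!%:R != 0 :> R by rewrite pnatr_eq0 -lt0n fact_gt0.
apply: (mulIf (lt0r_neq0 nu0)); rewrite /wg mulrAC H -[n%:~R]/(n%:R).
by field; rewrite n0 gt_eqF.
Qed.

Lemma we_rec nu s : 0 < nu -> we nu s = (nu + s%:~R + 1) * (we (nu + 1) s / nu).
Proof.
move=> nu0; case: s => [n|t].
  rewrite /we; case: ifP => nL; last by rewrite mul0r mulr0.
  have H : \prod_(u < n.+1) (nu + 1 + u%:R) * nu =
     (nu + n%:R + 1) * \prod_(u < n.+1) (nu + u%:R).
    elim: n {nL} => [|n IH]; first by rewrite !big_ord_recr !big_ord0 !addr0/=; ring.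
    by rewrite big_ord_recr [X in _ = _ * X]big_ord_recr/= mulrAC IH -natr1; ring.
  have n0 : (L - n)`!%:R != 0 :> R by rewrite pnatr_eq0 -lt0n fact_gt0.
  have P0 : \prod_(u < n.+1) (nu + u%:R) != 0.
    by apply/prodf_neq0 => u _; rewrite gt_eqF// ltr_wpDr.
  have P1 : \prod_(u < n.+1) (nu + 1 + u%:R) != 0.
    apply/prodf_neq0 => u _; rewrite gt_eqF// ltr_wpDr//; lra.
  have -> : \prod_(u < n.+1) (nu + u%:R) =
     \prod_(u < n.+1) (nu + 1 + u%:R) * nu / (nu + n%:R + 1).
    by rewrite H mulrAC divff ?mul1r// gt_eqF//; have := ler0n R n; lra.
  have h := ler0n R n; rewrite -[n%:~R]/(n%:R).
  by field; rewrite P1 n0 !gt_eqF//; lra.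
rewrite /we.
have H : nu * \prod_(u < t) (nu - 1 - u%:R) = (nu - t%:R) * \prod_(u < t) (nu + 1 - 1 - u%:R).
  elim: t => [|t IH]; first by rewrite !big_ord0 subr0 mulrC.
  by rewrite !big_ord_recr/= mulrA IH -natr1; ring.
have n0 : (L + t.+1)`!%:R != 0 :> R by rewrite pnatr_eq0 -lt0n fact_gt0.
have -> : (Negz t)%:~R = - t%:R - 1 :> R by rewrite NegzE intrN -[t.+1%:~R]/(t.+1%:R) -natr1; ring.
apply: (mulfI (lt0r_neq0 nu0)); rewrite [LHS]mulrA H.
by field; rewrite n0 gt_eqF.
Qed.

Lemma we_recS nu s : 0 < nu -> we nu (s + 1) = (L%:R - s%:~R) * (we (nu + 1) s / nu).
Proof.
move=> nu0; case: s => [n|t].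
  rewrite (_ : Posz n + 1 = n.+1); last by lia.
  rewrite /we; case: ifP => nL; last first.
    case: ifP => nL'; last by rewrite mul0r mulr0.
    by rewrite (_ : n = L) ?subrr ?mul0r//; lia.
  rewrite ifT; last by lia.
  rewrite big_ord_recl addr0.
  have -> : \prod_(i < n.+1) (nu + (lift ord0 i)%:R) = \prod_(u < n.+1) (nu + 1 + u%:R).
    by apply: eq_bigr => i _; rewrite lift0 -natr1; ring.
  rewrite -(subnSK nL) factS natrM subnSK//.
  have -> : L%:R - n%:~R = (L - n)%:R :> R by rewrite natrB//; lia.
  have P1 : \prod_(u < n.+1) (nu + 1 + u%:R) != 0.
    by apply/prodf_neq0 => u _; rewrite gt_eqF// ltr_wpDr//; lra.
  have n0 : (L - n.+1)`!%:R != 0 :> R by rewrite pnatr_eq0 -lt0n fact_gt0.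
  have n1 : (L - n)%:R != 0 :> R by rewrite pnatr_eq0; lia.
  by field; rewrite P1 n0 n1 gt_eqF.
have -> : (Negz t)%:~R = - t%:R - 1 :> R by rewrite NegzE intrN -[t.+1%:~R]/(t.+1%:R) -natr1; ring.
have t0 := ler0n R t; have L0 := ler0n R L.
case: t t0 => [|t] t0.
  rewrite (_ : Negz 0 + 1 = 0%N)// /we leq0n big_ord_recr !big_ord0 subn0 addr0 addn1 factS natrM.
  have n0 : L`!%:R != 0 :> R by rewrite pnatr_eq0 -lt0n fact_gt0.
  by rewrite -natr1/=; field; rewrite n0 !gt_eqF//; lra.
rewrite (_ : Negz t.+1 + 1 = Negz t); last by lia.
rewrite /we big_ord_recl subr0.
have -> : \prod_(i < t) (nu + 1 - 1 - (lift ord0 i)%:R) = \prod_(u < t) (nu - 1 - u%:R).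
  by apply: eq_bigr => i _; rewrite lift0 -natr1; ring.
have n0 : (L + t.+1)`!%:R != 0 :> R by rewrite pnatr_eq0 -lt0n fact_gt0.
have -> : (L + t.+2)`!%:R = (L%:R + t%:R + 2) * (L + t.+1)`!%:R :> R.
  rewrite (_ : L + t.+2 = (L + t.+1).+1)%N; last by lia.
  by rewrite factS natrM -natr1 natrD -natr1; ring.
have t1 := ler0n R t.
by rewrite -[t.+1%:R]natr1/=; field; rewrite n0 !gt_eqF//; lra.
Qed.

End weight_coefficients.

(** * Coefficient identities behind the symmetry and the Pearson equations *)

Section weight_identities.
Variables (R : realFieldType) (L : nat).
Implicit Types (nu : R) (k p q s : int).

(** [xup] and [xdown] are the coefficients of x times [ultra nu m] on degrees m + 1 and m - 1. *)
Definition xup nu (m : int) : R := (m%:~R + 2 * nu) / (2 * (m%:~R + nu)).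
Definition xdown nu (m : int) : R := m%:~R / (2 * (m%:~R + nu)).

Let wbase nu k p q : R := wf L nu k * wg nu p * wg nu q * we L nu (k + p + q).

(** The factor p + q + nu built into [wcoef] cancels the denominators of [xup] and [xdown]. It can
    vanish only for p + q < 0, where [wcoef] is 0. *)
Let wcoef_mul nu k p q (x : R) : 0 < nu ->
  wcoef L nu k p q * (x / (2 * ((p + q)%:~R + nu))) = wbase nu k p q * (x / 2).
Proof.
move=> nu0; rewrite /wcoef -/(wbase nu k p q).
have [p0|p0] := ltP p 0; first by rewrite /wbase (wg_neg _ p0) !(mulr0, mul0r).
have [q0|q0] := ltP q 0; first by rewrite /wbase (wg_neg _ q0) !(mulr0, mul0r).
have : 0 <= (p + q)%:~R :> R by rewrite ler0z; lia.
by move=> pq0; field; rewrite gt_eqF//; lra.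
Qed.

Let wg_param nu p : p != -1 -> exists t,
  wg nu (p + 1) = (nu + p%:~R) * t /\ wg nu p = (p%:~R + 1) * t.
Proof.
move=> p1; exists (wg nu p / (p%:~R + 1)); split; first exact: wgS.
have p0 : p%:~R + 1 != 0 :> R.
  by rewrite -[1]/(1%:~R) -intrD intr_eq0; lia.
by rewrite mulrC divfK.
Qed.

Let wg_N1S nu : wg nu (-1 + 1) = 1.
Proof. by rewrite (_ : -1 + 1 = 0%N :> int)// /wg big_ord0 divr1. Qed.

Let wg_N1 nu : wg nu (-1) = 0. Proof. by []. Qed.

Let wgE := (wg_N1, wg_N1S).

(** With p = i - k and q = j - k, the coefficient on degree i + j + 1 - 2k in entry (i, j) of X_nu
    W_nu - W_nu X_nu^t, scalings removed. The values -1 of p and q are split off, as the contiguity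
    relation of [wg] fails there. *)
Lemma weight_coef_sym nu k p q (i j : R) : 0 < nu ->
  i = k%:~R + p%:~R -> j = k%:~R + q%:~R ->
  2 * (nu + i) * (i + 1) * wcoef L nu k (p + 1) q
  + 2 * (nu + L%:R - i) * (L%:R - i + 1) * wcoef L nu (k - 1) p (q + 1)
  - 2 * (nu + j) * (j + 1) * wcoef L nu k p (q + 1)
  - 2 * (nu + L%:R - j) * (L%:R - j + 1) * wcoef L nu (k - 1) (p + 1) q
  + 4 * (j * (L%:R - j) - i * (L%:R - i)) *
    (wcoef L nu k p q * xup nu (p + q)
     + wcoef L nu (k - 1) (p + 1) (q + 1) * xdown nu (p + q + 2)) = 0.
Proof.
move=> nu0 -> ->.
rewrite (_ : p + q + 2 = (p + 1) + (q + 1)); last by lia.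
rewrite /xup /xdown !wcoef_mul// /wbase /wcoef.
rewrite (_ : k + (p + 1) + q = k + p + q + 1); last by lia.
rewrite (_ : k - 1 + p + (q + 1) = k + p + q); last by lia.
rewrite (_ : k + p + (q + 1) = k + p + q + 1); last by lia.
rewrite (_ : k - 1 + (p + 1) + q = k + p + q); last by lia.
rewrite (_ : k - 1 + (p + 1) + (q + 1) = k + p + q + 1); last by lia.
rewrite (wf_rec L k nu0) (wf_recB1 L k nu0) (we_recS L _ nu0) (we_rec L _ nu0).
set t := wf _ _ _ / _; set u := we _ _ _ / _; move: t u => t u.
rewrite !(intrD _ _ _).
have [->|/(wg_param nu)[v [-> ->]]] := eqVneq p (-1);
have [->|/(wg_param nu)[w [-> ->]]] := eqVneq q (-1); rewrite ?wgE.
all: by field.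
Qed.

(** The same coefficient for W_nu Psi; the right-hand side comes from [ultra_deriv_ultraS]. *)
Lemma weight_coef_Pearson1 nu k p q (j : R) : 0 < nu ->
  j = k%:~R + q%:~R ->
  (nu + j) * (j + 1) * wcoef L nu k p (q + 1)
  + (nu + L%:R - j) * (L%:R - j + 1) * wcoef L nu (k - 1) (p + 1) q
  - 2 * (nu + j) * (nu + L%:R - j) *
    (wcoef L nu k p q * xup nu (p + q)
     + wcoef L nu (k - 1) (p + 1) (q + 1) * xdown nu (p + q + 2))
  = - (nu * (L%:R + 2 * nu)) * wcoef L (nu + 1) k p q.
Proof.
move=> nu0 ->.
rewrite (_ : p + q + 2 = (p + 1) + (q + 1)); last by lia.
rewrite /xup /xdown !wcoef_mul// /wbase /wcoef.
rewrite (_ : k + p + (q + 1) = k + p + q + 1); last by lia.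
rewrite (_ : k - 1 + (p + 1) + q = k + p + q); last by lia.
rewrite (_ : k - 1 + (p + 1) + (q + 1) = k + p + q + 1); last by lia.
rewrite (wf_rec L k nu0) (wf_recB1 L k nu0) (we_recS L _ nu0) (we_rec L _ nu0).
rewrite !wg_nu1//; set t := wf _ _ _; set u := we _ _ _; move: t u => t u.
have L0 := ler0n R L; rewrite !(intrD _ _ _).
have [->|/(wg_param nu)[v [-> ->]]] := eqVneq p (-1);
have [->|/(wg_param nu)[w [-> ->]]] := eqVneq q (-1); rewrite ?wgE.
all: by field; rewrite !gt_eqF//; lra.
Qed.

Let wg_N2SS nu : wg nu (-2 + 2) = 1.
Proof. by rewrite (_ : -2 + 2 = 0%N :> int)// /wg big_ord0 divr1. Qed.

Let wg_N1SS nu : wg nu (-1 + 2) = nu.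
Proof. by rewrite (_ : -1 + 2 = 1%N :> int)// /wg big_ord1 addr0 divr1. Qed.

Let wg_N2S nu : wg nu (-2 + 1) = 0. Proof. by []. Qed.

Let wg_N2 nu : wg nu (-2) = 0. Proof. by []. Qed.

Let wgE2 := (wg_N1, wg_N1S, wg_N1SS, wg_N2, wg_N2S, wg_N2SS).

Let xdown0 nu : xdown nu 0 = 0. Proof. by rewrite /xdown mul0r. Qed.

Let wg_param2 nu p : 0 <= p -> exists t,
  [/\ wg nu (p + 2) = (nu + p%:~R) * (nu + p%:~R + 1) * t,
   wg nu (p + 1) = (nu + p%:~R) * (p%:~R + 2) * t &
   wg nu p = (p%:~R + 1) * (p%:~R + 2) * t].
Proof.
move=> p0; have h : 0 <= p%:~R :> R by rewrite ler0z.
exists (wg nu p / ((p%:~R + 1) * (p%:~R + 2))).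
have -> : wg nu (p + 2) = (nu + (p + 1)%:~R) * (wg nu (p + 1) / ((p + 1)%:~R + 1)).
  by rewrite -wgS; [congr wg; lia|lia].
have -> : wg nu (p + 1) = (nu + p%:~R) * (wg nu p / (p%:~R + 1)).
  by rewrite wgS//; lia.
by rewrite intrD; split; field; rewrite !gt_eqF//; lra.
Qed.

(** The coefficient on degree i + j + 2 - 2k for W_nu Phi; the two fractions on the right come from
    [ultraS_1subX2] in degrees p + q + 2 and p + q. *)
Lemma weight_coef_Pearson2 nu k p q (j y : R) : 0 < nu ->
  j = k%:~R + q%:~R -> y = L%:R - j ->
  (j + 1) * (j + 2) * wcoef L nu k p (q + 2)
  + (y + 1) * (y + 2) * wcoef L nu (k - 2) (p + 2) q
  + 2 * (2 * j + 1 - L%:R) * (j + 1) *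
    (wcoef L nu k p (q + 1) * xup nu (p + q + 1)
     + wcoef L nu (k - 1) (p + 1) (q + 2) * xdown nu (p + q + 3))
  + 2 * (L%:R - 2 * j + 1) * (y + 1) *
    (wcoef L nu (k - 1) (p + 1) q * xup nu (p + q + 1)
     + wcoef L nu (k - 2) (p + 2) (q + 1) * xdown nu (p + q + 3))
  - 4 * (nu + j) * (nu + y) *
    ((wcoef L nu k p q * xup nu (p + q)
      + wcoef L nu (k - 1) (p + 1) (q + 1) * xdown nu (p + q + 2)) * xup nu (p + q + 1)
     + (wcoef L nu (k - 1) (p + 1) (q + 1) * xup nu (p + q + 2)
      + wcoef L nu (k - 2) (p + 2) (q + 2) * xdown nu (p + q + 4)) * xdown nu (p + q + 3))
  + (4 * (nu + j) * (nu + y) + y ^+ 2 + j ^+ 2 - 4 * j * y - y - j)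
    * wcoef L nu (k - 1) (p + 1) (q + 1)
  = 2 * nu * (L%:R + 2 * nu) * (L%:R + 2 * nu + 1) *
    (wcoef L (nu + 1) (k - 1) (p + 1) (q + 1) / (2 * ((p + q + 2)%:~R + (nu + 1)))
     - wcoef L (nu + 1) k p q / (2 * ((p + q)%:~R + (nu + 1)))).
Proof.
move=> nu0 -> ->; have nu10 : 0 < nu + 1 by lra.
rewrite /wcoef.
rewrite (_ : k + p + (q + 2) = k + p + q + 1 + 1); last by lia.
rewrite (_ : k - 2 + (p + 2) + q = k + p + q); last by lia.
rewrite (_ : k + p + (q + 1) = k + p + q + 1); last by lia.
rewrite (_ : k - 1 + (p + 1) + (q + 2) = k + p + q + 1 + 1); last by lia.
rewrite (_ : k - 1 + (p + 1) + q = k + p + q); last by lia.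
rewrite (_ : k - 2 + (p + 2) + (q + 1) = k + p + q + 1); last by lia.
rewrite (_ : k - 1 + (p + 1) + (q + 1) = k + p + q + 1); last by lia.
rewrite (_ : k - 2 + (p + 2) + (q + 2) = k + p + q + 1 + 1); last by lia.
rewrite (_ : k - 2 = k - 1 - 1); last by lia.
have wfB1 := wf_recB1 L (k - 1) nu0.
rewrite wfB1 (wf_recB1 L k nu0) (wf_rec L k nu0) (wf_rec L k nu10) (wf_recB1 L k nu10).
have weSS := we_recS L (k + p + q + 1) nu0.
rewrite weSS (we_recS L (k + p + q) nu0) (we_rec L (k + p + q) nu0).
rewrite (we_recS L (k + p + q) nu10) (we_rec L (k + p + q) nu10).
rewrite !wg_nu1//; set t := wf _ _ _; set u := we _ _ _; move: t u => t u.
have L0 := ler0n R L.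
(* Shifts by two: below -2 all terms vanish, at -2 and -1 the few nonzero values of [wg] are
   inserted, and from 0 on three consecutive values share a factor. *)
have [pN|pN] := ltP p (-2).
  rewrite (wg_neg _ (p := p)) ?(wg_neg _ (p := p + 1)) ?(wg_neg _ (p := p + 2)); try lia.
  by rewrite !(mul0r, mulr0, addr0, subr0).
have [qN|qN] := ltP q (-2).
  rewrite (wg_neg _ (p := q)) ?(wg_neg _ (p := q + 1)) ?(wg_neg _ (p := q + 2)); try lia.
  by rewrite !(mul0r, mulr0, addr0, subr0).
have pC : p = -2 \/ p = -1 \/ 0 <= p by lia.
have qC : q = -2 \/ q = -1 \/ 0 <= q by lia.
case: pC => [->|[->|p0]]; case: qC => [->|[->|q0]]; rewrite ?wgE2.
all: rewrite ?(mul0r, mulr0, add0r, addr0, subr0, oppr0).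
(* The only terms left contain [xdown nu 0], so the possibly zero denominators at negative degrees
   do no harm. *)
- by rewrite (_ : -2 + -2 + 4 = 0)// xdown0 ?(mul0r, mulr0, add0r, addr0, subr0, oppr0).
- by rewrite (_ : -2 + -1 + 3 = 0)// xdown0 ?(mul0r, mulr0, add0r, addr0, subr0, oppr0).
- have qx : 0 <= q%:~R :> R by rewrite ler0z.
  have [w [-> -> ->]] := wg_param2 nu q0.
  rewrite /xup /xdown !intrD.
  move: qx; move: (q%:~R) (k%:~R) => x2 z y0.
  by field; rewrite !gt_eqF//; lra.
- by rewrite (_ : -1 + -2 + 3 = 0)// xdown0 ?(mul0r, mulr0, add0r, addr0, subr0, oppr0).
- rewrite (_ : -1 + -1 + 2 = 0)// xdown0 ?(mul0r, mulr0, add0r, addr0, subr0, oppr0).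
  rewrite /xup /xdown !intrD; move: (k%:~R) => z.
  by field; rewrite !gt_eqF//; lra.
- have qx : 0 <= q%:~R :> R by rewrite ler0z.
  have [w [-> -> ->]] := wg_param2 nu q0.
  rewrite /xup /xdown !intrD.
  move: qx; move: (q%:~R) (k%:~R) => x2 z y0.
  by field; rewrite !gt_eqF//; lra.
- have px : 0 <= p%:~R :> R by rewrite ler0z.
  have [v [-> -> ->]] := wg_param2 nu p0.
  rewrite /xup /xdown !intrD.
  move: px; move: (p%:~R) (k%:~R) => x2 z y0.
  by field; rewrite !gt_eqF//; lra.
- have px : 0 <= p%:~R :> R by rewrite ler0z.
  have [v [-> -> ->]] := wg_param2 nu p0.
  rewrite /xup /xdown !intrD.
  move: px; move: (p%:~R) (k%:~R) => x2 z y0.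
  by field; rewrite !gt_eqF//; lra.
have px : 0 <= p%:~R :> R by rewrite ler0z.
have qx : 0 <= q%:~R :> R by rewrite ler0z.
have [v [-> -> ->]] := wg_param2 nu p0; have [w [-> -> ->]] := wg_param2 nu q0.
rewrite /xup /xdown !intrD.
move: px qx; move: (p%:~R) (q%:~R) (k%:~R) => x1 x2 z x0 y0.
by field; rewrite !gt_eqF//; lra.
Qed.

End weight_identities.

(** * Entries of the weight as combinations of ultraspherical polynomials *)

Section hat_weight.
Variables (R : realFieldType) (L : nat).
Implicit Types (nu : R) (d i j k p q s : int) (phi psi : int -> R).

Let int_nat (m : int) : 0 <= m -> exists n : nat, m = n.
Proof. by case: m => // n _; exists n. Qed.

Definition ultraz nu (m : int) : {poly R} := if m is Posz n then ultra nu n else 0.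

Definition wsum nu d phi : {poly R} := \sum_(k < L.+4) phi k *: ultraz nu (d - 2 * k%:Z).

(* Up to a scalar, the entries of the weight divided by i! (L - i)! j! (L - j)!; the
   range of k in wsum is larger than needed, to leave room for shifts of the index. *)
Definition hatw nu i j : {poly R} :=
  wsum nu (i + j) (fun k => wcoef L nu k (i - k) (j - k)).

Lemma eq_wsum nu d d' phi psi : d = d' -> (forall k, phi k = psi k) ->
  wsum nu d phi = wsum nu d' psi.
Proof. by move=> -> H; apply: eq_bigr => k _; rewrite H. Qed.

Lemma wsumZ nu d a phi : a *: wsum nu d phi = wsum nu d (fun k => a * phi k).
Proof. by rewrite scaler_sumr; apply: eq_bigr => k _; rewrite scalerA. Qed.

Lemma wsumD nu d phi psi :
  wsum nu d phi + wsum nu d psi = wsum nu d (fun k => phi k + psi k).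
Proof. by rewrite -big_split; apply: eq_bigr => k _; rewrite scalerDl. Qed.

Lemma wsumN nu d phi : - wsum nu d phi = wsum nu d (fun k => - phi k).
Proof. by rewrite -sumrN; apply: eq_bigr => k _; rewrite scaleNr. Qed.

Lemma wsum0 nu d phi : (forall k, phi k = 0) -> wsum nu d phi = 0.
Proof. by move=> H; rewrite /wsum big1// => k _; rewrite H scale0r. Qed.

(** Reindexing k as k - 1: phi(-1) is the new first coefficient, phi(L + 3) the last one, which
    drops out. *)
Lemma wsum_shift nu d phi : phi (-1) = 0 -> phi (L%:Z + 3) = 0 ->
  wsum nu d phi = wsum nu (d + 2) (fun k => phi (k - 1)).
Proof.
move=> H0 H1; rewrite /wsum [RHS]big_ord_recl [LHS]big_ord_recr /=.
rewrite (_ : phi L.+3 = 0) ?scale0r ?addr0; last by rewrite -H1; congr phi; lia.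
rewrite sub0r H0 scale0r add0r; apply: eq_bigr => k _.
by rewrite /bump /=; congr (phi _ *: ultraz _ _); lia.
Qed.

Lemma wsum_mulX nu d phi : 0 < nu -> (forall k, d < 2 * k -> phi k = 0) ->
  phi (-1) = 0 -> phi (L%:Z + 3) = 0 ->
  'X * wsum nu d phi =
  wsum nu (d + 1) (fun k => phi k * xup nu (d - 2 * k)
                            + phi (k - 1) * xdown nu (d - 2 * k + 2)).
Proof.
move=> nu0 Hd H0 H1; rewrite -wsumD.
transitivity (wsum nu (d + 1) (fun k => phi k * xup nu (d - 2 * k)) +
              wsum nu (d - 1) (fun k => phi k * xdown nu (d - 2 * k))).
  rewrite /wsum mulr_sumr -big_split; apply: eq_bigr => k _ /=.
  (* [ultraz] is 0 in negative degrees, where the recurrence breaks down: it would produce degree 0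
     out of degree -1. Hence the vanishing required of phi. *)
  have [dk|dk] := ltP d (2 * k%:Z); first by rewrite Hd// !mul0r !scale0r mulr0 addr0.
  rewrite -scalerAr -[(_ * xup _ _) *: _]scalerA -[(_ * xdown _ _) *: _]scalerA -scalerDr.
  congr (_ *: _).
  have -> : d + 1 - 2 * k%:Z = d - 2 * k%:Z + 1 by lia.
  have -> : d - 1 - 2 * k%:Z = d - 2 * k%:Z - 1 by lia.
  have [n ->] := int_nat (etrans (subr_ge0 _ _) dk).
  rewrite (_ : Posz n + 1 = n.+1); last by lia.
  rewrite [ultraz _ n]/= mulX_ultra// /xup /xdown /=; congr (_ + _).
  case: n => [|n]; first by rewrite mul0r !scale0r.
  by rewrite (_ : n.+1%:Z - 1 = n)//; lia.
congr (_ + _); rewrite wsum_shift ?H0 ?H1 ?mul0r//.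
apply: eq_wsum => [|k]; first by lia.
by congr (_ * xdown _ _); lia.
Qed.

Lemma wcoef_out nu k p q : [|| k < 0, p < 0, q < 0 | L%:Z < k + p + q] ->
  wcoef L nu k p q = 0.
Proof.
case/or4P => H; rewrite /wcoef ?(wf_neg _ _ H) ?(wg_neg _ H) ?(we_gt _ H);
by rewrite !(mul0r, mulr0).
Qed.

Lemma hatw_out nu i j : [|| i < 0, L%:Z < i, j < 0 | L%:Z < j] -> hatw nu i j = 0.
Proof.
move=> H; apply: wsum0 => k; apply: wcoef_out; lia.
Qed.

(** This and the next lemmas write the neighbours of entry (i, j), and x times that entry, as sums
    of the common degree i + j + 1, ready for a comparison of coefficients. *)
Lemma hatwD1l nu i j : hatw nu (i + 1) j =
  wsum nu (i + j + 1) (fun k => wcoef L nu k (i - k + 1) (j - k)).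
Proof. by apply: eq_wsum => [|k]; [lia|congr wcoef; lia]. Qed.

Lemma hatwD1r nu i j : hatw nu i (j + 1) =
  wsum nu (i + j + 1) (fun k => wcoef L nu k (i - k) (j - k + 1)).
Proof. by apply: eq_wsum => [|k]; [lia|congr wcoef; lia]. Qed.

Lemma hatwB1l nu i j : hatw nu (i - 1) j =
  wsum nu (i + j + 1) (fun k => wcoef L nu (k - 1) (i - k) (j - k + 1)).
Proof.
rewrite /hatw wsum_shift ?wcoef_out//; try lia.
by apply: eq_wsum => [|k]; [lia|congr wcoef; lia].
Qed.

Lemma hatwB1r nu i j : hatw nu i (j - 1) =
  wsum nu (i + j + 1) (fun k => wcoef L nu (k - 1) (i - k + 1) (j - k)).
Proof.
rewrite /hatw wsum_shift ?wcoef_out//; try lia.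
by apply: eq_wsum => [|k]; [lia|congr wcoef; lia].
Qed.

Lemma mulX_hatw nu i j : 0 < nu -> 'X * hatw nu i j =
  wsum nu (i + j + 1) (fun k =>
    wcoef L nu k (i - k) (j - k) * xup nu (i - k + (j - k))
    + wcoef L nu (k - 1) (i - k + 1) (j - k + 1) * xdown nu (i - k + (j - k) + 2)).
Proof.
move=> nu0; rewrite /hatw wsum_mulX ?wcoef_out//; try lia.
  apply: eq_wsum => // k.
  have -> : i + j - 2 * k = i - k + (j - k) by lia.
  by congr (_ + wcoef _ _ _ _ _ * _); lia.
by move=> k ijk; apply: wcoef_out; lia.
Qed.

Lemma hatw_sym nu i j : 0 < nu ->
  (2 * (nu + i%:~R) * (i%:~R + 1)) *: hatw nu (i + 1) j
  + (2 * (nu + L%:R - i%:~R) * (L%:R - i%:~R + 1)) *: hatw nu (i - 1) j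
  - (2 * (nu + j%:~R) * (j%:~R + 1)) *: hatw nu i (j + 1)
  - (2 * (nu + L%:R - j%:~R) * (L%:R - j%:~R + 1)) *: hatw nu i (j - 1)
  + (4 * (j%:~R * (L%:R - j%:~R) - i%:~R * (L%:R - i%:~R))) *: ('X * hatw nu i j) = 0.
Proof.
move=> nu0; rewrite hatwD1l hatwD1r hatwB1l hatwB1r mulX_hatw// !wsumZ !wsumN !wsumD.
apply: wsum0 => k; apply: (@weight_coef_sym _ L nu k (i - k) (j - k)) => //.
  by rewrite -intrD; congr (_%:~R); lia.
by rewrite -intrD; congr (_%:~R); lia.
Qed.

Lemma ultra_deriv_sum nu (I : Type) (r : seq I) (F : I -> {poly R}) :
  ultra_deriv nu (\sum_(i <- r) F i) = \sum_(i <- r) ultra_deriv nu (F i).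
Proof.
elim: r => [|x r IH]; last by rewrite !big_cons ultra_derivD IH.
by rewrite !big_nil /ultra_deriv derivC !mulr0 scaler0 subr0.
Qed.

Lemma hatw_Pearson1 nu i j : 0 < nu ->
  ((nu + j%:~R) * (j%:~R + 1)) *: hatw nu i (j + 1)
  + ((nu + L%:R - j%:~R) * (L%:R - j%:~R + 1)) *: hatw nu i (j - 1)
  - (2 * (nu + j%:~R) * (nu + L%:R - j%:~R)) *: ('X * hatw nu i j)
  = (nu * (L%:R + 2 * nu) / (2 * nu + 1)) *: ultra_deriv nu (hatw (nu + 1) i j).
Proof.
move=> nu0; rewrite hatwD1r hatwB1r mulX_hatw//.
have -> : ultra_deriv nu (hatw (nu + 1) i j) =
   wsum nu (i + j + 1) (fun k => - (2 * nu + 1) * wcoef L (nu + 1) k (i - k) (j - k)).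
  rewrite ultra_deriv_sum; apply: eq_bigr => k _.
  rewrite ultra_derivZ [_ * wcoef _ _ _ _ _]mulrC -[(wcoef _ _ _ _ _ * _) *: _]scalerA.
  have [H|H] := ltP (i - k%:Z + (j - k%:Z)) 0; first by rewrite wcoef_out ?scale0r//; lia.
  congr (_ *: _).
  have [n Hn] := int_nat H.
  rewrite (_ : i + j - 2 * k%:Z = n); last by lia.
  rewrite (_ : i + j + 1 - 2 * k%:Z = n.+1); last by lia.
  exact: ultra_deriv_ultraS.
rewrite !wsumZ !wsumN !wsumD; apply: eq_wsum => // k.
rewrite (@weight_coef_Pearson1 _ L nu k (i - k) (j - k) j%:~R)//; last first.
  by rewrite -intrD; congr (_%:~R); lia.
by field; rewrite gt_eqF//; lra.
Qed.

Lemma hatwD2r nu i j : hatw nu i (j + 2) =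
  wsum nu (i + j + 2) (fun k => wcoef L nu k (i - k) (j - k + 2)).
Proof. by apply: eq_wsum => [|k]; [lia|congr wcoef; lia]. Qed.

Lemma hatwB2r nu i j : hatw nu i (j - 2) =
  wsum nu (i + j + 2) (fun k => wcoef L nu (k - 2) (i - k + 2) (j - k)).
Proof.
rewrite /hatw wsum_shift ?wcoef_out//; try lia.
rewrite wsum_shift ?wcoef_out//; try lia.
by apply: eq_wsum => [|k]; [lia|congr wcoef; lia].
Qed.

Lemma hatw_shift nu i j : hatw nu i j =
  wsum nu (i + j + 2) (fun k => wcoef L nu (k - 1) (i - k + 1) (j - k + 1)).
Proof.
rewrite /hatw wsum_shift ?wcoef_out//; try lia.
by apply: eq_wsum => [|k]; [lia|congr wcoef; lia].
Qed.

Lemma mulX_hatwD1r nu i j : 0 < nu -> 'X * hatw nu i (j + 1) =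
  wsum nu (i + j + 2) (fun k =>
    wcoef L nu k (i - k) (j - k + 1) * xup nu (i - k + (j - k) + 1)
    + wcoef L nu (k - 1) (i - k + 1) (j - k + 2) * xdown nu (i - k + (j - k) + 3)).
Proof.
move=> nu0; rewrite mulX_hatw//; apply: eq_wsum => [|k]; first by lia.
by congr (wcoef _ _ _ _ _ * xup _ _ + wcoef _ _ _ _ _ * xdown _ _); lia.
Qed.

Lemma mulX_hatwB1r nu i j : 0 < nu -> 'X * hatw nu i (j - 1) =
  wsum nu (i + j + 2) (fun k =>
    wcoef L nu (k - 1) (i - k + 1) (j - k) * xup nu (i - k + (j - k) + 1)
    + wcoef L nu (k - 2) (i - k + 2) (j - k + 1) * xdown nu (i - k + (j - k) + 3)).
Proof.
move=> nu0; rewrite mulX_hatw// wsum_shift ?wcoef_out ?mul0r ?addr0//; try lia.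
apply: eq_wsum => [|k]; first by lia.
by congr (wcoef _ _ _ _ _ * xup _ _ + wcoef _ _ _ _ _ * xdown _ _); lia.
Qed.

Lemma mulXX_hatw nu i j : 0 < nu -> 'X * ('X * hatw nu i j) =
  wsum nu (i + j + 2) (fun k =>
    (wcoef L nu k (i - k) (j - k) * xup nu (i - k + (j - k))
     + wcoef L nu (k - 1) (i - k + 1) (j - k + 1) * xdown nu (i - k + (j - k) + 2))
      * xup nu (i - k + (j - k) + 1)
    + (wcoef L nu (k - 1) (i - k + 1) (j - k + 1) * xup nu (i - k + (j - k) + 2)
     + wcoef L nu (k - 2) (i - k + 2) (j - k + 2) * xdown nu (i - k + (j - k) + 4))
      * xdown nu (i - k + (j - k) + 3)).
Proof.
move=> nu0; rewrite mulX_hatw// wsum_mulX//.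
- apply: eq_wsum => [|k]; first by lia.
  by congr ((_ + _) * xup _ _ + (wcoef _ _ _ _ _ * xup _ _ + wcoef _ _ _ _ _ * xdown _ _) * xdown _ _); lia.
- move=> k H; rewrite wcoef_out ?mul0r ?add0r; last by lia.
  (* In degree 0 the lowering coefficient is 0, so x times the entry has no term of degree -1. *)
  have [->|H2] := eqVneq (i - k + (j - k) + 2) 0; first by rewrite /xdown mul0r mulr0.
  by rewrite wcoef_out ?mul0r//; lia.
- by rewrite !wcoef_out ?mul0r ?addr0//; lia.
- by rewrite !wcoef_out ?mul0r ?addr0//; lia.
Qed.

Lemma hatw_Pearson2 nu i j : 0 < nu -> let y := L%:R - j%:~R in
  ((j%:~R + 1) * (j%:~R + 2)) *: hatw nu i (j + 2)
  + ((y + 1) * (y + 2)) *: hatw nu i (j - 2)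
  + (2 * (2 * j%:~R + 1 - L%:R) * (j%:~R + 1)) *: ('X * hatw nu i (j + 1))
  + (2 * (L%:R - 2 * j%:~R + 1) * (y + 1)) *: ('X * hatw nu i (j - 1))
  - (4 * (nu + j%:~R) * (nu + y)) *: ('X * ('X * hatw nu i j))
  + (4 * (nu + j%:~R) * (nu + y) + y ^+ 2 + j%:~R ^+ 2 - 4 * j%:~R * y - y - j%:~R)
    *: hatw nu i j
  = (2 * nu * (L%:R + 2 * nu) * (L%:R + 2 * nu + 1) / (2 * nu + 1)) *:
    ((1 - 'X ^+ 2) * hatw (nu + 1) i j).
Proof.
move=> nu0 y.
have -> : (1 - 'X ^+ 2) * hatw (nu + 1) i j =
   wsum nu (i + j + 2) (fun k => (2 * nu + 1) *
    (wcoef L (nu + 1) (k - 1) (i - k + 1) (j - k + 1)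
       / (2 * ((i - k + (j - k) + 2)%:~R + (nu + 1)))
     - wcoef L (nu + 1) k (i - k) (j - k) / (2 * ((i - k + (j - k))%:~R + (nu + 1))))).
  pose b k := wcoef L (nu + 1) k (i - k) (j - k) / (2 * ((i - k + (j - k))%:~R + (nu + 1))).
  transitivity ((2 * nu + 1) *: (wsum nu (i + j) b - wsum nu (i + j + 2) b)).
    rewrite /hatw /wsum mulr_sumr -sumrB scaler_sumr; apply: eq_bigr => k _.
    rewrite -scalerBr /b -scalerAr.
    have [H|H] := ltP (i - k%:Z + (j - k%:Z)) 0.
      by rewrite wcoef_out ?mul0r ?scale0r ?scaler0//; lia.
    have [n Hn] := int_nat H.
    rewrite (_ : i + j - 2 * k%:Z = n); last by lia.
    rewrite (_ : i + j + 2 - 2 * k%:Z = n.+2); last by lia.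
    rewrite [ultraz (nu + 1) n]/= ultraS_1subX2// Hn !scalerA; congr (_ *: _).
    have n0 := ler0n R n; rewrite -[n%:~R]/(n%:R).
    by field; rewrite !gt_eqF//; lra.
  rewrite (@wsum_shift _ (i + j)) /b ?wcoef_out ?mul0r//; try lia.
  rewrite wsumN wsumD wsumZ; apply: eq_wsum => // k.
  rewrite (_ : i - (k - 1) + (j - (k - 1)) = i - k + (j - k) + 2); last by lia.
  by congr (_ * (wcoef _ _ _ _ _ / _ - _)); lia.
rewrite hatwD2r hatwB2r mulX_hatwD1r// mulX_hatwB1r// mulXX_hatw// (hatw_shift nu).
rewrite !wsumZ !wsumN !wsumD; apply: eq_wsum => // k.
have := @weight_coef_Pearson2 _ L nu k (i - k) (j - k) j%:~R y nu0.
move=> ->//; last by rewrite -intrD; congr (_%:~R); lia.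
by set D := (wcoef _ _ _ _ _ / _ - _); move: D => D; field; rewrite gt_eqF//; lra.
Qed.

End hat_weight.

(** * The matrix weight *)

Section matrix_weight.
Variables (R : realFieldType) (L : nat).
Implicit Types (nu : R).

Let sc (i : nat) : R := (i`! * (L - i)`!)%:R.

Let sc_neq0 i : sc i != 0.
Proof. by rewrite pnatr_eq0 muln_eq0 !negb_or -!lt0n !fact_gt0. Qed.

Definition Wpoly nu : 'M[{poly R}]_L.+1 :=
  \matrix_(i, j) ((sc i * sc j) *: hatw L nu i%:Z j%:Z).

Definition Xconst nu : 'M[R]_L.+1 := \matrix_(i, j)
  ((2 * (nu + i%:R) * (L%:R - i%:R)) *+ (j == i.+1 :> nat)
   + (2 * (nu + L%:R - i%:R) * i%:R) *+ (i == j.+1 :> nat)).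

Definition Xpoly nu : 'M[{poly R}]_L.+1 :=
  map_mx polyC (Xconst nu) + 'X *: map_mx polyC (4 *: Vmx R L).

Lemma XconstS nu : Xconst (nu + 1) = Xconst nu + 2 *: Cmx R L.
Proof.
apply/matrixP => i j; rewrite !mxE natrB ?leq_ord//.
by case: eqP => _; case: eqP => _; rewrite ?(mulr1n, mulr0n); ring.
Qed.

Lemma hatwC nu (i j : int) : hatw L nu i j = hatw L nu j i.
Proof.
apply: eq_wsum => [|k]; first by rewrite addrC.
rewrite /wcoef [in LHS]addrAC (addrC (i - k) (j - k)).
by rewrite -(mulrA (wf _ _ _)) (mulrC (wg _ _)) mulrA.
Qed.

Lemma Wpoly_tr nu : (Wpoly nu)^T = Wpoly nu.
Proof. by apply/matrixP => i j; rewrite !mxE hatwC [sc j * _]mulrC. Qed.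

(** Integer indices spare the borders: a neighbour outside 0, ..., L is an entry [hatw] equal to
    0. *)
Let sum_pick (F : int -> {poly R}) (m : int) :
  (forall l, (l < 0) || (L%:Z < l) -> F l = 0) ->
  \sum_(l < L.+1) F l%:Z *+ (l%:Z == m) = F m.
Proof.
move=> F0; have [mL|mL] := boolP ((m < 0) || (L%:Z < m)).
  rewrite (F0 _ mL) big1// => l _; have lL := ltn_ord l.
  by rewrite (_ : (l%:Z == m) = false)//; lia.
have mL' : (absz m < L.+1)%N by lia.
rewrite (bigD1 (Ordinal mL'))//= big1 ?addr0 => [|l lm].
  by rewrite (_ : Posz (absz m) = m) ?eqxx ?mulr1n//; lia.
rewrite (_ : (l%:Z == m) = false)//; apply: contraNF lm => /eqP lm.
by apply/eqP/val_inj => /=; lia.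
Qed.

Let sc_S (i : nat) : (i < L)%N -> sc i.+1 * (L%:R - i%:R) = sc i * (i%:R + 1).
Proof.
move=> iL; rewrite /sc factS -(subnSK iL) factS !natrM subnSK//.
have -> : L%:R - i%:R = (L - i)%:R :> R by rewrite natrB// ltnW.
by rewrite -natr1; ring.
Qed.

(** The scaling [sc] turns the factor L - i of X_nu above the diagonal into i + 1, and the factor i
    below it into L - i + 1. *)
Let Xpoly_Wpoly nu i j : (Xpoly nu *m Wpoly nu) i j = (sc i * sc j) *: (
  (2 * (nu + i%:Z%:~R) * (i%:Z%:~R + 1)) *: hatw L nu (i%:Z + 1) j
  + (2 * (nu + L%:R - i%:Z%:~R) * (L%:R - i%:Z%:~R + 1)) *: hatw L nu (i%:Z - 1) j
  - (4 * (i%:Z%:~R * (L%:R - i%:Z%:~R))) *: ('X * hatw L nu i j)).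
Proof.
have iL := leq_ord i.
rewrite mxE.
transitivity (\sum_(l < L.+1) (
   ((2 * (nu + i%:R) * (L%:R - i%:R)) * (sc l * sc j)) *: hatw L nu l%:Z j *+ (l%:Z == i%:Z + 1)
 + ((2 * (nu + L%:R - i%:R) * i%:R) * (sc l * sc j)) *: hatw L nu l%:Z j *+ (l%:Z == i%:Z - 1)
 - (4 * (i%:R * (L%:R - i%:R)) * (sc l * sc j)) *: ('X * hatw L nu l%:Z j) *+ (l%:Z == i%:Z))).
  apply: eq_bigr => l _; rewrite !mxE.
  have -> : (l == i.+1 :> nat) = (l%:Z == i%:Z + 1) by lia.
  have -> : (i == l.+1 :> nat) = (l%:Z == i%:Z - 1) by lia.
  have -> : (i == l) = (l%:Z == i%:Z) by rewrite -val_eqE/=; lia.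
  rewrite natrM natrB//.
  case: (l%:Z == i%:Z + 1); case: (l%:Z == i%:Z - 1); case: (l%:Z == i%:Z);
  by rewrite ?(mulr1n, mulr0n) -!mul_polyC !(polyCD, polyCN, polyCM, polyC0); ring.
rewrite !big_split/= sumrN.
pose scz (l : int) : R := if l is Posz n then sc n else 0.
have out l (z : R) : (l < 0) || (L%:Z < l) -> z *: hatw L nu l j%:Z = 0.
  by move=> H; rewrite hatw_out ?scaler0//; lia.
rewrite (sum_pick (F := fun l => (2 * (nu + i%:R) * (L%:R - i%:R) * (scz l * sc j)) *: hatw L nu l j));
  last by move=> *; exact: out.
rewrite (sum_pick (F := fun l => (2 * (nu + L%:R - i%:R) * i%:R * (scz l * sc j)) *: hatw L nu l j));
  last by move=> *; exact: out.
rewrite (sum_pick (F := fun l => (4 * (i%:R * (L%:R - i%:R)) * (scz l * sc j)) *: ('X * hatw L nu l j)));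
  last by move=> *; rewrite scalerAr out// mulr0.
rewrite scalerBr !scalerDr !scalerA.
congr (_ + _ - _).
- have [H|H] := eqVneq (i : nat) L; first by rewrite hatw_out ?scaler0//; lia.
  congr (_ *: _); rewrite (_ : i%:Z + 1 = i.+1); last by lia.
  rewrite /scz -[i%:Z%:~R]/(i%:R) [in RHS]mulrCA -!mulrA; congr (_ * (_ * _)).
  by rewrite mulrA [_ * sc i.+1]mulrC sc_S; [ring|lia].
- have [H|H] := posnP i; first by rewrite hatw_out ?scaler0//; lia.
  congr (_ *: _); have [i' Hi'] : exists i', i = i'.+1 :> nat by exists i.-1; lia.
  rewrite (_ : i%:Z - 1 = i'); last by lia.
  rewrite /scz -[i%:Z%:~R]/(i%:R) Hi' -[i'.+1%:R]natr1.
  have E : sc i'.+1 * (L%:R - i'%:R) = sc i' * (i'%:R + 1) by apply: sc_S; lia.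
  have -> : L%:R - (i'%:R + 1) + 1 = L%:R - i'%:R :> R by ring.
  transitivity (2 * (nu + L%:R - (i'%:R + 1)) * (sc i' * (i'%:R + 1)) * sc j); first by ring.
  by rewrite -E; ring.
- by congr (_ *: _); rewrite -[i%:Z%:~R]/(i%:R) /scz; ring.
Qed.

Lemma Xpoly_sym nu : 0 < nu -> Xpoly nu *m Wpoly nu = Wpoly nu *m (Xpoly nu)^T.
Proof.
move=> nu0; rewrite -[in RHS](Wpoly_tr nu) -trmx_mul; apply/matrixP => i j.
rewrite [RHS]mxE !Xpoly_Wpoly [sc j * _]mulrC; congr (_ *: _).
apply/eqP; rewrite -subr_eq0; apply/eqP.
rewrite -[RHS](hatw_sym L i j nu0) ![hatw _ _ _ i]hatwC -!mul_polyC.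
by rewrite !(polyCD, polyCN, polyCM); ring.
Qed.

(** Phi and Psi are read off the left-hand sides of [hatw_Pearson2] and [hatw_Pearson1], as
    combinations of neighbouring columns. The signs of the top coefficients keep n Phi_2 + Psi_1
    from vanishing for every n, as [mx_top_diag] requires. *)
Lemma Wpoly_Pearson nu : 0 < nu -> exists Phi Psi : 'M[{poly R}]_L.+1,
  [/\ Wpoly nu *m Phi = (1 - 'X ^+ 2) *: Wpoly (nu + 1),
      Wpoly nu *m Psi = map_mx (ultra_deriv nu) (Wpoly (nu + 1)),
      forall i j, (size (Phi i j) <= 3)%N /\ (size (Psi i j) <= 2)%N,
      forall i j, i != j -> (Phi i j)`_2 = 0 /\ (Psi i j)`_1 = 0 &
      forall i, (Phi i i)`_2 < 0 /\ (Psi i i)`_1 < 0].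
Proof.
move=> nu0; have L0 := ler0n R L.
(* [k1] and [k2] invert the constants of [hatw_Pearson1] and [hatw_Pearson2]; the quotient sc j / sc
   l below undoes the scaling of the entries. *)
pose k1 : R := (2 * nu + 1) / (nu * (L%:R + 2 * nu)).
pose k2 : R := (2 * nu + 1) / (2 * nu * (L%:R + 2 * nu) * (L%:R + 2 * nu + 1)).
have k10 : 0 < k1 by rewrite divr_gt0 ?mulr_gt0//; lra.
have k20 : 0 < k2 by rewrite divr_gt0 ?mulr_gt0//; lra.
pose y (j : nat) : R := L%:R - j%:R.
pose v (j : nat) := 4 * (nu + j%:R) * (nu + y j) + y j ^+ 2 + j%:R ^+ 2
  - 4 * j%:R * y j - y j - j%:R.
pose u (j : nat) := 4 * (nu + j%:R) * (nu + y j).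
pose Phi : 'M[{poly R}]_L.+1 := \matrix_(l, j) ((k2 * (sc j / sc l)) *: (
  ((j%:R + 1) * (j%:R + 2))%:P *+ (l%:Z == j%:Z + 2)
  + ((y j + 1) * (y j + 2))%:P *+ (l%:Z == j%:Z - 2)
  + ((2 * (2 * j%:R + 1 - L%:R) * (j%:R + 1)) *: 'X) *+ (l%:Z == j%:Z + 1)
  + ((2 * (L%:R - 2 * j%:R + 1) * (y j + 1)) *: 'X) *+ (l%:Z == j%:Z - 1)
  + ((v j)%:P - u j *: ('X * 'X)) *+ (l%:Z == j%:Z))).
pose Psi : 'M[{poly R}]_L.+1 := \matrix_(l, j) ((k1 * (sc j / sc l)) *: (
  ((nu + j%:R) * (j%:R + 1))%:P *+ (l%:Z == j%:Z + 1)
  + ((nu + y j) * (y j + 1))%:P *+ (l%:Z == j%:Z - 1)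
  - ((2 * (nu + j%:R) * (nu + y j)) *: 'X) *+ (l%:Z == j%:Z))).
have out i l (z : {poly R}) : (l < 0) || (L%:Z < l) -> hatw L nu i l * z = 0.
  by move=> H; rewrite hatw_out ?mul0r//; lia.
exists Phi, Psi; split.
- apply/matrixP => i j; rewrite !mxE.
  transitivity ((k2 * (sc i * sc j)) *: \sum_(l < L.+1) (
    hatw L nu i%:Z l%:Z * ((j%:R + 1) * (j%:R + 2))%:P *+ (l%:Z == j%:Z + 2)
  + hatw L nu i%:Z l%:Z * ((y j + 1) * (y j + 2))%:P *+ (l%:Z == j%:Z - 2)
  + hatw L nu i%:Z l%:Z * ((2 * (2 * j%:R + 1 - L%:R) * (j%:R + 1)) *: 'X) *+ (l%:Z == j%:Z + 1)
  + hatw L nu i%:Z l%:Z * ((2 * (L%:R - 2 * j%:R + 1) * (y j + 1)) *: 'X) *+ (l%:Z == j%:Z - 1)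
  + hatw L nu i%:Z l%:Z * ((v j)%:P - u j *: ('X * 'X)) *+ (l%:Z == j%:Z))).
    rewrite scaler_sumr; apply: eq_bigr => l _; rewrite !mxE -!mulrnAr -!mulrDr.
    rewrite -scalerAl -scalerAr !scalerA; congr (_ *: _).
    by have := sc_neq0 l; move: (sc l) => z z0; field.
  rewrite !big_split/= !(sum_pick (F := fun l => hatw L nu i l * _)); try by move=> *; exact: out.
  have := @hatw_Pearson2 _ L nu i j nu0; rewrite /= -[j%:Z%:~R]/(j%:R) => P2.
  transitivity ((sc i * sc j) *: (k2 *: ((2 * nu * (L%:R + 2 * nu) * (L%:R + 2 * nu + 1) / (2 * nu + 1)) *:
    ((1 - 'X ^+ 2) * hatw L (nu + 1) i j)))).
    rewrite -P2 [k2 * _]mulrC -[LHS]scalerA; congr (_ *: _); congr (_ *: _).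
    by rewrite -!mul_polyC /v /u /y; ring.
  rewrite -[RHS]scalerAr; congr (_ *: _).
  rewrite scalerA -[RHS]scale1r; congr (_ *: _); rewrite /k2; field.
  by rewrite !gt_eqF//; lra.
- apply/matrixP => i j; rewrite !mxE.
  transitivity ((k1 * (sc i * sc j)) *: \sum_(l < L.+1) (
    hatw L nu i%:Z l%:Z * ((nu + j%:R) * (j%:R + 1))%:P *+ (l%:Z == j%:Z + 1)
  + hatw L nu i%:Z l%:Z * ((nu + y j) * (y j + 1))%:P *+ (l%:Z == j%:Z - 1)
  + hatw L nu i%:Z l%:Z * (- ((2 * (nu + j%:R) * (nu + y j)) *: 'X)) *+ (l%:Z == j%:Z))).
    rewrite scaler_sumr; apply: eq_bigr => l _; rewrite !mxE -!mulrnAr -!mulrDr mulNrn.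
    rewrite -scalerAl -scalerAr !scalerA; congr (_ *: _).
    by have := sc_neq0 l; move: (sc l) => z z0; field.
  rewrite !big_split/= !(sum_pick (F := fun l => hatw L nu i l * _)); try by move=> *; exact: out.
  have := @hatw_Pearson1 _ L nu i j nu0; rewrite -[j%:Z%:~R]/(j%:R) => P1.
  rewrite ultra_derivZ.
  transitivity ((sc i * sc j) *: (k1 *: ((nu * (L%:R + 2 * nu) / (2 * nu + 1)) *:
    ultra_deriv nu (hatw L (nu + 1) i j)))).
    rewrite -P1 [k1 * _]mulrC -[LHS]scalerA; congr (_ *: _); congr (_ *: _).
    by rewrite -!mul_polyC /y; ring.
  congr (_ *: _).
  rewrite scalerA -[RHS]scale1r; congr (_ *: _); rewrite /k1; field.
  by rewrite !gt_eqF//; lra.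
- move=> i j; rewrite !mxE; split; apply: leq_trans (size_scale_leq _ _) _; apply/leq_sizeP => m Hm.
    rewrite !(coefD, coefN, coefMn, coefZ, coefC, coefX, coefXM).
    by case: m Hm => [|[|[|m]]]//= _; rewrite !(mulr0, mul0rn, addr0, subr0).
  rewrite !(coefD, coefN, coefMn, coefZ, coefC, coefX, coefXM).
  by case: m Hm => [|[|m]]//= _; rewrite !(mulr0, mul0rn, addr0, subr0).
- move=> i j ij; rewrite !mxE !(coefD, coefN, coefMn, coefZ, coefC, coefX, coefXM)/=.
  rewrite (_ : (i%:Z == j%:Z) = false); last by apply: contraNF ij => /eqP[/val_inj->].
  by rewrite !(mulr0n, mulr0, mul0rn, addr0, subr0).
- move=> i; rewrite !mxE !(coefD, coefN, coefMn, coefZ, coefC, coefX, coefXM)/= eqxx.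
  have y0 : 0 <= y i by rewrite subr_ge0 ler_nat leq_ord.
  have i0 := ler0n R i.
  rewrite !(mulr1n, mulr0, mul0rn, add0r, addr0, subr0) divff// !mulr1 !mulrN !oppr_lt0.
  have h1 : 0 < nu + i%:R by rewrite ltr_wpDr.
  have h2 : 0 < nu + y i by rewrite ltr_wpDr.
  by split; rewrite mulr_gt0// /u !mulr_gt0.
Qed.

End matrix_weight.

(** * Moments of the matrix weight, and its link with the given one *)

Section weight_moments.
Variables (R : realType) (L : nat).
Implicit Types (nu : R).

Lemma ultra_momentD nu (p q : {poly R}) : 0 < nu ->
  ultra_moment nu (p + q) = ultra_moment nu p + ultra_moment nu q.
Proof. by move=> nu0; rewrite -[p]scale1r ultra_moment_linear// mul1r scale1r. Qed.

Lemma ultra_moment0 nu : 0 < nu -> ultra_moment nu 0 = 0.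
Proof.
move=> nu0; have := ultra_momentD 0 0 nu0; rewrite addr0 => /eqP.
by rewrite -subr_eq0 opprD addrA subrr sub0r oppr_eq0 => /eqP.
Qed.

Lemma ultra_momentZ nu c (p : {poly R}) : 0 < nu ->
  ultra_moment nu (c *: p) = c * ultra_moment nu p.
Proof.
by move=> nu0; rewrite -[c *: p]addr0 ultra_moment_linear// ultra_moment0// addr0.
Qed.

Lemma ultra_moment_sum nu (I : Type) (r : seq I) (F : I -> {poly R}) : 0 < nu ->
  ultra_moment nu (\sum_(i <- r) F i) = \sum_(i <- r) ultra_moment nu (F i).
Proof.
move=> nu0; elim: r => [|x r IH]; first by rewrite !big_nil ultra_moment0.
by rewrite !big_cons ultra_momentD// IH.
Qed.

Lemma ultra_moment_ultra nu n : 0 < nu -> ultra_moment nu (ultra nu n.+1) = 0.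
Proof.
move=> nu0; have := ultra_moment_deriv (ultra (nu + 1) n) nu0.
rewrite ultra_deriv_ultraS// ultra_momentZ// => /eqP; rewrite mulf_eq0 => /orP[|/eqP//].
by rewrite oppr_eq0 gt_eqF//; lra.
Qed.

Lemma hatw_moment nu (i j : nat) : 0 < nu -> (i <= L)%N ->
  ultra_moment nu (hatw L nu i j) =
  if i == j then wcoef L nu i 0 0 * ultra_moment nu 1 else 0.
Proof.
move=> nu0 iL; rewrite ultra_moment_sum//.
have Z k : ultra_moment nu (wcoef L nu k (i%:Z - k) (j%:Z - k) *:
    ultraz nu (i%:Z + j%:Z - 2 * k)) =
    if (i == j) && (k == i%:Z) then wcoef L nu i 0 0 * ultra_moment nu 1 else 0.
  rewrite ultra_momentZ//; case: ifPn => [/andP[/eqP-> /eqP->]|H].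
    rewrite subrr (_ : j%:Z + j%:Z - 2 * j%:Z = 0) ?ultra0//; lia.
  have [out|out] := boolP [|| k < 0, i%:Z - k < 0, j%:Z - k < 0 | L%:Z < k + (i%:Z - k) + (j%:Z - k)].
    by rewrite wcoef_out// mul0r.
  have : 0 < i%:Z + j%:Z - 2 * k by lia.
  by case: (_ - _) => [[|n]|n]// _; rewrite ultra_moment_ultra// mulr0.
under eq_bigr do rewrite Z.
case: (i == j) => /=; last by rewrite big1.
have iL4 : (i < L.+4)%N by lia.
rewrite (bigD1 (Ordinal iL4))//= eqxx big1 ?addr0// => k ki; rewrite ifF//.
by apply: contraNF ki => /eqP[H]; apply/eqP/val_inj.
Qed.

Lemma Wpoly_moment nu : 0 < nu -> exists h : nat -> R,
  [/\ map_mx (ultra_moment nu) (Wpoly L nu) = diag_mx (\row_i h i),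
   forall i, (i <= L)%N -> 0 < h i &
   forall i, (i < L)%N ->
     h i.+1 * (L%:R - i%:R) * (nu + i%:R + 1) = h i * (i%:R + 1) * (nu + L%:R - i%:R)].
Proof.
move=> nu0; have L0 := ler0n R L.
exists (fun i => (i`! * (L - i)`!)%:R ^+ 2 * (wcoef L nu i 0 0 * ultra_moment nu 1)).
have m0 := ultra_moment1_gt0 nu0.
have P0 n : 0 < \prod_(u < n) (nu + u%:R).
  by apply: prodr_gt0 => u _; rewrite ltr_wpDr.
have wE (i : nat) : (i <= L)%N -> wcoef L nu i 0 0 =
    (\prod_(s < i) (nu + L%:R - s%:R)) / i`!%:R /
    ((\prod_(u < i.+1) (nu + u%:R)) * (L - i)`!%:R) * nu.
  have wg0 : wg nu 0 = 1 by rewrite -[0]/(Posz 0) /wg big_ord0 divr1.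
  by move=> iL; rewrite /wcoef !addr0 wg0 !mulr1 add0r /we iL.
split.
- apply/matrixP => i j; rewrite !mxE ultra_momentZ// hatw_moment ?leq_ord//.
  by rewrite -val_eqE; case: eqP => [->|_]; rewrite ?mulr0// mulr1n expr2.
- move=> i iL; rewrite wE// !mulr_gt0 ?divr_gt0 ?exprn_gt0 ?ltr0n ?muln_gt0 ?fact_gt0//.
    apply: prodr_gt0 => s _; have : (s : nat)%:R <= L%:R :> R.
      by rewrite ler_nat; have := ltn_ord s; lia.
    by move=> h; lra.
  by rewrite invr_gt0 mulr_gt0 ?P0 ?ltr0n ?fact_gt0.
- move=> i iL; rewrite !wE//; last exact: ltnW.
  rewrite [\prod_(s < i.+1) (nu + L%:R - _)]big_ord_recr.
  rewrite [\prod_(u < i.+2) _]big_ord_recr/= factS -(subnSK iL) factS !natrM subnSK//.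
  have E : (L - i)%:R = L%:R - i%:R :> R by rewrite natrB// ltnW.
  rewrite !E -[i.+1%:R]natr1.
  have hp := P0 i.+1; move: (\prod_(u < i.+1) (nu + u%:R)) hp => A A0.
  move: (\prod_(s < i) (nu + L%:R - s%:R)) => B.
  have f0 : i`!%:R != 0 :> R by rewrite pnatr_eq0 -lt0n fact_gt0.
  have g0 : (L - i.+1)`!%:R != 0 :> R by rewrite pnatr_eq0 -lt0n fact_gt0.
  have Li : 0 < L%:R - i%:R :> R by rewrite -E ltr0n subn_gt0.
  have i0 := ler0n R i.
  by field; rewrite f0 g0 !gt_eqF//; lra.
Qed.

(** The factors of [alpha] regroup into those of [wcoef]; the sign (-1)^k cancels against that of
    (-2l - nu)_k. *)
Lemma weight_Wpoly nu x (i j : 'I_L.+1) : 0 < nu ->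
  weight L nu x i j = (1 - x ^+ 2) `^ (nu - 2^-1) *
   (((nu + L%:R) / L`!%:R) *: Wpoly L nu i j).[x].
Proof.
move=> nu0; have nu20 : 0 < 2 * nu by lra.
have iL := leq_ord i; have jL := leq_ord j; have L0 := ler0n R L.
rewrite !mxE; congr (_ * _).
have prodE (a : R) n : 0 < a -> pochhammer a n = \prod_(s < n) (a + s%:R).
  move=> a0; elim: n => [|n IH]; first by rewrite big_ord0 pochhammer0.
  by rewrite pochhammerS// big_ord_recr/= IH mulrC.
pose G k := (nu + L%:R) / L`!%:R * ((i`! * (L - i)`!)%:R * (j`! * (L - j)`!)%:R *
  (wcoef L nu k%:Z (i%:Z - k%:Z) (j%:Z - k%:Z) *: ultraz nu (i%:Z + j%:Z - 2 * k%:Z)).[x]).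
(* Outside the summation range of [weight] the extended coefficients are 0. *)
have G0 k : ~~ ((i + j - L <= k) && (k < (minn i j).+1))%N -> G k = 0.
  by move=> H; rewrite /G wcoef_out ?scale0r ?horner0 ?mulr0//; lia.
have -> : ((nu + L%:R) / L`!%:R *: (((i`! * (L - i)`!)%:R * (j`! * (L - j)`!)%:R) *:
    hatw L nu i j)).[x] = \sum_(0 <= k < L.+4) G k.
  rewrite !hornerZ /hatw horner_sum !mulr_sumr big_mkord.
  by apply: eq_bigr => k _; rewrite /G.
have min1 : (i + j - L <= (minn i j).+1)%N by lia.
have min2 : ((minn i j).+1 <= L.+4)%N by lia.
have min3 : (i + j - L <= L.+4)%N by lia.
rewrite [RHS](@big_cat_nat _ _ _ (i + j - L))//= [X in _ = X + _]big_nat.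
rewrite [X in _ = X + _]big1 ?add0r; last by move=> k kn; apply: G0; lia.
rewrite [RHS](@big_cat_nat _ _ _ (minn i j).+1)//= [X in _ = _ + X]big_nat.
rewrite [X in _ = _ + X]big1 ?addr0; last by move=> k kn; apply: G0; lia.
rewrite big_nat [RHS]big_nat; apply: eq_bigr => k kn.
have ki : (k <= i)%N by lia. have kj : (k <= j)%N by lia.
have [p pE] : exists p, p = (i - k)%N by eexists.
have [q qE] : exists q, q = (j - k)%N by eexists.
have sL : (k + p + q <= L)%N by lia.
have iE : nat_of_ord i = (k + p)%N by lia.
have jE : nat_of_ord j = (k + q)%N by lia.
rewrite /G /alpha -pE -qE.
have -> : i%:Z - k%:Z = p by lia.
have -> : j%:Z - k%:Z = q by lia.
have -> : i%:Z + j%:Z - 2 * k%:Z = (p + q)%N by lia.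
have -> : (i + j - 2 * k = p + q)%N by lia.
have -> : (i + j - k = k + p + q)%N by lia.
have -> : (L + k - (i + j) = L - (k + p + q))%N by lia.
rewrite hornerZ gegenbauer_ultra// hornerZ [ultraz _ _]/=.
move: ((ultra nu (p + q)).[x]) => U.
rewrite /wcoef -!PoszD /wf /wg /we sL -[(p + q)%:~R]/((p + q)%:R).
have -> : \prod_(0 <= s < k) (- L%:R - nu + s%:R) =
    (-1) ^+ k * \prod_(s < k) (nu + L%:R - s%:R).
  rewrite big_mkord -[k in (-1) ^+ k]card_ord -prodrN; apply: eq_bigr => s _; ring.
rewrite !prodE// big_ord_recr/=.
have Pn n : \prod_(s < n) (nu + s%:R) != 0.
  by apply/prodf_neq0 => u _; rewrite gt_eqF// ltr_wpDr.
have P2n n : \prod_(s < n) (2 * nu + s%:R) != 0.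
  by apply/prodf_neq0 => u _; rewrite gt_eqF// ltr_wpDr.
have F0 n : n`!%:R != 0 :> R by rewrite pnatr_eq0 -lt0n fact_gt0.
have := Pn (k + p + q)%N; have := P2n (p + q)%N.
move: (\prod_(s < p) _) (\prod_(s < q) _) (\prod_(s < k + p + q) _)
  (\prod_(s < p + q) _) (\prod_(s < k) _) => A B D E F1 E0 D0.
have s1 : ((-1) ^+ k * (-1) ^+ k) = 1 :> R by rewrite -exprMn mulrNN mulr1 expr1n.
rewrite !natrM.
have := F0 p; have := F0 q; have := F0 k; have := F0 (p + q)%N.
have := F0 (L - (k + p + q))%N; have := F0 L.
move: (p`!%:R : R) (q`!%:R : R) (k`!%:R : R) ((p + q)`!%:R : R)
  ((L - (k + p + q))`!%:R : R) (L`!%:R : R) (i`!%:R : R) (j`!%:R : R) ((L - i)`!%:R : R)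
  ((L - j)`!%:R : R) => a1 a2 a3 a4 a5 a6 a7 a8 a9 a10 h6 h5 h4 h3 h2 h1.
have kpq := ler0n R (k + p + q).
transitivity (((-1) ^+ k * (-1) ^+ k) * ((L%:R + nu) / a6) * (a7 * a8 * a9 * a10) *
  (F1 * A * B / (a1 * a2 * a3 * a5 * D)) * ((p + q)%:R + nu) / ((k + p + q)%:R + nu) * U).
  by field; rewrite h1 h2 h3 h4 h5 h6 E0 D0 !gt_eqF//; lra.
by rewrite s1; field; rewrite h1 h2 h3 h5 h6 D0 !gt_eqF//; lra.
Qed.

End weight_moments.

(** * Commutators of orthogonal matrix polynomials *)

Section orthogonality.
Variables (R : realType) (L : nat).
Implicit Types (nu : R) (n : nat) (H : 'M[{poly R}]_L.+1).

Local Notation W := (Wpoly L).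
Local Notation pC := (map_mx polyC).
Local Notation dmx := (map_mx (@deriv R)).
Local Notation C := (pC (Cmx R L)).
Local Notation V := (pC (Vmx R L)).

Definition mx_orthogonal nu n H := forall (q : {poly R}) i j,
  (size q <= n)%N -> ultra_moment nu (q * (H *m W nu) i j) = 0.

(** The maps S and T_nu of the induction. *)
Definition commutator_C H := dmx H *m C - C^T *m dmx H + (V *m H - H *m V) *+ 2.
Definition commutator_X nu H := H *m Xpoly L nu - (Xpoly L nu)^T *m H.

Let dmxM (A B : 'M[{poly R}]_L.+1) : dmx (A *m B) = dmx A *m B + A *m dmx B.
Proof.
apply/matrixP => i j; rewrite !mxE raddf_sum -big_split; apply: eq_bigr => l _.
by rewrite /= derivM !mxE.
Qed.

Let dmxD (A B : 'M[{poly R}]_L.+1) : dmx (A + B) = dmx A + dmx B.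
Proof. by apply/matrixP => i j; rewrite !mxE derivD. Qed.

Let dmxN (A : 'M[{poly R}]_L.+1) : dmx (- A) = - dmx A.
Proof. by apply/matrixP => i j; rewrite !mxE derivN. Qed.

Let dmxMn (A : 'M[{poly R}]_L.+1) n : dmx (A *+ n) = dmx A *+ n.
Proof. by elim: n => [|n IH]; rewrite ?mulrS ?dmxD ?IH//; apply/matrixP => i j; rewrite !mxE derivC. Qed.

Let dmxC (A : 'M[R]_L.+1) : dmx (pC A) = 0.
Proof. by apply/matrixP => i j; rewrite !mxE derivC. Qed.

Let dmx_eq0 (A : 'M[{poly R}]_L.+1) : dmx A = 0 -> exists K, A = pC K.
Proof.
move=> /matrixP A0; exists (\matrix_(i, j) (A i j)`_0).
apply/matrixP => i j; rewrite !mxE; apply/polyP => k; rewrite coefC.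
case: k => [//|k] /=; have := A0 i j; rewrite !mxE => /polyP/(_ k).
by rewrite coef_deriv coef0 => /eqP; rewrite mulrn_eq0 => /eqP.
Qed.

Let trC (A : 'M[R]_L.+1) : (pC A)^T = pC A^T.
Proof. by rewrite map_trmx. Qed.

Lemma commutator_C_deriv H : dmx (commutator_C H) = commutator_C (dmx H).
Proof.
rewrite /commutator_C trC dmxD dmxMn !dmxD !dmxN !dmxM !dmxC.
by rewrite !(mul0mx, mulmx0, addr0, add0r).
Qed.

Let Vtr : (Vmx R L)^T = Vmx R L.
Proof. by apply/matrixP => i j; rewrite !mxE; case: eqVneq => [->|_]; rewrite ?eqxx// eq_sym; case: eqP. Qed.

Lemma commutator_X_deriv nu H : dmx (commutator_X nu H) =
  commutator_X (nu + 1) (dmx H) - commutator_C H *+ 2.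
Proof.
have X1 : Xpoly L (nu + 1) = Xpoly L nu + (C + C).
  rewrite /Xpoly XconstS; move: (Xconst L nu) (Cmx R L) (Vmx R L) => A B D.
  by apply/matrixP => i j; rewrite !mxE [2 * _]mulr_natl polyCD polyCMn; ring.
have X1t : (Xpoly L (nu + 1))^T = (Xpoly L nu)^T + (C^T + C^T).
  by rewrite X1; apply/matrixP => i j; rewrite [LHS]mxE mxE [in RHS]mxE; congr (_ + _); rewrite ?mxE.
have dX : dmx (Xpoly L nu) = V + V + (V + V).
  rewrite /Xpoly dmxD dmxC add0r; move: (Vmx R L) => A; apply/matrixP => i j.
  by rewrite !mxE derivM derivX mul1r derivC mulr0 addr0 mulr_natl polyCMn; ring.
have dXt : dmx (Xpoly L nu)^T = V + V + (V + V).
  by rewrite -map_trmx dX -[in RHS]Vtr -trC; apply/matrixP => i j; rewrite !mxE.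
rewrite /commutator_X /commutator_C dmxD dmxN !dmxM dX dXt X1t X1 !(mulmxDr, mulmxDl).
move: (dmx H *m C) (C^T *m dmx H) (V *m H) (H *m V) (dmx H *m _) (_^T *m dmx H) => a b c d e f.
by apply/matrixP => i j; rewrite !mxE; ring.
Qed.

Let moment_mulmx nu (q : {poly R}) H (Y : 'M[{poly R}]_L.+1) i j : 0 < nu ->
  ultra_moment nu (q * (H *m W nu *m Y) i j) =
  \sum_l ultra_moment nu ((q * Y l j) * (H *m W nu) i l).
Proof.
move=> nu0; rewrite [(_ *m Y) i j]mxE mulr_sumr ultra_moment_sum//.
by apply: eq_bigr => l _; congr (ultra_moment _ _); ring.
Qed.

(** The moment of [ultra_deriv nu (q H W_(nu+1))] is 0. By Leibniz and the Pearson equations the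
    argument is q' H W_nu Phi + q (1 - x^2) H' W_(nu+1) + q H W_nu Psi, whose middle term is a
    moment for nu + 1. *)
Let moment_deriv nu (q : {poly R}) H (Phi Psi : 'M[{poly R}]_L.+1) i j : 0 < nu ->
  W nu *m Phi = (1 - 'X ^+ 2) *: W (nu + 1) ->
  W nu *m Psi = map_mx (ultra_deriv nu) (W (nu + 1)) ->
  ultra_moment (nu + 1) (q * (dmx H *m W (nu + 1)) i j) =
  - \sum_l ultra_moment nu ((q^`() * Phi l j + q * Psi l j) * (H *m W nu) i l).
Proof.
move=> nu0 EPhi EPsi; rewrite ultra_momentS//; apply/eqP; rewrite -addr_eq0; apply/eqP.
have := ultra_moment_deriv (q * (H *m W (nu + 1)) i j) nu0.
rewrite ultra_derivM.
have -> : (1 - 'X ^+ 2) * (H *m W (nu + 1)) i j = (H *m W nu *m Phi) i j.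
  by rewrite -mulmxA EPhi -scalemxAr [in RHS]mxE.
have -> : ultra_deriv nu ((H *m W (nu + 1)) i j) =
    (1 - 'X ^+ 2) * (dmx H *m W (nu + 1)) i j + (H *m W nu *m Psi) i j.
  rewrite -mulmxA EPsi ![(_ *m _) i j]mxE mulr_sumr ultra_deriv_sum -big_split/=.
  by apply: eq_bigr => l _; rewrite ultra_derivM !mxE mulrCA.
move=> T0; rewrite -[RHS]T0 mulrDr !ultra_momentD// !moment_mulmx// mulrCA [RHS]addrCA; congr (_ + _).
by rewrite -big_split; apply: eq_bigr => l _; rewrite /= mulrDl ultra_momentD.
Qed.

(** The degree bounds on Phi and Psi make q' Phi + q Psi at most one degree higher than q. *)
Lemma mx_orthogonal_deriv nu n H : 0 < nu -> mx_orthogonal nu n.+1 H ->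
  mx_orthogonal (nu + 1) n (dmx H).
Proof.
move=> nu0 orthH q i j qn; have [Phi [Psi [EPhi EPsi szP _ _]]] := Wpoly_Pearson L nu0.
rewrite (moment_deriv _ _ _ _ nu0 EPhi EPsi) big1 ?oppr0// => l _; apply: orthH.
have [s1 s2] := szP l j.
apply: leq_trans (size_polyD _ _) _; rewrite geq_max; apply/andP; split.
  have [->|q0] := eqVneq q^`() 0; first by rewrite mul0r size_poly0.
  apply: leq_trans (size_polyMleq _ _) _.
  have q1 : q != 0 by apply: contraNneq q0 => ->; rewrite derivC.
  have := lt_size_deriv q1.
  by move: (size q) (size q^`()) (size (Phi l j)) qn s1 => a b c; lia.
apply: leq_trans (size_polyMleq _ _) _.
by move: (size q) (size (Psi l j)) qn s2 => a b; lia.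
Qed.

(** The first moment matrix that orthogonality leaves free. *)
Definition mx_top nu n H : 'M[R]_L.+1 :=
  \matrix_(i, j) ultra_moment nu ('X^n * (H *m W nu) i j).

Let moment_top nu n H (p : {poly R}) i j : 0 < nu -> mx_orthogonal nu n H ->
  (size p <= n.+1)%N ->
  ultra_moment nu (p * (H *m W nu) i j) = p`_n * mx_top nu n H i j.
Proof.
move=> nu0 orthH pn; rewrite [mx_top _ _ _ _ _]mxE.
have pE : p = p`_n *: 'X^n + (p - p`_n *: 'X^n) by rewrite addrC subrK.
rewrite [in LHS]pE mulrDl ultra_momentD// -scalerAl ultra_momentZ// orthH ?addr0//.
apply/leq_sizeP => k nk; rewrite coefB coefZ coefXn.
have [->|kn] := eqVneq k n; first by rewrite mulr1 subrr.
rewrite mulr0 subr0; apply: (leq_sizeP _ _ pn); lia.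
Qed.

(** Passing from (nu, n + 1, H) to (nu + 1, n, H') multiplies column j by the positive number - (n
    Phi_2 + Psi_1)_jj. At n = 0, H is a constant diagonal matrix and the moment of W_nu is diagonal
    and positive. *)
Lemma mx_top_diag nu n H : 0 < nu -> mx_orthogonal nu n H ->
  (forall i j, (size (H i j) <= n.+1)%N) ->
  (forall i j, i != j -> (H i j)`_n = 0) ->
  (forall i j, i != j -> mx_top nu n H i j = 0) /\
  (forall i, (H i i)`_n != 0 -> mx_top nu n H i i != 0).
Proof.
elim: n nu H => [|n IH] nu H nu0 orthH szH offH.
  have [h [hE h0 _]] := Wpoly_moment L nu0.
  have topE i j : mx_top nu 0 H i j = (H i j)`_0 * h j.
    rewrite mxE expr0 mul1r mxE ultra_moment_sum//.
    under eq_bigr => l _.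
      rewrite (size1_polyC (szH i l)) mul_polyC ultra_momentZ//.
      have -> : ultra_moment nu (W nu l j) = h j *+ (l == j).
        by have /matrixP/(_ l j) := hE; rewrite !mxE => ->; case: eqVneq => [->|].
      over.
    rewrite (bigD1 j)//= eqxx mulr1n big1 ?addr0//.
    by move=> l /negbTE->; rewrite mulr0n mulr0.
  split=> [i j ij|i Hi]; first by rewrite topE offH// mul0r.
  by rewrite topE mulf_neq0// gt_eqF// h0// leq_ord.
have nu10 : 0 < nu + 1 by lra.
have [Phi [Psi [EPhi EPsi szP offP diagP]]] := Wpoly_Pearson L nu0.
have topS i j : mx_top (nu + 1) n (dmx H) i j =
    - (n%:R * (Phi j j)`_2 + (Psi j j)`_1) * mx_top nu n.+1 H i j.
  rewrite mxE (moment_deriv _ _ _ _ nu0 EPhi EPsi).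
  have coefP l k : (('X^n)^`() * Phi l j + 'X^n * Psi l j)`_(n.+1 + k) =
      n%:R * (Phi l j)`_(2 + k) + (Psi l j)`_(1 + k).
    rewrite derivXn mulrnAl coefD coefMn !coefXnM [_ * _]mulr_natl.
    rewrite (_ : (n.+1 + k < n)%N = false); last by lia.
    rewrite (_ : (n.+1 + k < n.-1)%N = false); last by lia.
    rewrite (_ : (n.+1 + k - n = 1 + k)%N); last by lia.
    have [->|n0] := posnP n; first by rewrite !mulr0n.
    by rewrite (_ : (n.+1 + k - n.-1 = 2 + k)%N); last by lia.
  have topl l : ultra_moment nu ((('X^n)^`() * Phi l j + 'X^n * Psi l j) * (H *m W nu) i l)
     = (n%:R * (Phi l j)`_2 + (Psi l j)`_1) * mx_top nu n.+1 H i l.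
    have [s1 s2] := szP l j; rewrite (moment_top i l nu0 orthH).
      by rewrite -[n.+1 in X in X * _]addn0 coefP.
    apply/leq_sizeP => k nk; have [k' ->] : exists k', k = (n.+1 + k'.+1)%N.
      by exists (k - n.+2)%N; lia.
    by rewrite coefP (leq_sizeP _ _ s1)// (leq_sizeP _ _ s2)// mulr0 addr0.
  rewrite (bigD1 j)//= topl big1 ?addr0 ?mulNr// => l lj.
  by have [P2 P1] := offP _ _ lj; rewrite topl P2 P1 mulr0 addr0 mul0r.
have Hsz i j : (size (dmx H i j) <= n.+1)%N.
  rewrite mxE; apply/leq_sizeP => k nk; rewrite coef_deriv.
  by rewrite (leq_sizeP _ _ (szH i j)) ?mul0rn.
have Hoff i j : i != j -> (dmx H i j)`_n = 0.
  by move=> ij; rewrite mxE coef_deriv offH// mul0rn.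
have [IH1 IH2] := IH (nu + 1) (dmx H) nu10 (mx_orthogonal_deriv nu0 orthH) Hsz Hoff.
have cneq0 j : - (n%:R * (Phi j j)`_2 + (Psi j j)`_1) != 0.
  have [h1 h2] := diagP j; have n0 := ler0n R n.
  have h3 : n%:R * (Phi j j)`_2 <= 0 by rewrite mulr_ge0_le0// ltW.
  by rewrite gt_eqF//; lra.
split=> [i j ij|i Hi].
  have := IH1 i j ij; rewrite topS => /eqP; rewrite mulf_eq0 (negbTE (cneq0 j)) /=.
  by move/eqP.
have : mx_top (nu + 1) n (dmx H) i i != 0.
  by apply: IH2; rewrite mxE coef_deriv mulrn_eq0.
by rewrite topS; apply: contraNneq => ->; rewrite mulr0.
Qed.

Let Xpoly_entry nu (i j : 'I_L.+1) : Xpoly L nu i j =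
  (Xconst L nu i j)%:P + (4 * Vmx R L i j) *: 'X.
Proof.
rewrite /Xpoly; move: (Xconst L nu) (Vmx R L) => A B.
by rewrite !mxE ['X * _]mulrC mul_polyC.
Qed.

Let Vmx_off (i j : 'I_L.+1) : i != j -> Vmx R L i j = 0.
Proof. by move=> /negbTE ij; rewrite mxE ij mulr0n. Qed.

Lemma commutator_X_orthogonal nu n H : 0 < nu -> mx_orthogonal nu n H ->
  (forall i j, (size (H i j) <= n.+1)%N) ->
  (forall i j, i != j -> (H i j)`_n = 0) ->
  mx_orthogonal nu n (commutator_X nu H).
Proof.
move=> nu0 orthH szH offH q i j qn.
have [topH _] := mx_top_diag nu0 orthH szH offH.
set G := H *m W nu.
(* The symmetry relation moves X_nu through the weight, so both terms act on G = H W_nu. *)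
have -> : commutator_X nu H *m W nu = G *m (Xpoly L nu)^T - (Xpoly L nu)^T *m G.
  by rewrite mulmxBl -!mulmxA Xpoly_sym.
rewrite mxE [(- (_ *m _)) i j]mxE mulrBr -scaleN1r ultra_momentD// ultra_momentZ//.
have E (a b : 'I_L.+1) (l m : 'I_L.+1) : ultra_moment nu (q * Xpoly L nu a b * G l m) =
    4 * Vmx R L a b * ultra_moment nu ('X * q * G l m).
  rewrite Xpoly_entry mulrDr mulrDl ultra_momentD//.
  rewrite [q * _%:P]mulrC mul_polyC -scalerAl ultra_momentZ// orthH// mulr0 add0r.
  by rewrite -scalerAr -scalerAl ultra_momentZ// [q * 'X]mulrC.
have -> : ultra_moment nu (q * (G *m (Xpoly L nu)^T) i j) =
    4 * Vmx R L j j * ultra_moment nu ('X * q * G i j).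
  rewrite moment_mulmx// (bigD1 j)//= big1 ?addr0 => [|l lj]; last first.
    by rewrite [_^T _ _]mxE E Vmx_off 1?eq_sym// mulr0 mul0r.
  by rewrite [_^T _ _]mxE E.
have -> : ultra_moment nu (q * ((Xpoly L nu)^T *m G) i j) =
    4 * Vmx R L i i * ultra_moment nu ('X * q * G i j).
  rewrite [((_)^T *m G) i j]mxE mulr_sumr ultra_moment_sum//.
  rewrite (bigD1 i)//= big1 ?addr0 => [|l li]; last first.
    by rewrite [_^T _ _]mxE mulrA E Vmx_off// mulr0 mul0r.
  by rewrite [_^T _ _]mxE mulrA E.
(* On the diagonal the two entries of V coincide; off it, x q has degree at most n and [mx_top] is
   diagonal. *)
have [->|ij] := eqVneq i j; first by ring.
rewrite (moment_top _ _ nu0 orthH); last first.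
  have [->|q0] := eqVneq q 0; first by rewrite mulr0 size_poly0.
  by rewrite mulrC size_mulX.
by rewrite topH// !mulr0 addr0.
Qed.

Let mul_diagl (d : nat -> R) (D : 'M[R]_L.+1) (M : 'M[{poly R}]_L.+1) i j :
  (forall i j, D i j = d i *+ (i == j)) -> (pC D *m M) i j = d i *: M i j.
Proof.
move=> DE; rewrite mxE (bigD1 i)//= big1 ?addr0 => [|l li].
  by rewrite mxE DE eqxx mul_polyC.
by rewrite mxE DE eq_sym (negbTE li) mul0r.
Qed.

Let mul_diagr (d : nat -> R) (D : 'M[R]_L.+1) (M : 'M[{poly R}]_L.+1) i j :
  (forall i j, D i j = d i *+ (i == j)) -> (M *m pC D) i j = d j *: M i j.
Proof.
move=> DE; rewrite mxE (bigD1 j)//= big1 ?addr0 => [|l lj].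
  by rewrite mxE DE eqxx mulrC mul_polyC.
by rewrite mxE DE (negbTE lj) mulr0.
Qed.

Let VmxE (i j : 'I_L.+1) : Vmx R L i j = (- (i * (L - i))%:R : R) *+ (i == j).
Proof. by rewrite mxE. Qed.

Let vd (i : nat) : R := - (i * (L - i))%:R.

Let mulVl (M : 'M[{poly R}]_L.+1) i j : (V *m M) i j = vd i *: M i j.
Proof. by rewrite (@mul_diagl vd). Qed.

Let mulVr (M : 'M[{poly R}]_L.+1) i j : (M *m V) i j = vd j *: M i j.
Proof. by rewrite (@mul_diagr vd). Qed.

(** C and the constant part of X_nu are supported on the two diagonals next to the main one. *)
Let band_cases (P : 'I_L.+1 -> 'I_L.+1 -> Prop) :
  (forall i j : 'I_L.+1, (i < L)%N -> j = i.+1 :> nat -> P i j) ->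
  (forall i j : 'I_L.+1, (j < L)%N -> i = j.+1 :> nat -> P i j) ->
  (forall i j : 'I_L.+1, (j == i.+1 :> nat) = false -> (i == j.+1 :> nat) = false -> P i j) ->
  forall i j, P i j.
Proof.
move=> Pu Pd Po i j; have [ji|ji] := eqVneq (j : nat) i.+1.
  by apply: Pu => //; have := ltn_ord j; rewrite ji.
have [ij|ij] := eqVneq (i : nat) j.+1.
  by apply: Pd => //; have := ltn_ord i; rewrite ij.
by apply: Po; exact: negbTE.
Qed.

(** The two conclusions are carried together: T_(nu+1)(H') = 0 is what makes the derivative of
    T_nu(H) equal to - 2 S(H). *)
Lemma commutators_eq0 n nu H (d : nat -> R) : 0 < nu -> mx_orthogonal nu n H ->
  (forall i j, (size (H i j) <= n.+1)%N) ->
  (forall i j, (H i j)`_n = d i *+ (i == j)) ->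
  (forall i, (i < L)%N -> d i * (L%:R - i%:R) * (nu + n%:R + i%:R) =
     d i.+1 * (i%:R + 1) * (nu + n%:R + L%:R - i%:R - 1)) ->
  commutator_C H = 0 /\ commutator_X nu H = 0.
Proof.
elim: n nu H d => [|n IH] nu H d nu0 orthH szH leadH dE.
  (* For n = 0, H is a constant diagonal matrix: it commutes with V, and the recurrence for d says
     that H X_nu = X_nu^t H. *)
  have HE : H = pC (\matrix_(i, j) (d i *+ (i == j))).
    by apply/matrixP => i j; rewrite !mxE -leadH; apply: size1_polyC.
  split; apply/matrixP => i j.
    rewrite /commutator_C [in dmx H]HE dmxC mul0mx mulmx0 subr0 add0r.
    rewrite HE mulmxnE mxE [(- (_ *m _)) i j]mxE.
    rewrite mulVl mulVr !mxE.
    by case: eqVneq => [->|_]; rewrite ?subrr ?mul0rn// !scaler0 subrr mul0rn.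
  rewrite [RHS]mxE /commutator_X HE mxE [(- (_ *m _)) i j]mxE.
  have DE (a b : 'I_L.+1) : (\matrix_(i, j) (d i *+ (i == j))) a b = d a *+ (a == b).
    by rewrite mxE.
  rewrite (mul_diagl _ _ _ DE) (mul_diagr _ _ _ DE) [_^T i j]mxE !Xpoly_entry.
  rewrite !VmxE [j == i]eq_sym; have [->|ij] := eqVneq i j; first by rewrite subrr.
  rewrite !mulr0 !scale0r !addr0 -!mul_polyC -!polyCM -polyCB !mxE.
  apply/eqP; rewrite polyC_eq0; apply/eqP; move: i j {ij}; apply: band_cases.
  - move=> i j iL ji; have := dE i iL; rewrite ji eqxx (_ : (i == i.+2 :> nat) = false); last by lia.
    rewrite addr0 !(mulr1n, mulr0n) addr0 add0r -[i.+1%:R]natr1 => E.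
    by transitivity (2 * (d i * (L%:R - i%:R) * (nu + i%:R) -
       d i.+1 * (i%:R + 1) * (nu + L%:R - i%:R - 1))); [ring|rewrite E; ring].
  - move=> j i iL ji; have := dE i iL; rewrite ji eqxx (_ : (i == i.+2 :> nat) = false); last by lia.
    rewrite addr0 !(mulr1n, mulr0n) addr0 add0r -[i.+1%:R]natr1 => E.
    by transitivity (2 * (d i.+1 * (i%:R + 1) * (nu + L%:R - i%:R - 1) -
      d i * (L%:R - i%:R) * (nu + i%:R))); [ring|rewrite -E; ring].
  - by move=> i j -> ->; rewrite !mulr0n !addr0 !mulr0 subrr.
have nu10 : 0 < nu + 1 by lra.
have offH i j : i != j -> (H i j)`_n.+1 = 0.
  by move=> /negbTE ij; rewrite leadH ij.
have [S0 X0] : commutator_C (dmx H) = 0 /\ commutator_X (nu + 1) (dmx H) = 0.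
  apply: (IH _ _ (fun i => d i *+ n.+1) nu10 (mx_orthogonal_deriv nu0 orthH)).
  - move=> i j; rewrite mxE; apply/leq_sizeP => k nk; rewrite coef_deriv.
    by rewrite (leq_sizeP _ _ (szH i j)) ?mul0rn.
  - by move=> i j; rewrite mxE coef_deriv leadH -!mulrnA mulnC.
  - move=> i iL; have := dE i iL; rewrite -[n.+1%:R]natr1 => E.
    rewrite !mulrnAl; congr (_ *+ _).
    by transitivity (d i * (L%:R - i%:R) * (nu + (n%:R + 1) + i%:R)); [ring|rewrite E; ring].
have [K KE] : exists K, commutator_C H = pC K.
  by apply: dmx_eq0; rewrite commutator_C_deriv.
have [K0 XE] : exists K0, commutator_X nu H = pC K0 - 'X *: pC (K *+ 2).
  have : dmx (commutator_X nu H + 'X *: pC (K *+ 2)) = 0.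
    rewrite dmxD commutator_X_deriv X0 KE sub0r.
    apply/matrixP => i j; rewrite !mxE derivM derivX mul1r derivC mulr0 addr0.
    by rewrite polyCD addNr.
  by move=> /dmx_eq0[K0 E]; exists K0; rewrite -E addrK.
have orthX := commutator_X_orthogonal nu0 orthH szH offH.
have [h [hE h0 hS]] := Wpoly_moment L nu0.
have hneq0 (j : 'I_L.+1) : h j != 0 by rewrite gt_eqF// h0// leq_ord.
have mW (i j : 'I_L.+1) : ultra_moment nu (W nu i j) = h j *+ (i == j).
  by have /matrixP/(_ i j) := hE; rewrite !mxE => ->; case: eqVneq => [->|].
have mKW (A : 'M[R]_L.+1) i j : ultra_moment nu ((pC A *m W nu) i j) = A i j * h j.
  rewrite [(_ *m _) i j]mxE ultra_moment_sum// (bigD1 j)//= big1 ?addr0 => [|l lj].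
    by rewrite [(pC A) _ _]mxE mul_polyC ultra_momentZ// mW eqxx.
  by rewrite [(pC A) _ _]mxE mul_polyC ultra_momentZ// mW (negbTE lj) mulr0.
(* Once K = 0, T_nu(H) is constant and orthogonal to 1, hence 0 as the moment of W_nu is
   invertible. *)
suff K00 : K = 0.
  have E : commutator_X nu H = pC K0 by rewrite XE K00 mul0rn raddf0 scaler0 subr0.
  have K0z : K0 = 0.
    apply/matrixP => i j; rewrite mxE; apply: (mulIf (hneq0 j)); rewrite mul0r -mKW -E.
    by have := orthX 1 i j; rewrite mul1r; apply; rewrite size_poly1.
  by rewrite KE E K00 K0z !raddf0.
pose m1 (i j : 'I_L.+1) := ultra_moment nu ('X * W nu i j).
(* For n = 1, T_nu(H) is known to be orthogonal to constants only, which does not determine K; hence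
   the explicit computation. *)
case: n IH orthH szH leadH dE offH S0 X0 orthX => [|n] IH orthH szH leadH dE offH S0 X0 orthX.
  have orth0 i j : (H i j)`_0 * h j + d i * m1 i j = 0.
    have := orthH 1 i j; rewrite size_poly1 mul1r => /(_ isT) E0; rewrite -[RHS]E0.
    have HE : H = pC (\matrix_(i, j) (H i j)`_0) + 'X *: pC (\matrix_(i, j) (d i *+ (i == j))).
      apply/matrixP => a b; rewrite !mxE -leadH; apply/polyP => k.
      rewrite coefD coefC coefXM coefC; case: k => [|[|k]]/=; rewrite ?addr0 ?add0r//.
      by rewrite (leq_sizeP _ _ (szH a b)).
    rewrite [in RHS]HE mulmxDl [in RHS]mxE ultra_momentD// mKW [X in _ = X * _ + _]mxE; congr (_ + _).
    rewrite -scalemxAl [in RHS]mxE.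
    have DE (a b : 'I_L.+1) : (\matrix_(i, j) (d i *+ (i == j))) a b = d a *+ (a == b).
      by rewrite mxE.
    by rewrite (mul_diagl _ _ _ DE) -scalerAr ultra_momentZ.
  (* Moment of X_nu W_nu = W_nu X_nu^t. It gives the first moments of W_nu multiplied by V_ii -
     V_jj, the only form in which K needs them. *)
  have momX i j : 4 * (Vmx R L i i - Vmx R L j j) * m1 i j =
     Xconst L nu j i * h i - Xconst L nu i j * h j.
    have := Xpoly_sym L nu0 => /matrixP/(_ i j)/(congr1 (ultra_moment nu)).
    have E (a b l m : 'I_L.+1) : ultra_moment nu (Xpoly L nu a b * W nu l m) =
        Xconst L nu a b * (h m *+ (l == m)) + 4 * Vmx R L a b * m1 l m.
      rewrite Xpoly_entry mulrDl ultra_momentD// mul_polyC ultra_momentZ// mW.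
      by rewrite -scalerAl ultra_momentZ.
    rewrite [in X in X = _ -> _]mxE [in X in _ = X -> _]mxE !ultra_moment_sum//.
    under eq_bigr do rewrite E.
    under [X in _ = X -> _]eq_bigr do rewrite mulrC [(_^T) _ _]mxE E.
    rewrite !big_split/= (bigD1 j)//= big1 ?addr0; last first.
      by move=> l /negbTE lj; rewrite lj mulr0n mulr0.
    rewrite (bigD1 i)//= big1 ?addr0; last first.
      by move=> l li; rewrite Vmx_off 1?eq_sym// mulr0 mul0r.
    rewrite [X in _ = X + _ -> _](bigD1 i)//= [X in _ = _ + X + _ -> _]big1 ?addr0; last first.
      by move=> l li; rewrite eq_sym (negbTE li) mulr0n mulr0.
    rewrite [X in _ = _ + X -> _](bigD1 j)//= [X in _ = _ + (_ + X) -> _]big1 ?addr0; last first.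
      by move=> l lj; rewrite Vmx_off 1?eq_sym// mulr0 mul0r.
    rewrite !eqxx !mulr1n => /eqP; rewrite -subr_eq0 => /eqP EE.
    apply/eqP; rewrite -subr_eq0; apply/eqP; rewrite -[RHS]EE; ring.
  have KE2 i j : K i j = d i * Cmx R L i j - d j * Cmx R L j i + 2 * (vd i - vd j) * (H i j)`_0.
    have dHE : dmx H = pC (\matrix_(i, j) (d i *+ (i == j))).
      apply/matrixP => a b; rewrite !mxE -leadH; apply/polyP => k.
      rewrite coef_deriv coefC; case: k => [|k]//=.
      by rewrite (leq_sizeP _ _ (szH a b)) ?mul0rn.
    have := KE => /matrixP/(_ i j)/(congr1 (fun p : {poly R} => p`_0)).
    rewrite [(pC K) i j]mxE coefC eqxx => <-.
    have DE (a b : 'I_L.+1) : (\matrix_(i, j) (d i *+ (i == j))) a b = d a *+ (a == b).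
      by rewrite mxE.
    rewrite /commutator_C dHE mxE [(_ *m _ - _ *m _) i j]mxE [(- (_ *m _)) i j]mxE.
    rewrite (@mul_diagl d _ _ _ _ DE) (@mul_diagr d _ _ _ _ DE).
    rewrite mulmxnE [(_ *m _ - _ *m _) i j]mxE [(- (_ *m _)) i j]mxE mulVl mulVr trC.
    rewrite [(pC _) i j]mxE [(pC _) i j]mxE [(_^T) i j]mxE !(coefD, coefN, coefMn, coefZ, coefC)/=; ring.
  apply/matrixP => i j; rewrite [RHS]mxE.
  (* The constant term of H is eliminated by [orth0], then the first moment by [momX]. *)
  have K2 : 2 * h j * K i j = 2 * (d i * Cmx R L i j - d j * Cmx R L j i) * h j
     - d i * (Xconst L nu j i * h i - Xconst L nu i j * h j).
    rewrite -momX KE2 !VmxE !eqxx !mulr1n.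
    have -> : 2 * h j * (d i * Cmx R L i j - d j * Cmx R L j i + 2 * (vd i - vd j) * (H i j)`_0) =
      2 * (d i * Cmx R L i j - d j * Cmx R L j i) * h j +
      4 * (vd i - vd j) * ((H i j)`_0 * h j) by ring.
    have -> : (H i j)`_0 * h j = - (d i * m1 i j) by apply/eqP; rewrite -addr_eq0 orth0.
    by rewrite /vd; ring.
  have hj2 : 2 * h j != 0 by rewrite mulf_neq0// pnatr_eq0.
  apply: (mulfI hj2); rewrite mulr0 K2 => {K2 hj2 KE KE2 XE orthX}.
  move: i j; apply: band_cases.
  - move=> i j iL ji; rewrite !mxE ji eqxx (_ : (i == i.+2 :> nat) = false); last by lia.
    rewrite !(mulr1n, mulr0n) !(addr0, add0r) (natrB _ (ltnW iL)).
    have Li : 0 < L%:R - i%:R :> R by rewrite subr_gt0 ltr_nat.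
    have i0 := ler0n R i.
    have h1 : h i = h i.+1 * (L%:R - i%:R) * (nu + i%:R + 1) / ((i%:R + 1) * (nu + L%:R - i%:R)).
      by rewrite hS//; field; rewrite !gt_eqF//; lra.
    have d1 : d i.+1 = d i * (L%:R - i%:R) * (nu + 1 + i%:R) / ((i%:R + 1) * (nu + L%:R - i%:R)).
      rewrite dE//; field; rewrite !gt_eqF//; lra.
    by rewrite h1 d1 -[i.+1%:R]natr1; field; rewrite !gt_eqF//; lra.
  - move=> j i iL ji; rewrite !mxE ji eqxx (_ : (i == i.+2 :> nat) = false); last by lia.
    rewrite !(mulr1n, mulr0n) !(addr0, add0r) (natrB _ (ltnW iL)).
    have Li : 0 < L%:R - i%:R :> R by rewrite subr_gt0 ltr_nat.
    have i0 := ler0n R i.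
    have h1 : h i = h i.+1 * (L%:R - i%:R) * (nu + i%:R + 1) / ((i%:R + 1) * (nu + L%:R - i%:R)).
      by rewrite hS//; field; rewrite !gt_eqF//; lra.
    have d1 : d i.+1 = d i * (L%:R - i%:R) * (nu + 1 + i%:R) / ((i%:R + 1) * (nu + L%:R - i%:R)).
      rewrite dE//; field; rewrite !gt_eqF//; lra.
    by rewrite h1 d1 -[i.+1%:R]natr1; field; rewrite !gt_eqF//; lra.
  - by move=> i j H1 H2; rewrite !mxE H1 H2 !mulr0n !addr0 !mulr0 !mul0r subrr mulr0 mul0r mulr0 subrr.
(* [P1] is the monic orthogonal polynomial of degree 1; [A1] is the first moment of W_nu times the
   inverse of its zeroth moment. *)
pose A1 : 'M[R]_L.+1 := \matrix_(i, j) (m1 i j / h j).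
pose P1 : 'M[{poly R}]_L.+1 := 'X *: 1%:M - pC A1.
have P1W i j : (P1 *m W nu) i j = 'X * W nu i j - (pC A1 *m W nu) i j.
  by rewrite mulmxBl -scalemxAl mul1mx mxE [(- (_ *m _)) i j]mxE; congr (_ - _); rewrite mxE.
have orthP1 : mx_orthogonal nu 1 P1.
  move=> q i j /size1_polyC ->; rewrite mul_polyC ultra_momentZ// P1W -scaleN1r.
  by rewrite ultra_momentD// ultra_momentZ// mKW [A1 i j]mxE divfK// /m1; ring.
have P1E i j : P1 i j = 'X *+ (i == j) - (A1 i j)%:P.
  have PE (A : 'M[R]_L.+1) : ('X *: 1%:M - pC A) i j = 'X *+ (i == j) - (A i j)%:P.
    by rewrite !mxE mulrnAr mulr1.
  exact: PE.
have szP1 i j : (size (P1 i j) <= 2)%N.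
  apply/leq_sizeP => k k2; rewrite P1E coefB coefMn coefX coefC.
  by case: k k2 => [|[|k]]// _; rewrite mul0rn subr0.
have leadP1 i j : (P1 i j)`_1 = (i == j)%:R.
  by rewrite P1E coefB coefMn coefX coefC subr0.
have offP1 i j : i != j -> (P1 i j)`_1 = 0 by move=> /negbTE ij; rewrite leadP1 ij.
have [top0 topN] := mx_top_diag nu0 orthP1 szP1 offP1.
have topN0 i : mx_top nu 1 P1 i i != 0 by apply: topN; rewrite leadP1 eqxx oner_eq0.
(* T_nu(H) = K1 - 2 K P1. Pairing with 1 kills K1, and pairing with x then shows that K times the
   diagonal, invertible [mx_top] of P1 is 0. *)
pose K1 := K0 - (K *+ 2) *m A1.
have XE1 : commutator_X nu H = pC K1 - pC (K *+ 2) *m P1.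
  rewrite XE /P1 /K1 mulmxBr -scalemxAr mulmx1 -map_mxM map_mxB opprB addrA.
  by rewrite subrK.
have XW i j (q : {poly R}) : q * (commutator_X nu H *m W nu) i j =
    q * (pC K1 *m W nu) i j - \sum_l (K *+ 2) i l *: (q * (P1 *m W nu) l j).
  rewrite XE1 mulmxBl mxE [(- (_ *m _)) i j]mxE mulrBr; congr (_ - _).
  rewrite -mulmxA [(_ *m (_ *m _)) i j]mxE mulr_sumr; apply: eq_bigr => l _.
  by rewrite [(pC _) i l]mxE mul_polyC scalerAr.
have momXW i j (q : {poly R}) : (size q <= n.+2)%N ->
    ultra_moment nu (q * (pC K1 *m W nu) i j) =
    \sum_l (K *+ 2) i l * ultra_moment nu (q * (P1 *m W nu) l j).
  move=> qn; have := orthX q i j qn; rewrite XW -scaleN1r ultra_momentD// ultra_momentZ//.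
  rewrite ultra_moment_sum// mulN1r => /eqP; rewrite subr_eq0 => /eqP ->.
  by apply: eq_bigr => l _; rewrite ultra_momentZ.
have K10 : K1 = 0.
  apply/matrixP => i j; rewrite [RHS]mxE; apply: (mulIf (hneq0 j)); rewrite mul0r -mKW.
  have := momXW i j 1; rewrite size_poly1 mul1r => /(_ isT) ->.
  by rewrite big1// => l _; rewrite orthP1 ?mulr0// size_poly1.
apply/matrixP => i j; rewrite mxE.
have := momXW i j 'X; rewrite size_polyX K10 raddf0 mul0mx mxE mulr0 ultra_moment0// => /(_ isT)/esym.
rewrite (bigD1 j)//= big1 ?addr0 => [|l lj]; last first.
  by have := top0 l j lj; rewrite mxE expr1 => ->; rewrite mulr0.
have := topN0 j; rewrite mxE expr1 => tj /eqP; rewrite mulf_eq0 (negbTE tj) orbF.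
by rewrite mulmxnE mulrn_eq0 => /eqP.
Qed.

End orthogonality.

(** * Complex matrix polynomials *)

Section complex_matrices.
Variables (R : rcfType) (m : nat).
Implicit Types A B : 'M[R]_m.+1.
Local Open Scope complex_scope.

Definition complex_mx A B : 'M[R[i]]_m.+1 := \matrix_(i, j) (A i j +i* B i j).

Let complex_sum (I : Type) (r : seq I) (f g : I -> R) :
  \sum_(k <- r) (f k +i* g k) = (\sum_(k <- r) f k) +i* (\sum_(k <- r) g k).
Proof.
elim: r => [|k r IH]; first by rewrite !big_nil.
by rewrite !big_cons IH.
Qed.

Lemma complex_mxM A B A' B' : complex_mx A B *m complex_mx A' B' =
  complex_mx (A *m A' - B *m B') (A *m B' + B *m A').
Proof.
apply/matrixP => i j; rewrite !mxE -sumrB -big_split -complex_sum.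
by apply: eq_bigr => k _; rewrite !mxE.
Qed.

Lemma complex_mxD A B A' B' :
  complex_mx A B + complex_mx A' B' = complex_mx (A + A') (B + B').
Proof. by apply/matrixP => i j; rewrite !mxE. Qed.

Lemma complex_mxN A B : - complex_mx A B = complex_mx (- A) (- B).
Proof. by apply/matrixP => i j; rewrite !mxE. Qed.

Lemma real_complex_mx A : map_mx (real_complex R) A = complex_mx A 0.
Proof. by apply/matrixP => i j; rewrite !mxE. Qed.

Lemma conjtrmx_complex A B : conjtrmx (complex_mx A B) = complex_mx A^T (- B^T).
Proof. by apply/matrixP => i j; rewrite !mxE. Qed.

(** Matrices of polynomials rather than polynomials with matrix coefficients: the form in which the
    orthogonality arguments are stated. *)
Definition Re_mxpoly (p : {poly 'M[R[i]]_m.+1}) : 'M[{poly R}]_m.+1 :=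
  \matrix_(i, j) \poly_(k < size p) complex.Re (p`_k i j).
Definition Im_mxpoly (p : {poly 'M[R[i]]_m.+1}) : 'M[{poly R}]_m.+1 :=
  \matrix_(i, j) \poly_(k < size p) complex.Im (p`_k i j).

Lemma coef_Re_mxpoly p i j k : (Re_mxpoly p i j)`_k = complex.Re (p`_k i j).
Proof.
rewrite mxE coef_poly; case: ltnP => // /leq_sizeP H.
by rewrite H// mxE.
Qed.

Lemma coef_Im_mxpoly p i j k : (Im_mxpoly p i j)`_k = complex.Im (p`_k i j).
Proof.
rewrite mxE coef_poly; case: ltnP => // /leq_sizeP H.
by rewrite H// mxE.
Qed.

Lemma mxpoly_atE p x : mxpoly_at p x =
  complex_mx (map_mx (horner_eval x) (Re_mxpoly p)) (map_mx (horner_eval x) (Im_mxpoly p)).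
Proof.
apply/matrixP => i j; rewrite /mxpoly_at horner_coef summxE !mxE /horner_eval.
rewrite !horner_poly -complex_sum; apply: eq_bigr => k _.
have -> : (x%:C%:M : 'M[R[i]]_m.+1) ^+ k = ((x ^+ k)%:C)%:M.
  elim: (k : nat) => [|l IH]; first by rewrite !expr0.
  by rewrite !exprS IH rmorphM/= scalar_mxM.
rewrite -[p`_k * _]/(p`_k *m _) mul_mx_scalar mxE; case: (p`_k i j) => a b.
by apply/eqP; rewrite eq_complex /= !mul0r subr0 addr0 ![x ^+ k * _]mulrC !eqxx.
Qed.

Lemma Re_mxpoly_deriv p : Re_mxpoly p^`() = map_mx (@deriv R) (Re_mxpoly p).
Proof.
apply/matrixP => i j; apply/polyP => k.
rewrite coef_Re_mxpoly coef_deriv mulmxnE raddfMn /= [in RHS]mxE coef_deriv.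
by rewrite coef_Re_mxpoly.
Qed.

Lemma Im_mxpoly_deriv p : Im_mxpoly p^`() = map_mx (@deriv R) (Im_mxpoly p).
Proof.
apply/matrixP => i j; apply/polyP => k.
rewrite coef_Im_mxpoly coef_deriv mulmxnE raddfMn /= [in RHS]mxE coef_deriv.
by rewrite coef_Im_mxpoly.
Qed.

Lemma Re_mxpolyZ A p :
  Re_mxpoly ((map_mx (real_complex R) A)%:P * p) = map_mx polyC A *m Re_mxpoly p.
Proof.
apply/matrixP => i j; apply/polyP => k.
rewrite coef_Re_mxpoly coefCM [in RHS]mxE coef_sum [X in complex.Re X]mxE raddf_sum.
apply: eq_bigr => l _.
rewrite /= [map_mx polyC A i l]mxE coefCM coef_Re_mxpoly [map_mx _ A i l]mxE.
by case: (p`_k l j) => a b /=; rewrite mul0r subr0.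
Qed.

Lemma Im_mxpolyZ A p :
  Im_mxpoly ((map_mx (real_complex R) A)%:P * p) = map_mx polyC A *m Im_mxpoly p.
Proof.
apply/matrixP => i j; apply/polyP => k.
rewrite coef_Im_mxpoly coefCM [in RHS]mxE coef_sum [X in complex.Im X]mxE raddf_sum.
apply: eq_bigr => l _.
rewrite /= [map_mx polyC A i l]mxE coefCM coef_Im_mxpoly [map_mx _ A i l]mxE.
by case: (p`_k l j) => a b /=; rewrite mul0r addr0.
Qed.

End complex_matrices.

(** * Orthogonality and normalization of the given polynomials, and the first identity *)

Lemma ultra_moment_lead (R : realType) (nu : R) (p q : {poly R}) m : 0 < nu ->
  (forall k, (k < m)%N -> ultra_moment nu ('X ^+ k * p) = 0) -> (size q <= m.+1)%N ->
  ultra_moment nu (p * q) = q`_m * ultra_moment nu ('X ^+ m * p).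
Proof.
move=> nu0 p0 sq; rewrite [q in LHS](_ : _ = \poly_(k < m.+1) q`_k); last first.
  by apply/polyP => k; rewrite coef_poly; case: ltnP => // k1; rewrite nth_default ?(leq_trans sq).
rewrite poly_def mulr_sumr ultra_moment_sum// big_ord_recr/= big1 ?add0r.
  by rewrite -scalerAr ultra_momentZ// [p * _]mulrC.
by move=> k _; rewrite -scalerAr ultra_momentZ// [p * _]mulrC p0 ?mulr0.
Qed.

Section mvgegenbauer.
Variables (R : realType) (L : nat) (nu : R) (P : nat -> {poly 'M[R[i]]_L.+1}).
Hypotheses (nu0 : 0 < nu) (hP : monic_mvgegenbauer nu P).
Local Notation W := (Wpoly L nu).
Local Notation pC := (map_mx polyC).
Local Notation A n := (Re_mxpoly (P n)).
Local Notation B n := (Im_mxpoly (P n)).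

(** Real and imaginary parts of P_n W P_m^* with P = A + i B; W is real and its positive scalar
    factor drops out. *)
Lemma mvgegenbauer_orthogonal n m i j : n <> m ->
  ultra_moment nu ((A n *m W *m (A m)^T + B n *m W *m (B m)^T) i j) = 0 /\
  ultra_moment nu ((B n *m W *m (A m)^T - A n *m W *m (B m)^T) i j) = 0.
Proof.
move=> nm; pose c : R := (nu + L%:R) / L`!%:R.
have c0 : c != 0.
  rewrite mulf_neq0 ?invr_eq0 ?pnatr_eq0 -?lt0n ?fact_gt0//.
  by rewrite gt_eqF// ltr_wpDr.
have Ew x : weight L nu x = ((1 - x ^+ 2) `^ (nu - 2^-1) * c) *: map_mx (horner_eval x) W.
  by apply/matrixP => k l; rewrite weight_Wpoly// !mxE /horner_eval hornerZ mulrA.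
clearbody c; have := hP.2 n m nm => /matrixP/(_ i j); rewrite [RHS]mxE mxE => -[].
pose F x := mxpoly_at (P n) x *m map_mx (real_complex R) (weight L nu x)
         *m conjtrmx (mxpoly_at (P m) x).
pose X := A n *m W *m (A m)^T + B n *m W *m (B m)^T.
pose Y := B n *m W *m (A m)^T - A n *m W *m (B m)^T.
have FE x : F x = complex_mx
    (((1 - x ^+ 2) `^ (nu - 2^-1) * c) *: map_mx (horner_eval x) X)
    (((1 - x ^+ 2) `^ (nu - 2^-1) * c) *: map_mx (horner_eval x) Y).
  rewrite /F !mxpoly_atE real_complex_mx conjtrmx_complex !complex_mxM Ew.
  rewrite !mulmx0 subr0 add0r !map_trmx /X /Y map_mxD map_mxB !map_mxM.
  rewrite -!scalemxAr -!scalemxAl !mulmxN scalerN opprK.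
  rewrite -!scalerDr; apply: f_equal2 => //; apply: f_equal; exact: addrC.
have mom Z : \int[@lebesgue_measure R]_(x in `]-1, 1[)
    (((1 - x ^+ 2) `^ (nu - 2^-1) * c) * (Z : {poly R}).[x]) = c * ultra_moment nu Z.
  rewrite -ultra_momentZ//; apply: eq_Rintegral => x _.
  by rewrite hornerZ mulrA.
have FR x : complex.Re (F x i j) = (1 - x ^+ 2) `^ (nu - 2^-1) * c * (X i j).[x].
  by rewrite FE !mxE.
have FI x : complex.Im (F x i j) = (1 - x ^+ 2) `^ (nu - 2^-1) * c * (Y i j).[x].
  by rewrite FE !mxE.
rewrite -/F; under eq_Rintegral do rewrite -/(F _) FR.
under [X in _ -> X = _ -> _]eq_Rintegral do rewrite -/(F _) FI.
rewrite !mom => /eqP + /eqP; rewrite !mulf_eq0 (negPf c0)/= => /eqP-> /eqP->//.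
Qed.

Let coefP n : (P n)`_n = 1.
Proof. by have [sn /monicP] := hP.1 n; rewrite /lead_coef sn. Qed.

Let sizeA n i j : (size (A n i j) <= n.+1)%N.
Proof. by rewrite mxE (leq_trans (size_poly _ _))// (hP.1 n).1. Qed.

Let sizeB n i j : (size (B n i j) <= n.+1)%N.
Proof. by rewrite mxE (leq_trans (size_poly _ _))// (hP.1 n).1. Qed.

Let leadA n i j : (A n i j)`_n = (i == j)%:R.
Proof. by rewrite coef_Re_mxpoly coefP mxE; case: eqP. Qed.

Let leadB n i j : (B n i j)`_n = 0.
Proof. by rewrite coef_Im_mxpoly coefP mxE; case: eqP. Qed.

(** In the pairing with P_m the lower powers vanish by induction, and the leading coefficient of P_m
    is the real identity, so only the moment against x^m remains. *)
Lemma mvgegenbauer_orthogonal_X n m : (m < n)%N -> forall i j,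
  ultra_moment nu ('X ^+ m * (A n *m W) i j) = 0 /\
  ultra_moment nu ('X ^+ m * (B n *m W) i j) = 0.
Proof.
elim/ltn_ind: m => m IH mn i j.
have [] := @mvgegenbauer_orthogonal n m i j; first by move=> nm; rewrite nm ltnn in mn.
have E (M : 'M[{poly R}]_L.+1) (N : 'M[{poly R}]_L.+1) :
    (forall k, (k < m)%N -> forall l, ultra_moment nu ('X ^+ k * M i l) = 0) ->
    (forall l, size (N j l) <= m.+1)%N ->
    ultra_moment nu ((M *m N^T) i j) = \sum_l (N j l)`_m * ultra_moment nu ('X ^+ m * M i l).
  move=> M0 sN; rewrite mxE ultra_moment_sum//; apply: eq_bigr => l _.
  by rewrite [_^T _ _]mxE (ultra_moment_lead nu0 _ (sN l))// => k km; apply: M0.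
have A0 k : (k < m)%N -> forall l, ultra_moment nu ('X ^+ k * (A n *m W) i l) = 0.
  by move=> km l; have [] := IH k km (ltn_trans km mn) i l.
have B0 k : (k < m)%N -> forall l, ultra_moment nu ('X ^+ k * (B n *m W) i l) = 0.
  by move=> km l; have [] := IH k km (ltn_trans km mn) i l.
have EA (M : 'M[{poly R}]_L.+1) : (forall k, (k < m)%N -> forall l, ultra_moment nu ('X ^+ k * M i l) = 0) ->
    ultra_moment nu ((M *m (A m)^T) i j) = ultra_moment nu ('X ^+ m * M i j).
  move=> M0; rewrite E// (bigD1 j)//= leadA eqxx mul1r big1 ?addr0// => l lj.
  by rewrite leadA eq_sym (negPf lj) mul0r.
have EB (M : 'M[{poly R}]_L.+1) : (forall k, (k < m)%N -> forall l, ultra_moment nu ('X ^+ k * M i l) = 0) ->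
    ultra_moment nu ((M *m (B m)^T) i j) = 0.
  by move=> M0; rewrite E// big1// => l _; rewrite leadB mul0r.
rewrite [(_ + _ : 'M[{poly R}]_L.+1) i j]mxE [(_ - _ : 'M[{poly R}]_L.+1) i j]mxE.
rewrite [(- _ : 'M[{poly R}]_L.+1) i j]mxE -scaleN1r !ultra_momentD// ultra_momentZ//.
by rewrite (EA _ A0) (EB _ B0) (EA _ B0) (EB _ A0) mulr0 !addr0.
Qed.

Let orthogonalX n H (K : 'M[R]_L.+1) :
  (forall m, (m < n)%N -> forall i j, ultra_moment nu ('X ^+ m * (H *m W) i j) = 0) ->
  mx_orthogonal nu n (pC K *m H).
Proof.
move=> H0 q i j sq; rewrite -mulmxA mxE mulr_sumr ultra_moment_sum// big1// => l _.
rewrite mxE mulrCA mul_polyC ultra_momentZ//.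
case: n sq H0 => [|n] sq H0.
  by move: sq; rewrite leqn0 size_poly_eq0 => /eqP->; rewrite mul0r ultra_moment0// mulr0.
rewrite mulrC [q * _]mulrC (ultra_moment_lead nu0 _ sq) ?H0// ?mulr0 ?mul0r// => k kn.
by apply: H0; apply: ltn_trans kn _.
Qed.

Let d n (i : nat) : R := 'C(L, i)%:R * pochhammer (nu + n%:R) i
       / pochhammer (nu + n%:R + L%:R - i%:R) i.

(** Through [Gamma] both Pochhammer symbols get denominators independent of i, so consecutive values
    compare directly. *)
Let dE n (i : nat) : (i <= L)%N -> d n i = 'C(L, i)%:R * Gamma (nu + n%:R + i%:R) *
  Gamma (nu + n%:R + L%:R - i%:R) / (Gamma (nu + n%:R) * Gamma (nu + n%:R + L%:R)).
Proof.
move=> iL; rewrite /d /pochhammer subrK.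
have h1 := ler0n R n; have h2 := ler0n R L; have h := nu0.
have a0 : Gamma (nu + n%:R) != 0 by rewrite gt_eqF// Gamma_gt0//; lra.
have b0 : Gamma (nu + n%:R + L%:R) != 0 by rewrite gt_eqF// Gamma_gt0//; lra.
move: (Gamma (nu + n%:R)) (Gamma (nu + n%:R + L%:R)) (Gamma (nu + n%:R + i%:R))
  (Gamma (_ - _)) a0 b0 => a b c e a0 b0.
by rewrite invf_div; field; rewrite a0 b0.
Qed.

(** The recurrence asked of leading coefficients by [commutators_eq0]; this is what the
    normalization D_n achieves. *)
Let d_rec n (i : nat) : (i < L)%N -> d n i * (L%:R - i%:R) * (nu + n%:R + i%:R) =
  d n i.+1 * (i%:R + 1) * (nu + n%:R + L%:R - i%:R - 1).
Proof.
move=> iL; have h1 := ler0n R n; have h2 := ler0n R L; have h := nu0.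
have h3 := ler0n R i.
have h4 : i%:R + 1 <= L%:R :> R by rewrite natr1 ler_nat.
have := mul_bin_left L i => /(congr1 (fun k => k%:R : R)).
rewrite !natrM natrB ?(ltnW iL)// -[i.+1%:R]natr1 => Ebin.
rewrite !dE ?(ltnW iL)// -[i.+1%:R]natr1.
have -> : Gamma (nu + n%:R + (i%:R + 1)) = (nu + n%:R + i%:R) * Gamma (nu + n%:R + i%:R).
  by rewrite addrA Gamma_rec//; lra.
have -> : Gamma (nu + n%:R + L%:R - i%:R) = (nu + n%:R + L%:R - (i%:R + 1)) *
    Gamma (nu + n%:R + L%:R - (i%:R + 1)).
  by rewrite -Gamma_rec; [congr Gamma; ring | lra].
move: (_^-1) (Gamma (_ + _)) (Gamma (_ - _)) => a b c.
transitivity ((L%:R - i%:R) * 'C(L, i)%:R * (a * b * c * (nu + n%:R + i%:R) *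
  (nu + n%:R + L%:R - (i%:R + 1)))); first by ring.
by rewrite -Ebin; ring.
Qed.

Let Dmx_polyM n (H : 'M[{poly R}]_L.+1) : (pC (Dmx L nu n) *m H) = \matrix_(i, j) (d n i *: H i j).
Proof.
apply/matrixP => i j; rewrite mxE (bigD1 i)//= !mxE eqxx mul_polyC big1 ?addr0// => l li.
by rewrite !mxE eq_sym (negPf li) mulr0n mul0r.
Qed.

Theorem sym_mvgegenbauer_commutators n :
  commutator_C (Re_mxpoly (sym_mvgegenbauer nu P n)) = 0 /\
  commutator_C (Im_mxpoly (sym_mvgegenbauer nu P n)) = 0.
Proof.
rewrite /sym_mvgegenbauer Re_mxpolyZ Im_mxpolyZ; split.
  apply: (proj1 (@commutators_eq0 _ _ n nu _ (d n) nu0 _ _ _ _)).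
  - by apply: orthogonalX => m mn i j; exact: (mvgegenbauer_orthogonal_X mn i j).1.
  - by move=> i j; rewrite Dmx_polyM mxE (leq_trans (size_scale_leq _ _)).
  - by move=> i j; rewrite Dmx_polyM mxE coefZ leadA mulr_natr.
  - by move=> i; exact: d_rec.
(* The imaginary part has leading coefficient 0, and the zero sequence trivially satisfies the
   recurrence. *)
apply: (proj1 (@commutators_eq0 _ _ n nu _ (fun=> 0) nu0 _ _ _ _)).
- by apply: orthogonalX => m mn i j; exact: (mvgegenbauer_orthogonal_X mn i j).2.
- by move=> i j; rewrite Dmx_polyM mxE (leq_trans (size_scale_leq _ _)).
- by move=> i j; rewrite Dmx_polyM mxE coefZ leadB mulr0 mul0rn.
- by move=> i _; rewrite !mul0r.
Qed.

(** C and V are real, so the identity splits into those for the real and imaginary parts. *)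
Theorem sym_mvgegenbauer_C n x :
       mxpoly_at (sym_mvgegenbauer nu P n)^`() x *m Cmx R[i] L
         - (Cmx R[i] L)^T *m mxpoly_at (sym_mvgegenbauer nu P n)^`() x
       = - 2%:R *: mxbracket (Vmx R[i] L) (mxpoly_at (sym_mvgegenbauer nu P n) x).
Proof.
have [] := sym_mvgegenbauer_commutators n.
have CE : Cmx R[i] L = complex_mx (Cmx R L) 0.
  rewrite -real_complex_mx; apply/matrixP => i j.
  by rewrite !mxE rmorphD !rmorphMn.
have VE : Vmx R[i] L = complex_mx (Vmx R L) 0.
  rewrite -real_complex_mx; apply/matrixP => i j.
  by rewrite !mxE rmorphMn rmorphN rmorphMn.
move: (sym_mvgegenbauer nu P n) => p Rp Ip.
have E H : commutator_C H = 0 -> let M := map_mx (horner_eval x) H in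
    let N := map_mx (horner_eval x) (map_mx (@deriv R) H) in
    N *m Cmx R L - (Cmx R L)^T *m N = (M *m Vmx R L - Vmx R L *m M) *+ 2.
  move=> H0 M N; apply/eqP; rewrite -subr_eq0 -mulNrn opprB; apply/eqP.
  have pCE (K : 'M[R]_L.+1) : map_mx (horner_eval x) (pC K) = K.
    by apply/matrixP => i j; rewrite !mxE /horner_eval hornerC.
  have := congr1 (map_mx (horner_eval x)) H0.
  rewrite /commutator_C map_trmx !mulr2n !(map_mxD, map_mxN, map_mxM) /= !pCE => ->.
  by apply/matrixP => k l; rewrite !mxE /horner_eval horner0.
have := E _ Rp; have := E _ Ip; rewrite /= !mxpoly_atE Re_mxpoly_deriv Im_mxpoly_deriv.
move: (map_mx _ (Re_mxpoly p)) (map_mx _ (Im_mxpoly p)) => M N.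
move: (map_mx _ (map_mx _ (Re_mxpoly p))) (map_mx _ (map_mx _ (Im_mxpoly p))) => M' N'.
have trE (K : 'M[R]_L.+1) : (complex_mx K 0)^T = complex_mx K^T 0.
  by apply/matrixP => k l; rewrite !mxE.
move=> EI ER; rewrite /mxbracket CE VE trE !complex_mxM !(mulmx0, mul0mx, subr0, add0r, addr0).
rewrite !complex_mxN !complex_mxD ER EI scaleNr scaler_nat -mulNrn complex_mxN !opprB.
by rewrite [RHS]mulr2n complex_mxD !mulr2n.
Qed.
End mvgegenbauer.

Theorem proposition4p2 (R : realType) (L : nat) (nu : R) (hnu : 0 < nu) :
  (forall P : nat -> {poly 'M[R[i]]_L.+1},
     monic_mvgegenbauer nu P ->
     forall (n : nat) (x : R),
       mxpoly_at (sym_mvgegenbauer nu P n)^`() x *m Cmx R[i] L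
         - (Cmx R[i] L)^T *m mxpoly_at (sym_mvgegenbauer nu P n)^`() x
       = - 2%:R *: mxbracket (Vmx R[i] L) (mxpoly_at (sym_mvgegenbauer nu P n) x))
  /\
  (forall (n k : nat), (k <= L)%N ->
     Fmx L nu k n *m Cmx R L - (Cmx R L)^T *m Fmx L nu k n
     = (if (k < L)%N
        then (nu + L%:R + n%:R - k%:R - 1)^-1
               *: mxbracket (Fmx L nu k.+1 n) (Vmx R L)
        else 0)
       - (if (0 < k)%N
          then (nu + L%:R + n%:R - k%:R + 1)^-1
                 *: mxbracket (Fmx L nu k.-1 n) (Vmx R L)
          else 0)).
Proof.
split; first by move=> P hP n x; exact: sym_mvgegenbauer_C.
by move=> n k kL; exact: Fmx_commutator.
Qed.
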